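(* Let $n\ge1$, $t\in\mathbb{R}\setminus\{0\}$, let $Q$ be the $n\times n$ diagonal matrix with strictly positive eigenvalues $q_1,\dots,q_n$, and let $$g_n(x)=(2\pi\hbar)^{-n/2}e^{-\frac1{2\hbar}\langle x,Qx\rangle},\qquad x\in\mathbb{R}^n.$$ Then $$\sup_{f\in M^{\infty,1}(\mathbb{R}^n)\setminus\{0\}}\frac{\|e^{\frac{i\hbar t}{2}\Delta}f\|_{L^\infty(\mathbb{R}^n)}}{\|f\|_{M^{\infty,1}_{(g_n)}(\mathbb{R}^n)}}=\prod_{j=1}^n(t^2q_j^2+1)^{1/4}.$$
   Context: Fix $\hbar\in(0,1]$. The Fourier transform is $\hat f(\xi)=(2\pi\hbar)^{-n/2}\int_{\mathbb{R}^n}e^{-\frac i\hbar\xi\cdot x}f(x)\,dx$, extended to $\mathcal{S}'(\mathbb{R}^n)$. $e^{\frac{i\hbar t}{2}\Delta}$ is the propagator of the free Schrödinger equation $i\hbar\partial_tu=-\frac{\hbar^2}{2}\Delta u$, $u(0,\cdot)=f$, i.e. the Fourier multiplier $\widehat{e^{\frac{i\hbar t}{2}\Delta}f}(\xi)=e^{-\frac{it}{2\hbar}|\xi|^2}\hat f(\xi)$ on $\mathcal{S}'(\mathbb{R}^n)$; for Schwartz $f$, $e^{\frac{i\hbar t}{2}\Delta}f(x)=(2\pi i\hbar t)^{-n/2}\int_{\mathbb{R}^n}e^{\frac{i}{\hbar}\frac{|y|^2}{2t}}f(x-y)\,dy$. For $g\in\mathcal{S}(\mathbb{R}^n)$ and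 $f\in\mathcal{S}'(\mathbb{R}^n)$, $V_gf(x,\xi)$ is the Fourier transform of $f\,\overline{g(\cdot-x)}$ at $\xi$ (for functions, $V_gf(x,\xi)=(2\pi\hbar)^{-n/2}\int e^{-\frac i\hbar\xi\cdot y}f(y)\overline{g(y-x)}\,dy$). $\|f\|_{M^{\infty,1}_{(g)}(\mathbb{R}^n)}=\int_{\mathbb{R}^n}\sup_{x\in\mathbb{R}^n}|V_gf(x,\xi)|\,d\xi$, and $M^{\infty,1}(\mathbb{R}^n)$ is the space of $f\in\mathcal{S}'(\mathbb{R}^n)$ for which this is finite for some (equivalently every) $g\in\mathcal{S}(\mathbb{R}^n)\setminus\{0\}$. *)

(* Defs.v *)
From HB Require Import structures.
From mathcomp Require Import all_boot all_order all_algebra.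
From mathcomp Require Import complex.
From mathcomp Require Import all_classical all_reals all_analysis.

Set Implicit Arguments.
Unset Strict Implicit.
Unset Printing Implicit Defensive.

Import Order.TTheory GRing.Theory Num.Theory.
Import numFieldNormedType.Exports.

Local Open Scope classical_set_scope.
Local Open Scope ring_scope.
Local Open Scope complex_scope.

(* The library has a topology and derivatives on row vectors 'rV[R]_n, but its
   Borel sigma-algebra is on tuples.  Functions on R^n are functions on
   'rV[R]_n, and integrals over R^n are integrals over n.-tuple R of the
   composition with [row_of_tuple]. *)
Section LebesgueRn.
Context {R : realType}.
Local Notation mR := (measurableTypeR R).

Definition consr n (p : n.-tuple mR * mR) : n.+1.-tuple mR :=
  [the n.+1.-tuple mR of p.2 :: p.1].

Lemma measurable_consr n :
  measurable_fun [set: (n.-tuple mR * mR)%type] (@consr n).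
Proof. exact: (measurable_cons measurable_snd measurable_fst). Qed.

Definition lebesgue_step n (m : {measure set (n.-tuple mR) -> \bar R}) :
    set (n.+1.-tuple mR) -> \bar R :=
  pushforward (m \x lebesgue_measure)%E (@consr n).

HB.instance Definition _ n (m : {measure set (n.-tuple mR) -> \bar R}) :=
  Measure.copy (lebesgue_step m)
    (measure_function_pushforward__canonical__measure_function_Measure
       (m \x lebesgue_measure)%E (@measurable_consr n)).

Fixpoint lebesgue_Rn (n : nat) : {measure set (n.-tuple mR) -> \bar R} :=
  if n is n'.+1 then lebesgue_step (lebesgue_Rn n')
  else dirac ([tuple] : 0.-tuple mR).

Definition row_of_tuple n (s : n.-tuple mR) : 'rV[R]_n := \row_i tnth s i.

End LebesgueRn.

Section Functions.
Context {R : realType} {n : nat}.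
Local Notation Rn := 'rV[R]_n.
Local Notation C := (R[i]).
Local Notation mR := (measurableTypeR R).

Definition dot (x y : Rn) : R := (x *m y^T) 0 0.

Definition cis (a : R) : C := cos a +i* sin a.

Definition cintegral (f : Rn -> C) : C :=
  (\int[lebesgue_Rn n]_s complex.Re (f (row_of_tuple s)))%R +i*
  (\int[lebesgue_Rn n]_s complex.Im (f (row_of_tuple s)))%R.

Definition cmeasurable (f : Rn -> C) : Prop :=
  measurable_fun [set: n.-tuple mR] (fun s => complex.Re (f (row_of_tuple s)))
  /\
  measurable_fun [set: n.-tuple mR] (fun s => complex.Im (f (row_of_tuple s))).

(* The library does not make R[i] a normed space over R, so partial derivatives
   of complex-valued functions are taken on real and imaginary parts. *)
Definition pderivable (i : 'I_n) (f : Rn -> C) (x : Rn) : Prop :=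
  derivable (fun y => complex.Re (f y)) x (delta_mx 0 i) /\
  derivable (fun y => complex.Im (f y)) x (delta_mx 0 i).

Definition pderive (i : 'I_n) (f : Rn -> C) (x : Rn) : C :=
  ('D_(delta_mx 0 i) (fun y => complex.Re (f y)) x) +i*
  ('D_(delta_mx 0 i) (fun y => complex.Im (f y)) x).

(* Words over 'I_n play the role of multi-indices: [:: i1; ...; ik] stands for
   the derivative d_i1 ... d_ik and for the monomial x_i1 ... x_ik. *)
Definition pderives (r : seq 'I_n) (f : Rn -> C) : Rn -> C := foldr pderive f r.

Definition monomial (s : seq 'I_n) (x : Rn) : R := \prod_(i <- s) x 0 i.

Definition smooth (f : Rn -> C) : Prop :=
  forall r : seq 'I_n,
    [/\ continuous (fun x => complex.Re (pderives r f x)),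
        continuous (fun x => complex.Im (pderives r f x)) &
        forall i x, pderivable i (pderives r f) x].

Definition seminorm (s r : seq 'I_n) (f : Rn -> C) : \bar R :=
  ereal_sup
    (range (fun x => (`|monomial s x| * Normc.normc (pderives r f x))%:E)).

Definition schwartz (f : Rn -> C) : Prop :=
  smooth f /\ forall s r, (seminorm s r f < +oo)%E.

End Functions.

Section Distributions.
Context {R : realType} {n : nat}.
Local Notation Rn := 'rV[R]_n.
Local Notation C := (R[i]).

(* Tempered distributions are total functionals on functions, of which only the
   values at Schwartz functions are meaningful: they are linear there, and
   continuous (at 0) for the topology given by the seminorms. *)
Definition functional : Type := (Rn -> C) -> C.

Definition tempered (u : functional) : Prop :=
  (forall (a : C) (phi psi : Rn -> C), schwartz phi -> schwartz psi ->
     u (fun x => a * phi x + psi x) = a * u phi + u psi) /\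
  (forall e : R, 0 < e -> exists N : nat, exists2 d : R, 0 < d &
     forall phi : Rn -> C, schwartz phi ->
       (forall s r : seq 'I_n, (size s <= N)%N -> (size r <= N)%N ->
          (seminorm s r phi < d%:E)%E) ->
       Normc.normc (u phi) < e).

Definition nonzero (u : functional) : Prop :=
  exists2 phi, schwartz phi & u phi != 0.

Definition mul_dist (m : Rn -> C) (u : functional) : functional :=
  fun phi => u (fun x => m x * phi x).

Definition represents (h : Rn -> C) (u : functional) : Prop :=
  forall phi, schwartz phi -> u phi = cintegral (fun x => h x * phi x).

(* +oo (the infimum of the empty set) if u is not a function.  If h is not
   essentially bounded then its norm is +oo, so that representing functions h
   for which some h * phi fails to be integrable contribute nothing. *)
Definition Linfty_norm (u : functional) : \bar R :=
  ereal_inf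
    [set Lnorm (lebesgue_Rn n) +oo%E
           (fun s => (Normc.normc (h (row_of_tuple s)))%:E)
    | h in [set h | cmeasurable h /\ represents h u]].

End Distributions.

Section TimeFrequency.
Context {R : realType} {n : nat}.
Variable hbar : R.
Local Notation Rn := 'rV[R]_n.
Local Notation C := (R[i]).
Local Notation functional := (@functional R n).

Definition fourier_cst : C := ((2 * pi * hbar) `^ (- (n%:R / 2)))%:C.

Definition fourier (f : Rn -> C) (xi : Rn) : C :=
  fourier_cst * cintegral (fun x => cis (- (dot xi x / hbar)) * f x).

Definition ifourier (f : Rn -> C) (x : Rn) : C :=
  fourier_cst * cintegral (fun xi => cis (dot xi x / hbar) * f xi).

Definition fourier_dist (u : functional) : functional :=
  fun phi => u (fourier phi).

Definition ifourier_dist (u : functional) : functional :=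
  fun phi => u (ifourier phi).

Definition propagator (t : R) (f : functional) : functional :=
  ifourier_dist
    (mul_dist (fun xi => cis (- (t / (2 * hbar) * dot xi xi)))
      (fourier_dist f)).

(* The Fourier transform of u as a function of xi, for a functional u that can
   be applied to characters, such as [mul_dist g f] with g Schwartz and f
   tempered: then u (character) = f (g * character), and g * character is
   Schwartz. *)
Definition fourier_at (u : functional) (xi : Rn) : C :=
  fourier_cst * u (fun y => cis (- (dot xi y / hbar))).

Definition stft (g : Rn -> C) (f : functional) (x xi : Rn) : C :=
  fourier_at (mul_dist (fun y => (g (y - x))^*) f) xi.

Definition Minfty1_norm (g : Rn -> C) (f : functional) : \bar R :=
  (\int[lebesgue_Rn n]_s
     ereal_sup
       (range (fun x => (Normc.normc (stft g f x (row_of_tuple s)))%:E)))%E.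

Definition Minfty1 (f : functional) : Prop :=
  tempered f /\
  exists g : Rn -> C,
    [/\ schwartz g, (exists x, g x != 0) & (Minfty1_norm g f < +oo)%E].

Definition gauss_window (Q : 'M[R]_n) (x : Rn) : C :=
  ((2 * pi * hbar) `^ (- (n%:R / 2)) *
   expR (- ((2 * hbar)^-1 * dot x (x *m Q))))%:C.

End TimeFrequency.

(* Main.v *)
(* Upper bound.  Write m(xi) = exp(-i t |xi|^2 / (2 hbar)) and let G_(x, xi) be the
   time-frequency shifts of the Gaussian window.  For a Schwartz function phi
   and a Gaussian Gamma whose width is controlled by alpha > 0, the function
   F (m F^-1 phi) is, up to an explicit constant, the superposition over (a, xi)
   of the shifts G_(a - t xi, xi) with amplitudes
     m(xi) * int phi(z) exp(i xi.z / hbar) Gamma(z - a) dz.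
   A tempered distribution f commutes with such superpositions, which are limits
   of Riemann sums in every Schwartz seminorm.  Hence the propagated f is the
   function of z obtained by integrating
     m(xi) exp(i xi.z / hbar) Gamma(z - a) V_g f (a - t xi, xi)
   over (a, xi), and its modulus is at most the norm of f times a constant, equal
   to prod_j |1 + alpha q_j - i t q_j|^(1/2).  Let alpha tend to 0.
   Lower bound.  Take f(x) = exp(-|x|^2 / (2 hbar (alpha - i t))), which focuses at
   time t, and test the propagated f against exp(-|x|^2 / (2 hbar alpha^2)). *)
Require Import Defs.
From HB Require Import structures.
From mathcomp Require Import all_boot all_order all_algebra.
From mathcomp Require Import complex.
From mathcomp Require Import all_classical all_reals all_analysis.
From mathcomp Require Import measurable_realfun ess_sup_inf.
From mathcomp Require Import ring lra zify.

Import Order.TTheory GRing.Theory Num.Theory.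
Import numFieldNormedType.Exports.

Local Open Scope classical_set_scope.
Local Open Scope ring_scope.

Set Implicit Arguments.
Unset Strict Implicit.
Unset Printing Implicit Defensive.
Local Open Scope complex_scope.

(** Where the constant comes from: write U for the propagator and g for the window. Since U moves a
    packet at (x, xi) to (x + t xi, xi), the moduli of V_{Ug}(Uf)(z, xi) and V_g f(z - t xi, xi)
    agree, and Fourier inversion in xi at the point z bounds |Uf(z)| by (2 pi hbar)^(-n/2) / |Ug(0)|
    times the norm of f. Here |Ug(0)| = (2 pi hbar)^(-n/2) prod_j (1 + t^2 q_j^2)^(-1/4), so the
    normalisation of g cancels and the claimed product remains. The obstacle is that Uf is only
    given by duality and has no value at z. The Gaussian Gamma, of coefficient 1 / (hbar alpha), is
    a smeared point mass: for alpha > 0 the amplitudes decay rapidly in both variables, which lets f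
    pass through the integral, and the price is the term alpha q_j in the constant. In the lower
    bound, f is up to a scalar the Gaussian exp(-|x|^2 / (2 hbar alpha)) propagated backwards by
    time t; as alpha tends to 0 it approaches the chirp for which all contributions to Uf(0) are in
    phase. *)

Local Notation nc := Normc.normc.
Local Notation cRe := complex.Re.
Local Notation cIm := complex.Im.

(** * Complex-valued integrals *)
Section ComplexNumbers.
Context {R : realType}.
Local Notation C := (R[i]).
Implicit Types (a b c : C) (x y : R).

Lemma normcE a : nc a = Num.sqrt (cRe a ^+ 2 + cIm a ^+ 2).
Proof. by case: a. Qed.

Lemma normc_ge0 a : 0 <= nc a.
Proof. by rewrite normcE sqrtr_ge0. Qed.

Lemma sqr_normc a : nc a ^+ 2 = cRe a ^+ 2 + cIm a ^+ 2.
Proof. by rewrite normcE sqr_sqrtr// addr_ge0// sqr_ge0. Qed.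

Lemma normc_real x : nc x%:C = `|x|.
Proof. by rewrite normcE /= expr0n/= addr0 sqrtr_sqr. Qed.

Lemma normr_Re_le a : `|cRe a| <= nc a.
Proof. by rewrite normcE -sqrtr_sqr ler_wsqrtr// lerDl sqr_ge0. Qed.

Lemma normr_Im_le a : `|cIm a| <= nc a.
Proof. by rewrite normcE -sqrtr_sqr ler_wsqrtr// lerDr sqr_ge0. Qed.

Lemma Re_le_normc a : cRe a <= nc a.
Proof. by apply: le_trans (normr_Re_le a); exact: ler_norm. Qed.

Lemma normc_le_ReIm a : nc a <= `|cRe a| + `|cIm a|.
Proof.
rewrite -(ler_pXn2r (n := 2))// ?nnegrE ?normc_ge0// ?addr_ge0//.
rewrite sqr_normc -(real_normK (num_real (cRe a))) -(real_normK (num_real (cIm a))).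
have := normr_ge0 (cRe a); have := normr_ge0 (cIm a).
set u := `|cRe a|; set v := `|cIm a| => *; nra.
Qed.

Lemma normc_conj a : nc a^* = nc a.
Proof. by case: a => x y; rewrite !normcE /= sqrrN. Qed.

Lemma normc_eq0 a : (nc a == 0) = (a == 0).
Proof.
apply/eqP/eqP => [/Normc.eq0_normc//|->].
by rewrite normcE /= expr0n/= addr0 sqrtr0.
Qed.

Lemma normc_gt0 a : (0 < nc a) = (a != 0).
Proof. by rewrite lt_def normc_ge0 normc_eq0 andbT. Qed.

Lemma normc_sum (I : Type) (r : seq I) (P : pred I) (F : I -> C) :
  nc (\sum_(i <- r | P i) F i) <= \sum_(i <- r | P i) nc (F i).
Proof.
elim/big_rec2 : _ => [|i u v _ H]; first by rewrite Normc.normc0.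
exact: le_trans (le_normcD _ _) (lerD _ _).
Qed.

Lemma ReD a b : cRe (a + b) = cRe a + cRe b.
Proof. by case: a; case: b. Qed.
Lemma ImD a b : cIm (a + b) = cIm a + cIm b.
Proof. by case: a; case: b. Qed.
Lemma ReN a : cRe (- a) = - cRe a.
Proof. by case: a. Qed.
Lemma ImN a : cIm (- a) = - cIm a.
Proof. by case: a. Qed.
Lemma ReM a b : cRe (a * b) = cRe a * cRe b - cIm a * cIm b.
Proof. by case: a; case: b. Qed.
Lemma ImM a b : cIm (a * b) = cRe a * cIm b + cIm a * cRe b.
Proof. by case: a => ? ?; case: b => ? ? /=. Qed.

Lemma Re_conj a : cRe a^* = cRe a.
Proof. by case: a. Qed.
Lemma Im_conj a : cIm a^* = - cIm a.
Proof. by case: a. Qed.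

Lemma complex_eqP a b : cRe a = cRe b -> cIm a = cIm b -> a = b.
Proof. by case: a => u v; case: b => w z /= -> ->. Qed.

Lemma Re_sum (I : Type) (r : seq I) (P : pred I) (F : I -> C) :
  cRe (\sum_(i <- r | P i) F i) = \sum_(i <- r | P i) cRe (F i).
Proof. by apply: big_morph; [exact: ReD|]. Qed.

Lemma Im_sum (I : Type) (r : seq I) (P : pred I) (F : I -> C) :
  cIm (\sum_(i <- r | P i) F i) = \sum_(i <- r | P i) cIm (F i).
Proof. by apply: big_morph; [exact: ImD|]. Qed.

Lemma cisD x y : cis (x + y) = cis x * cis y.
Proof. by apply: complex_eqP; rewrite ?ReM ?ImM /= ?cosD ?sinD; ring. Qed.

Lemma normc_cis x : nc (cis x) = 1.
Proof. by rewrite normcE /= cos2Dsin2 sqrtr1. Qed.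

Lemma cis0 : cis 0 = 1 :> C.
Proof. by rewrite /cis cos0 sin0. Qed.

(** Gaussians, chirps and characters are all brought to this form, so that products and completed
    squares become identities between exponents. *)
Definition cexp a : C := (expR (cRe a))%:C * cis (cIm a).

Lemma cexpD a b : cexp (a + b) = cexp a * cexp b.
Proof. by rewrite /cexp ReD ImD expRD cisD rmorphM/=; ring. Qed.

Lemma cexp0 : cexp 0 = 1.
Proof. by rewrite /cexp /= expR0 cis0 mulr1. Qed.

Lemma normc_cexp a : nc (cexp a) = expR (cRe a).
Proof. by rewrite Normc.normcM normc_cis mulr1 normc_real ger0_norm// expR_ge0. Qed.

Lemma cexp_real x : cexp x%:C = (expR x)%:C.
Proof. by rewrite /cexp /= cis0 mulr1. Qed.

Lemma cis_cexp x : cis x = cexp (0 +i* x).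
Proof. by rewrite /cexp /= expR0 mul1r. Qed.

Lemma cexp_neq0 a : cexp a != 0.
Proof. by rewrite -normc_gt0 normc_cexp expR_gt0. Qed.

Lemma Re_cexp a : cRe (cexp a) = expR (cRe a) * cos (cIm a).
Proof. by rewrite /cexp ReM /= mul0r subr0. Qed.

Lemma Im_cexp a : cIm (cexp a) = expR (cRe a) * sin (cIm a).
Proof. by rewrite /cexp ImM /= mul0r addr0. Qed.

End ComplexNumbers.

Section ComplexIntegral.
Context {R : realType} d {T : measurableType d}.
Local Notation C := (R[i]).
Implicit Types (f g : T -> C) (p q : T -> R).

Definition cmfun f :=
  measurable_fun setT (fun x => cRe (f x)) /\
  measurable_fun setT (fun x => cIm (f x)).

Lemma cmfun_cst a : cmfun (fun=> a).
Proof. by split; exact: measurable_cst. Qed.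

Lemma cmfun_real p : measurable_fun setT p -> cmfun (fun x => (p x)%:C).
Proof. by move=> mp; split => //=; exact: measurable_cst. Qed.

Lemma cmfunM f g : cmfun f -> cmfun g -> cmfun (fun x => f x * g x).
Proof.
move=> [f1 f2] [g1 g2]; split.
  under eq_fun do rewrite ReM.
  by apply: measurable_funB; exact: measurable_funM.
under eq_fun do rewrite ImM.
by apply: measurable_funD; exact: measurable_funM.
Qed.

Lemma cmfun_conj f : cmfun f -> cmfun (fun x => (f x)^*).
Proof.
move=> [f1 f2]; split.
  by under eq_fun do rewrite Re_conj.
under eq_fun do rewrite Im_conj.
exact: measurableT_comp.
Qed.

Lemma cmfun_cis p : measurable_fun setT p -> cmfun (fun x => cis (p x)).
Proof.
move=> mp; split => /=.
  apply: (measurableT_comp (f := @cos R)) => //.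
  by apply: continuous_measurable_fun; exact: continuous_cos.
apply: (measurableT_comp (f := @sin R)) => //.
by apply: continuous_measurable_fun; exact: continuous_sin.
Qed.

Lemma measurable_normc f : cmfun f -> measurable_fun setT (fun x => nc (f x)).
Proof.
move=> [f1 f2]; under eq_fun do rewrite normcE.
apply: (measurableT_comp (f := @Num.sqrt R)).
  by apply: continuous_measurable_fun; exact: sqrt_continuous.
by apply: measurable_funD; exact: measurable_funX.
Qed.

Variable mu : {measure set T -> \bar R}.

Definition cint f : C := (\int[mu]_x cRe (f x))%R +i* (\int[mu]_x cIm (f x))%R.

Definition rintegrable p := mu.-integrable setT (EFin \o p).

Definition cintegrable f :=
  rintegrable (fun x => cRe (f x)) /\ rintegrable (fun x => cIm (f x)).

Lemma rintegrable_le p q : measurable_fun setT p -> rintegrable q ->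
  (forall x, `|p x| <= q x) -> rintegrable p.
Proof.
move=> mp iq pq; apply: le_integrable iq => //; first exact/measurable_EFinP.
by move=> x _; rewrite /= lee_fin (le_trans (pq x))// ler_norm.
Qed.

Lemma rintegrableD p q : rintegrable p -> rintegrable q ->
  rintegrable (fun x => p x + q x).
Proof. by move=> ip iq; have := integrableD measurableT ip iq. Qed.

Lemma rintegrableZ k p : rintegrable p -> rintegrable (fun x => k * p x).
Proof. by move=> ip; have := integrableZl measurableT k ip. Qed.

Lemma rintegrable_measurable p : rintegrable p -> measurable_fun setT p.
Proof. by move=> /measurable_int/measurable_EFinP. Qed.

Lemma cintegrable_cmfun f : cintegrable f -> cmfun f.
Proof. by move=> [? ?]; split; exact: rintegrable_measurable. Qed.

Lemma cintegrable_le f q : cmfun f -> rintegrable q ->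
  (forall x, nc (f x) <= q x) -> cintegrable f.
Proof.
move=> [f1 f2] iq fq; split; apply: (rintegrable_le _ iq) => // x.
  exact: le_trans (normr_Re_le _) (fq x).
exact: le_trans (normr_Im_le _) (fq x).
Qed.

Lemma cintegrable_norm f : cintegrable f -> rintegrable (fun x => nc (f x)).
Proof.
move=> [f1 f2]; have mf : cmfun f by split; exact: rintegrable_measurable.
apply: (@rintegrable_le _ (fun x => `|cRe (f x)| + `|cIm (f x)|)).
- exact: measurable_normc.
- apply: rintegrableD.
    by have := integrable_abse f1.
  by have := integrable_abse f2.
- by move=> x; rewrite ger0_norm ?normc_ge0// normc_le_ReIm.
Qed.

Lemma cintegrableD f g : cintegrable f -> cintegrable g ->
  cintegrable (fun x => f x + g x).
Proof.
move=> [f1 f2] [g1 g2]; split.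
  by rewrite /rintegrable /comp; under eq_fun do rewrite ReD; exact: rintegrableD.
by rewrite /rintegrable /comp; under eq_fun do rewrite ImD; exact: rintegrableD.
Qed.

Lemma cintegrableZ a f : cintegrable f -> cintegrable (fun x => a * f x).
Proof.
move=> fi; apply: (@cintegrable_le _ (fun x => nc a * nc (f x))).
- by apply: cmfunM; [exact: cmfun_cst|exact: cintegrable_cmfun].
- by apply: rintegrableZ; exact: cintegrable_norm.
- by move=> x; rewrite Normc.normcM.
Qed.

Lemma cintegrable0 : cintegrable (fun=> 0).
Proof. by split; exact: integrable0. Qed.

Lemma cintD f g : cintegrable f -> cintegrable g ->
  cint (fun x => f x + g x) = cint f + cint g.
Proof.
move=> [f1 f2] [g1 g2]; apply: complex_eqP; rewrite /cint /=.
  by under eq_Rintegral do rewrite ReD; rewrite RintegralD.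
by under eq_Rintegral do rewrite ImD; rewrite RintegralD.
Qed.

Lemma cintZ a f : cintegrable f -> cint (fun x => a * f x) = a * cint f.
Proof.
move=> [f1 f2]; apply: complex_eqP; rewrite ?ReM ?ImM /cint /=.
  under eq_Rintegral do rewrite ReM.
  rewrite RintegralB// ?RintegralZl//; exact: rintegrableZ.
under eq_Rintegral do rewrite ImM.
rewrite RintegralD// ?RintegralZl//; exact: rintegrableZ.
Qed.

Lemma cint0 : cint (fun=> 0) = 0.
Proof. by rewrite /cint /Rintegral /= integral0. Qed.

Lemma cintB f g : cintegrable f -> cintegrable g ->
  cint (fun x => f x - g x) = cint f - cint g.
Proof.
move=> fi gi; rewrite -[- cint g]mulN1r -cintZ// -cintD//; last exact: cintegrableZ.
by congr cint; apply/funext => x; rewrite mulN1r.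
Qed.

Lemma cintegrable_sum (I : Type) (r : seq I) (F : I -> T -> C) :
  (forall i, cintegrable (F i)) -> cintegrable (fun x => \sum_(i <- r) F i x).
Proof.
move=> iF; elim: r => [|i r IH].
  rewrite (_ : (fun x => _) = fun=> 0); first exact: cintegrable0.
  by apply/funext => x; rewrite big_nil.
rewrite (_ : (fun x => _) = fun x => F i x + \sum_(j <- r) F j x).
  exact: cintegrableD.
by apply/funext => x; rewrite big_cons.
Qed.

Lemma cint_sum (I : Type) (r : seq I) (F : I -> T -> C) :
  (forall i, cintegrable (F i)) ->
  cint (fun x => \sum_(i <- r) F i x) = \sum_(i <- r) cint (F i).
Proof.
move=> iF; elim: r => [|i r IH].
  by rewrite big_nil -[RHS]cint0; congr cint; apply/funext => x; rewrite big_nil.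
rewrite big_cons -IH -cintD//; last exact: cintegrable_sum.
by congr cint; apply/funext => x; rewrite big_cons.
Qed.

(** Multiplying by the unit number [u] makes the integral a nonnegative real, hence equal to the
    integral of a real part, which is at most the modulus. Bounding real and imaginary parts
    separately would lose a factor, and the sharp constant rests on this inequality. *)
Lemma normc_cint_le f q : cintegrable f -> rintegrable q ->
  (forall x, nc (f x) <= q x) -> nc (cint f) <= \int[mu]_x q x.
Proof.
move=> fi qi fq.
have [->|n0] := eqVneq (cint f) 0.
  rewrite Normc.normc0; apply: Rintegral_ge0 => x _.
  exact: le_trans (normc_ge0 _) (fq x).
pose u := (cint f)^* / (nc (cint f))%:C.
have nn0 : nc (cint f) != 0 by rewrite normc_eq0.
have uE : u * cint f = (nc (cint f))%:C.
  have E : (cint f)^* * cint f = (nc (cint f))%:C * (nc (cint f))%:C.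
    rewrite -[RHS]rmorphM/= -expr2 (sqr_normc (cint f)).
    by case: (cint f) => x y; apply: complex_eqP => /=; ring.
  rewrite /u mulrAC E mulfK//; apply: contra nn0 => /eqP H.
  by have := congr1 (@complex.Re R) H => /= ->.
have nu : nc u = 1.
  by rewrite /u Normc.normcM Normc.normcV normc_conj normc_real ger0_norm ?normc_ge0// divff.
have -> : nc (cint f) = \int[mu]_x cRe (u * f x).
  by have := congr1 (@complex.Re R) (cintZ u fi); rewrite uE /= => <-.
have [i1 i2] := cintegrableZ u fi.
apply: le_Rintegral => // x _.
apply: le_trans (Re_le_normc _) _.
by rewrite Normc.normcM nu mul1r.
Qed.

End ComplexIntegral.

(** * Fubini's theorem for real and complex integrands *)

Section Fubini.
Context {R : realType} d1 d2 (T1 : measurableType d1) (T2 : measurableType d2).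
Variable m1 : {sigma_finite_measure set T1 -> \bar R}.
Variable m2 : {sigma_finite_measure set T2 -> \bar R}.
Local Notation C := (R[i]).

(** The inner real integral is [fine] of an extended one. The extended one is finite for almost
    every x, so the two agree almost everywhere and the outer integrals coincide. *)
Lemma Rfubini1 (f : T1 * T2 -> R) : rintegrable (m1 \x m2)%E f ->
  rintegrable m1 (fun x => \int[m2]_y f (x, y)) /\
  \int[m1]_x \int[m2]_y f (x, y) = \int[(m1 \x m2)%E]_z f z.
Proof.
move=> fi; have Fi := integrable_fubini_F fi.
have mF := measurable_int _ Fi.
have mF' : measurable_fun setT (fun x => (\int[m2]_y f (x, y))%:E).
  by apply/measurable_EFinP; apply: measurableT_comp mF; exact: fine_measurable.
have ae : ae_eq m1 setT (fubini_F m2 (EFin \o f))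
    (fun x => (\int[m2]_y f (x, y))%:E).
  have := integrable_ae measurableT Fi; apply: filterS => x /= /(_ I) fx _.
  by rewrite /Rintegral fineK.
split.
  apply/integrableP; split => //.
  have /integrableP[_] := Fi.
  rewrite (ae_eq_integral (D := setT) (fun x => `|(\int[m2]_y f (x, y))%:E|)%E)//.
  - exact: measurableT_comp.
  - exact: measurableT_comp.
  - by apply: filterS ae => x /= /(_ I) ->.
rewrite /Rintegral; congr fine.
by rewrite -(integral12_prod_meas1 fi); apply/esym/ae_eq_integral.
Qed.

Lemma Rfubini2 (f : T1 * T2 -> R) : rintegrable (m1 \x m2)%E f ->
  rintegrable m2 (fun y => \int[m1]_x f (x, y)) /\
  \int[m2]_y \int[m1]_x f (x, y) = \int[(m1 \x m2)%E]_z f z.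
Proof.
(* The modulus of a partial integral is at most the partial integral of the modulus, whose total is
   finite by Tonelli. *)
move=> fi; have Fi : m2.-integrable setT (fubini_G m1 (EFin \o f)).
  have mf := measurable_int _ fi.
  apply/integrableP; split; first exact: (measurable_fubini_G fi).
  apply: le_lt_trans ((integrable21ltyP _ _ mf).1 fi).
  apply: ge0_le_integral => //.
  - by apply: measurableT_comp => //; exact: measurable_fubini_G fi.
  - apply: (measurable_fun_fubini_tonelli_G (abse \o (EFin \o f))) => //=.
    exact: measurableT_comp.
  - move=> y _; apply: le_abse_integral => //.
    exact: measurableT_comp.
have mF := measurable_int _ Fi.
have mF' : measurable_fun setT (fun y => (\int[m1]_x f (x, y))%:E).
  by apply/measurable_EFinP; apply: measurableT_comp mF; exact: fine_measurable.
have ae : ae_eq m2 setT (fubini_G m1 (EFin \o f))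
    (fun y => (\int[m1]_x f (x, y))%:E).
  have := integrable_ae measurableT Fi; apply: filterS => x /= /(_ I) fx _.
  by rewrite /Rintegral fineK.
split.
  apply/integrableP; split => //.
  have /integrableP[_] := Fi.
  rewrite (ae_eq_integral (D := setT) (fun y => `|(\int[m1]_x f (x, y))%:E|)%E)//.
  - exact: measurableT_comp.
  - exact: measurableT_comp.
  - by apply: filterS ae => x /= /(_ I) ->.
rewrite /Rintegral; congr fine.
by rewrite -(integral21_prod_meas1 fi); apply/esym/ae_eq_integral.
Qed.

Lemma cintegrable_fubini2 (f : T1 * T2 -> C) : cintegrable (m1 \x m2)%E f ->
  cintegrable m2 (fun y => cint m1 (fun x => f (x, y))).
Proof. by move=> [/Rfubini2[? _] /Rfubini2[? _]]; split. Qed.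

Lemma cfubini1 (f : T1 * T2 -> C) : cintegrable (m1 \x m2)%E f ->
  cint m1 (fun x => cint m2 (fun y => f (x, y))) = cint (m1 \x m2)%E f.
Proof.
by move=> [/Rfubini1[_ H1] /Rfubini1[_ H2]]; apply: complex_eqP; rewrite /= ?H1 ?H2.
Qed.

Lemma cfubini2 (f : T1 * T2 -> C) : cintegrable (m1 \x m2)%E f ->
  cint m2 (fun y => cint m1 (fun x => f (x, y))) = cint (m1 \x m2)%E f.
Proof.
by move=> [/Rfubini2[_ H1] /Rfubini2[_ H2]]; apply: complex_eqP; rewrite /= ?H1 ?H2.
Qed.

Lemma cfubini (f : T1 -> T2 -> C) : cintegrable (m1 \x m2)%E (fun z => f z.1 z.2) ->
  cint m1 (fun x => cint m2 (f x)) = cint m2 (fun y => cint m1 (f^~ y)).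
Proof. by move=> fi; rewrite (cfubini1 fi) -(cfubini2 fi). Qed.

(* No integrability is needed: the positive and negative parts have measurable
   partial integrals, and [fine] is measurable. *)
Lemma emeasurable_partial_integral (f : T1 * T2 -> \bar R) :
  measurable_fun setT f -> measurable_fun setT (fun x => \int[m2]_y f (x, y))%E.
Proof.
move=> mf; have -> : (fun x => \int[m2]_y f (x, y))%E =
    (fun x => fubini_F m2 f^\+ x - fubini_F m2 f^\- x)%E.
  apply/funext => x; rewrite [LHS]integralE.
  under eq_integral do rewrite funepos_comp/=.
  by under [X in (_ - X)%E = _]eq_integral do rewrite funeneg_comp/=.
apply: emeasurable_funB; apply: measurable_fun_fubini_tonelli_F => //.
  exact: measurable_funepos.
exact: measurable_funeneg.
Qed.

Lemma measurable_Rint (f : T1 * T2 -> R) : measurable_fun setT f ->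
  measurable_fun setT (fun x => \int[m2]_y f (x, y)).
Proof.
move=> mf; apply: (measurableT_comp (f := @fine R)); first exact: fine_measurable.
by apply: (emeasurable_partial_integral (f := EFin \o f)); exact/measurable_EFinP.
Qed.

Lemma cmfun_cint (f : T1 * T2 -> C) : cmfun f ->
  cmfun (fun x => cint m2 (fun y => f (x, y))).
Proof.
move=> [f1 f2]; split => /=; first exact: (measurable_Rint f1).
exact: (measurable_Rint f2).
Qed.

Lemma cintegrable_prod_le (f : T1 * T2 -> C) (p : T1 -> R) (q : T2 -> R) :
  cmfun f -> rintegrable m1 p -> rintegrable m2 q ->
  (forall x, 0 <= p x) -> (forall y, 0 <= q y) ->
  (forall x y, nc (f (x, y)) <= p x * q y) -> cintegrable (m1 \x m2)%E f.
Proof.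
move=> mf ip iq p0 q0 fpq.
have mp := rintegrable_measurable ip; have mq := rintegrable_measurable iq.
have mpq : measurable_fun setT (fun z : T1 * T2 => p z.1 * q z.2).
  by apply: measurable_funM; exact: measurableT_comp.
apply: (cintegrable_le mf (q := fun z => p z.1 * q z.2)); last by case.
apply/integrable12ltyP; first exact/measurable_EFinP.
under eq_integral => x _.
  under eq_integral => y _ do rewrite /= normrM (ger0_norm (p0 _)) (ger0_norm (q0 _)) EFinM.
  rewrite ge0_integralZl//=; last by rewrite lee_fin.
  - over.
  - exact/measurable_EFinP.
  - by move=> y _; rewrite lee_fin.
have := integrable_fin_num measurableT iq => /fineK /= <-.
rewrite ge0_integralZr//=.
- have := integrable_fin_num measurableT ip => /fineK /= <-.
  by rewrite -EFinM ltry.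
- exact/measurable_EFinP.
- by move=> x _; rewrite lee_fin.
- by rewrite lee_fin; apply: fine_ge0; apply: integral_ge0 => y _; rewrite lee_fin.
Qed.

End Fubini.

(** * Lebesgue measure on R^n *)
Section LebesgueRn.
Context {R : realType}.
Local Notation mR := (measurableTypeR R).

(** A separate constant to which the sigma-finite structure is attached; it is convertible to
    [lebesgue_Rn], so that results pass freely to the measure of the statement. *)
Definition leb n : set (n.-tuple mR) -> \bar R := lebesgue_Rn n.
Arguments leb : clear implicits.

HB.instance Definition _ n := Measure.copy (leb n) (lebesgue_Rn n).

Lemma lebS n A : measurable A ->
  leb n.+1 A = (leb n \x lebesgue_measure)%E (@consr R n @^-1` A).
Proof. by []. Qed.

Definition cube n k : set (n.-tuple mR) := [set s | forall i, tnth s i \in `[- k%:R, k%:R]].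
Arguments cube : clear implicits.

Lemma cubeS n k : @consr R n @^-1` cube n.+1 k = cube n k `*` [set` `[- k%:R, k%:R]].
Proof.
apply/seteqP; split => [[s x] /= H|[s x] /= [H1 H2]].
  split => /= [i|]; first by have := H (lift ord0 i); rewrite tnthS.
  by have := H ord0; rewrite tnth0.
move=> i; have [->|[j ->]] : i = ord0 \/ exists j, i = lift ord0 j.
- by case: (unliftP ord0 i) => [j ->|->]; [right; exists j|left].
- by rewrite tnth0.
- by rewrite tnthS; exact: H1.
Qed.

Lemma measurable_cube n k : measurable (cube n k).
Proof.
have -> : cube n k =
    \bigcap_(i in [set: 'I_n]) ((fun s => tnth s i) @^-1` [set` `[- (k%:R : R), k%:R]]).
  by apply/seteqP; split => [s H i _|s H i]; [exact: H|exact: (H i I)].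
apply: fin_bigcap_measurable => // i _; rewrite -[X in measurable X]setTI.
exact: measurable_tnth.
Qed.

Lemma leb_cube_lty n k : (leb n (cube n k) < +oo)%E.
Proof.
elim: n => [|n IH]; first by rewrite /leb /= diracE ltry.
rewrite lebS; last exact: measurable_cube.
rewrite cubeS product_measure1E//; last exact: measurable_cube.
apply: lte_mul_pinfty => //; first by rewrite ge0_fin_numE.
have : (lebesgue_measure ([set` `[- (k%:R : R), k%:R]%R] : set R) < +oo)%E.
  by rewrite lebesgue_measure_itv /=; case: ifP => _; rewrite ?ltry// -EFinD ltry.
exact.
Qed.

Lemma leb_sigma_finite n : sigma_finite setT (leb n).
Proof.
exists (cube n); last by move=> k; split; [exact: measurable_cube|exact: leb_cube_lty].
apply/esym/seteqP; split => // s _.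
have [k Hk] : exists k : nat, forall i, `|tnth s i| <= k%:R.
  exists (\max_(i < n) `|Num.ceil `|tnth s i| |%N) => i.
  apply: le_trans (ceil_ge _) _; rewrite -[leLHS]ger0_norm; last by rewrite ler0z ceil_ge0 (lt_le_trans _ (normr_ge0 _))//ltrN10.
  by rewrite -intr_norm -natr_absz ler_nat (leq_bigmax (F := fun i => `|Num.ceil `|tnth s i| |%N)).
by exists k => // i; rewrite in_itv /= -ler_norml.
Qed.

HB.instance Definition _ n :=
  @Measure_isSigmaFinite.Build _ _ _ (leb n) (leb_sigma_finite n).

(** The measure is the image of a product under [consr], so a change of variables followed by
    Tonelli gives the induction step for integrals over R^n. *)
Lemma ge0_integral_lebS n (F : n.+1.-tuple mR -> \bar R) :
  measurable_fun setT F -> (forall s, 0 <= F s)%E ->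
  (\int[leb n.+1]_s F s =
   \int[leb n]_s \int[lebesgue_measure]_x F (consr (s, x)))%E.
Proof.
move=> mF F0.
pose m := measure_function_pushforward__canonical__measure_function_Measure
  (leb n \x lebesgue_measure)%E (@measurable_consr R n).
transitivity (\int[m]_s F s)%E.
  by apply: eq_measure_integral => A mA _; exact: lebS.
rewrite ge0_integral_pushforward//; last exact: measurable_consr.
rewrite preimage_setT (fubini_tonelli1 (F \o @consr R n))//.
  by apply: measurableT_comp => //; exact: measurable_consr.
by move=> x; exact: F0.
Qed.

(** Uniqueness of Lebesgue measure reduces the claim to half-open intervals, whose length is
    invariant under translation. *)
Lemma lebesgue_measure_shift (a : R) (A : set mR) : measurable A ->
  pushforward lebesgue_measure (fun x : mR => x + a : mR) A = lebesgue_measure A.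
Proof.
move=> mA; apply/esym/lebesgue_measure_unique => //=.
  by apply: measurable_funD.
move=> _ _ [[u v]] _ <-; rewrite /pushforward.
have -> : (fun x => x + a) @^-1` `]u, v] = `](u - a), (v - a)]%classic.
  by apply/seteqP; split => x /=; rewrite !in_itv /= ltrBlDr lerBrDr.
rewrite !lebesgue_measure_itv /= !lte_fin ltrD2r.
by case: ifP => // _; rewrite -!EFinD; congr EFin; lra.
Qed.

Lemma ge0_integral_shift1 (F : mR -> \bar R) (a : R) :
  measurable_fun setT F -> (forall x, 0 <= F x)%E ->
  (\int[lebesgue_measure]_x F (x + a)%R = \int[lebesgue_measure]_x F x)%E.
Proof.
move=> mF F0; have ms : measurable_fun setT (fun x : mR => x + a : mR).
  by apply: measurable_funD.
transitivity (\int[pushforward lebesgue_measure (fun x : mR => (x + a)%R : mR)]_x F x)%E.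
  by rewrite ge0_integral_pushforward// preimage_setT.
apply: eq_measure_integral => A mA _; exact: lebesgue_measure_shift.
Qed.

Definition tshift n (a : 'rV[R]_n) (s : n.-tuple mR) : n.-tuple mR :=
  [tuple tnth s i + a 0 i | i < n].

Lemma measurable_tshift n (a : 'rV[R]_n) : measurable_fun setT (tshift a).
Proof.
apply/measurable_fun_tnthP => i; rewrite (_ : _ \o _ = fun s => tnth s i + a 0 i).
  by apply: measurable_funD => //; exact: measurable_tnth.
by apply/funext => s /=; rewrite tnth_mktuple.
Qed.

Lemma tshift_consr n (a : 'rV[R]_n.+1) (s : n.-tuple mR) (x : mR) :
  tshift a (consr (s, x)) =
  consr (tshift (\row_j a 0 (lift ord0 j)) s, x + a 0 ord0).
Proof.
apply: eq_from_tnth => i; case: (unliftP ord0 i) => [j ->|->].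
  by rewrite tnth_mktuple !tnthS tnth_mktuple mxE.
by rewrite tnth_mktuple !tnth0.
Qed.

Lemma ge0_integral_tshift n (F : n.-tuple mR -> \bar R) (a : 'rV[R]_n) :
  measurable_fun setT F -> (forall s, 0 <= F s)%E ->
  (\int[leb n]_s F (tshift a s) = \int[leb n]_s F s)%E.
Proof.
elim: n F a => [|n IH] F a mF F0.
  by apply: eq_integral => s _; congr F; apply: eq_from_tnth => -[].
rewrite (ge0_integral_lebS mF F0) ge0_integral_lebS; last 2 first.
- by apply: measurableT_comp => //; exact: measurable_tshift.
- by move=> s; exact: F0.
have mFc : measurable_fun setT (fun p : n.-tuple mR * mR => F (consr p)).
  by apply: measurableT_comp => //; exact: measurable_consr.
rewrite -(IH (fun s => \int[lebesgue_measure]_x F (consr (s, x)))%E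
             (\row_j a 0 (lift ord0 j))).
- apply: eq_integral => s _; under eq_integral do rewrite tshift_consr.
  apply: (ge0_integral_shift1 (F := fun x => F (consr (_, x)))) => //.
  by apply: (measurableT_comp mFc); exact: measurable_pair1.
- exact: (measurable_fun_fubini_tonelli_F (fun p => F (consr p))).
- by move=> s; apply: integral_ge0.
Qed.

Lemma integral_tshift n (F : n.-tuple mR -> \bar R) (a : 'rV[R]_n) :
  measurable_fun setT F ->
  (\int[leb n]_s F (tshift a s) = \int[leb n]_s F s)%E.
Proof.
move=> mF; rewrite [LHS]integralE [RHS]integralE; congr (_ - _)%E.
  under eq_integral do rewrite funepos_comp/=.
  by rewrite ge0_integral_tshift//; exact: measurable_funepos.
under eq_integral do rewrite funeneg_comp/=.
by rewrite ge0_integral_tshift//; exact: measurable_funeneg.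
Qed.

Lemma measurable_prod_tnth k (h : 'I_k -> mR -> R) :
  (forall i, measurable_fun setT (h i)) ->
  measurable_fun setT (fun s : k.-tuple mR => \prod_(i < k) h i (tnth s i)).
Proof.
move=> mh; elim: (index_enum _) => [|i r IHr].
  by under eq_fun do rewrite big_nil; exact: measurable_cst.
under eq_fun do rewrite big_cons.
by apply: measurable_funM => //; apply: measurableT_comp => //; exact: measurable_tnth.
Qed.

Lemma ge0_integral_leb_prod n (g : 'I_n -> mR -> R) :
  (forall i, rintegrable lebesgue_measure (g i)) -> (forall i x, 0 <= g i x) ->
  (\int[leb n]_s (\prod_(i < n) g i (tnth s i))%:E =
   (\prod_(i < n) \int[lebesgue_measure]_x g i x)%:E)%E.
Proof.
elim: n g => [|n IH] g ig g0.
  under eq_integral do rewrite big_ord0.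
  by rewrite big_ord0 integral_cst//= mul1e /leb /= diracT.
have mg := measurable_prod_tnth.
have mgi i : measurable_fun setT (g i) := rintegrable_measurable (ig i).
rewrite ge0_integral_lebS//; last 2 first.
- by apply/measurable_EFinP; exact: (mg _ _ mgi).
- by move=> s; rewrite lee_fin; apply: prodr_ge0.
have E s : (\int[lebesgue_measure]_x (\prod_(i < n.+1) g i (tnth (consr (s, x)) i))%:E =
    (\prod_(i < n) g (lift ord0 i) (tnth s i))%:E * (\int[lebesgue_measure]_x g ord0 x)%:E)%E.
  rewrite (eq_integral (fun x : mR => (\prod_(i < n) g (lift ord0 i) (tnth s i))%:E * (g ord0 x)%:E)%E); last first.
    move=> x _; rewrite big_ord_recl tnth0 mulrC EFinM.
    by under eq_bigr do rewrite tnthS.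
  rewrite ge0_integralZl//=.
  - by rewrite /Rintegral fineK//; exact: integrable_fin_num (ig ord0).
  - exact/measurable_EFinP.
  - by move=> x _; rewrite lee_fin.
  - by rewrite lee_fin; apply: prodr_ge0.
under eq_integral do rewrite E.
rewrite ge0_integralZr//=.
- by rewrite (IH (fun i => g (lift ord0 i)))// -EFinM big_ord_recl mulrC.
- by apply/measurable_EFinP; exact: (mg _ (fun i => g (lift ord0 i))).
- by move=> s _; rewrite lee_fin; apply: prodr_ge0.
- by rewrite lee_fin; apply: Rintegral_ge0.
Qed.

Lemma leb_prod n (g : 'I_n -> mR -> R) :
  (forall i, rintegrable lebesgue_measure (g i)) -> (forall i x, 0 <= g i x) ->
  rintegrable (leb n) (fun s => \prod_(i < n) g i (tnth s i)) /\
  \int[leb n]_s (\prod_(i < n) g i (tnth s i)) =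
    \prod_(i < n) \int[lebesgue_measure]_x g i x.
Proof.
move=> ig g0; have E := ge0_integral_leb_prod ig g0.
split; last by rewrite /Rintegral E.
apply/integrableP; split.
  apply/measurable_EFinP; apply: (measurable_prod_tnth (h := g)) => i.
  exact: rintegrable_measurable (ig i).
under eq_integral => s _ do rewrite /= ger0_norm ?prodr_ge0//.
by rewrite E ltry.
Qed.

End LebesgueRn.
Arguments leb {R} n.

Section OneDimensional.
Context {R : realType}.
Local Notation mR := (measurableTypeR R).

(** A rescaled normal density of variance 1/a, whose total mass is 1. *)
Lemma gauss_integral1 (a : R) : 0 < a ->
  rintegrable (T := mR) lebesgue_measure (fun x => expR (- (a / 2 * x ^+ 2))) /\
  \int[lebesgue_measure]_(x in [set: mR]) expR (- (a / 2 * x ^+ 2)) = Num.sqrt (2 * pi / a).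
Proof.
move=> a0; pose s := (Num.sqrt a)^-1.
have s2 : s ^+ 2 = a^-1 by rewrite /s exprVn sqr_sqrtr// ltW.
have s0 : s != 0 by rewrite invr_eq0 sqrtr_eq0 -ltNge.
have E x : expR (- (a / 2 * x ^+ 2)) = (normal_peak s)^-1 * normal_pdf 0 s x.
  rewrite normal_pdfE// mulrA mulVf ?mul1r ?gt_eqF ?normal_peak_gt0//.
  rewrite /normal_fun s2 subr0; congr expR.
  by rewrite mulNr; congr (- _); field; rewrite gt_eqF.
have i1 := integrable_normal_pdf 0 s.
have pE : (normal_peak s)^-1 = Num.sqrt (2 * pi / a).
  by rewrite /normal_peak invrK s2; congr Num.sqrt; ring.
have := integral_normal_pdf 0 s => I1.
split.
  rewrite (_ : (fun x => _) = fun x : mR => (normal_peak s)^-1 * normal_pdf 0 s x).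
    exact: rintegrableZ.
  by apply/funext => x; exact: E.
under eq_Rintegral do rewrite E.
by rewrite RintegralZl// /Rintegral I1 mulr1.
Qed.

(** The one-variable majorant from which the integrable weights on R^n are built. *)
Lemma rintegrable_oneDsqrV :
  rintegrable (T := mR) lebesgue_measure (fun x => (1 + x ^+ 2)^-1).
Proof.
have c : continuous (fun x : R => (oneDsqr x)^-1) by exact: continuous_oneDsqrV.
apply/integrableP; split.
  by apply/measurable_EFinP; exact: continuous_measurable_fun.
have p0 (x : R) : 0 <= (oneDsqr x)^-1 by rewrite invr_ge0 ltW// oneDsqr_gt0.
rewrite (eq_integral (fun x : mR => (oneDsqr x)^-1%:E)); last first.
  by move=> x _ /=; rewrite (ger0_norm (p0 x)).
rewrite (ge0_symfun_integralT (f := fun x => (oneDsqr x)^-1))//.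
  rewrite -set_itvcy integral0y_oneDsqr -EFinM ltry//.
by move=> x; rewrite /= /oneDsqr sqrrN.
Qed.

End OneDimensional.

(** * Measurability, polynomial weights and translations on row vectors *)

Section RowVectors.
Context {R : realType}.
Local Notation mR := (measurableTypeR R).

Lemma normr_coord_le n (x : 'rV[R]_n) i : `|x 0 i| <= `|x|.
Proof.
rewrite [leRHS]/Num.norm /= mx_normrE.
exact: (le_bigmax _ (fun ij : 'I_1 * 'I_n => `|x ij.1 ij.2|) (0, i)).
Qed.

Lemma rV_norm_le n (x : 'rV[R]_n) (e : R) : 0 <= e ->
  (forall i, `|x 0 i| <= e) -> `|x| <= e.
Proof.
move=> e0 H; rewrite [leLHS]/Num.norm /= mx_normrE; apply/bigmax_leP; split => //.
by case=> i j _ /=; rewrite (ord1 i).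
Qed.

Lemma row_of_tupleE n (s : n.-tuple mR) i : row_of_tuple s 0 i = tnth s i.
Proof. by rewrite mxE. Qed.

Lemma measurable_coord n i :
  measurable_fun setT (fun s : n.-tuple mR => row_of_tuple s 0 i).
Proof. by under eq_fun do rewrite row_of_tupleE; exact: measurable_tnth. Qed.

(** This rounding has countable range and uniform error. The first property serves measurability,
    here and for suprema over positions; the second serves the Riemann sums. *)
Definition grid n (k : nat) (x : 'rV[R]_n) : 'rV[R]_n :=
  \row_j ((Num.floor (k.+1%:R * x 0 j))%:~R / k.+1%:R).

Lemma grid_dist n k (x : 'rV[R]_n) : `|grid k x - x| <= k.+1%:R^-1.
Proof.
apply: rV_norm_le => [|i]; first by rewrite invr_ge0.
have k0 : 0 < k.+1%:R :> R by [].
rewrite !mxE -(@ler_pM2l _ k.+1%:R)// mulfV ?gt_eqF// -{1}(ger0_norm (ltW k0)).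
rewrite -normrM mulrBr mulrCA mulfV ?gt_eqF// mulr1.
have := floor_le (k.+1%:R * x 0 i); have := floorD1_gt (k.+1%:R * x 0 i).
rewrite intrD => H1 H2; rewrite ler0_norm; lra.
Qed.

(** Bridge between the topology of row vectors and the sigma-algebra generated by coordinates: after
    rounding to the grid, the function takes countably many values, each on a measurable set of
    cells, and continuity makes the rounded functions converge pointwise. *)
Lemma measurable_continuous_rV n d (T : measurableType d) (r : T -> 'rV[R]_n)
    (F : 'rV[R]_n -> R) :
  (forall i, measurable_fun setT (fun t => r t 0 i)) -> continuous F ->
  measurable_fun setT (fun t => F (r t)).
Proof.
move=> mr cF; apply: (measurable_fun_cvg (h := fun k t => F (grid k (r t)))) => [k|t _].
- move=> _ B mB; rewrite setTI.
  pose pt (v : 'rV[int]_n) : 'rV[R]_n := \row_j ((v 0 j)%:~R / k.+1%:R).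
  have -> : (fun t => F (grid k (r t))) @^-1` B =
    \bigcup_(v in [set: 'rV[int]_n]) [set t | B (F (pt v)) /\
       forall j, Num.floor (k.+1%:R * r t 0 j) = v 0 j].
    apply/seteqP; split => [t /= Bt|t [v _ [Bv H]] /=].
      exists (\row_j Num.floor (k.+1%:R * r t 0 j)) => //; split=> [|j]; last by rewrite mxE.
      by congr (B (F _)): Bt; apply/rowP => j; rewrite !mxE.
    by congr (B (F _)): Bv; apply/rowP => j; rewrite !mxE H.
  apply: countable_bigcupT_measurable => [|v]; first exact: countableP.
  have [Bv|nBv] := pselect (B (F (pt v))); last first.
    by rewrite (_ : [set t | _] = set0)//; apply/seteqP; split => // t [].
  rewrite (_ : [set t | _] = \bigcap_(j in [set: 'I_n])
     ((fun t => k.+1%:R * r t 0 j) @^-1` [set` `[(v 0 j)%:~R, (v 0 j + 1)%:~R[ ])); last first.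
    apply/seteqP; split=> [t [_ H] j _ /=|t H]; last split => // j.
      by rewrite in_itv /= -(H j) floor_le floorD1_gt.
    by have := H j I; rewrite /= in_itv /= => /floor_def ->.
  apply: fin_bigcap_measurable => // j _; rewrite -[X in measurable X]setTI.
  by apply: measurable_funM => //; exact: mr.
- apply: (@cvg_comp _ _ _ (fun k => grid k (r t)) F _ _ _ _ (cF (r t))).
  apply/cvgrPdist_le => e e0.
  near=> k; rewrite distrC (le_trans (grid_dist _ _))//.
  rewrite invf_ple ?posrE//; near: k.
  have [N HN] : exists N : nat, e^-1 <= N%:R.
    by exists (Num.truncn e^-1).+1; rewrite ltW// truncnS_gt.
  exists N => // m /= Nm; rewrite (le_trans HN)// ler_nat; exact: leqW.
Unshelve. all: by end_near.
Qed.

Lemma cmfun_continuous_rV n d (T : measurableType d) (r : T -> 'rV[R]_n)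
    (F : 'rV[R]_n -> R[i]) :
  (forall i, measurable_fun setT (fun t => r t 0 i)) ->
  continuous (fun x => cRe (F x)) -> continuous (fun x => cIm (F x)) ->
  cmfun (fun t => F (r t)).
Proof.
by move=> mr c1 c2; split; [exact: (measurable_continuous_rV mr c1)
                          |exact: (measurable_continuous_rV mr c2)].
Qed.

(* Large negative powers of this weight are integrable majorants. *)
Definition jb n (x : 'rV[R]_n) : R := 1 + `|x|.

Lemma jb_ge1 n (x : 'rV[R]_n) : 1 <= jb x.
Proof. by rewrite lerDl. Qed.

Lemma jb_gt0 n (x : 'rV[R]_n) : 0 < jb x.
Proof. exact: lt_le_trans (jb_ge1 x). Qed.

Lemma jbD n (x y : 'rV[R]_n) : jb (x + y) <= jb x * jb y.
Proof.
rewrite /jb; have := ler_normD x y; have := normr_ge0 x; have := normr_ge0 y.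
move=> *; nra.
Qed.

Lemma jbN n (x : 'rV[R]_n) : jb (- x) = jb x.
Proof. by rewrite /jb normrN. Qed.

Lemma jbX_ge1 n (x : 'rV[R]_n) k : 1 <= jb x ^+ k.
Proof. by rewrite exprn_ege1// jb_ge1. Qed.

Lemma jbX_gt0 n (x : 'rV[R]_n) k : 0 < jb x ^+ k.
Proof. by rewrite exprn_gt0// jb_gt0. Qed.

Lemma jbV_gt0 n (x : 'rV[R]_n) k : 0 < jb x ^- k.
Proof. by rewrite invr_gt0 jbX_gt0. Qed.

Lemma jbV_le1 n (x : 'rV[R]_n) k : jb x ^- k <= 1.
Proof. by rewrite invf_le1 ?jbX_ge1 ?jbX_gt0. Qed.

Lemma jbX_homo n (x : 'rV[R]_n) k l : (k <= l)%N -> jb x ^+ k <= jb x ^+ l.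
Proof. by move=> kl; rewrite ler_weXn2l// jb_ge1. Qed.

Lemma jbV_homo n (x : 'rV[R]_n) k l : (k <= l)%N -> jb x ^- l <= jb x ^- k.
Proof. by move=> kl; rewrite lef_pV2 ?posrE ?jbX_gt0// jbX_homo. Qed.

Lemma measurable_jbV n k : measurable_fun setT (fun s : n.-tuple mR => jb (row_of_tuple s) ^- k).
Proof.
apply: (measurable_continuous_rV (F := fun x => jb x ^- k)); first exact: measurable_coord.
move=> x.
apply: (@cvg_comp _ _ _ (fun x : 'rV[R]_n => jb x ^+ k) GRing.inv (nbhs x) (nbhs (jb x ^+ k))).
  2: by apply: inv_continuous; rewrite gt_eqF// jbX_gt0.
apply: (@cvg_comp _ _ _ (@jb n) (fun z => z ^+ k)); last exact: exprn_continuous.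
by apply: cvgD; [exact: cvg_cst|exact: norm_continuous].
Qed.

(** In the sup norm (1 + |x|)^2 dominates 1 + x_i^2 for every i, so (1 + |x|)^(-2n) is at most the
    product of the integrable functions 1 / (1 + x_i^2). The exponent 2n recurs below for this
    reason. *)
Lemma rintegrable_jbV n k : (2 * n <= k)%N ->
  rintegrable (leb n) (fun s : n.-tuple mR => jb (row_of_tuple s) ^- k).
Proof.
move=> nk; have [iP _] := leb_prod (n := n) (fun=> rintegrable_oneDsqrV (R := R))
  (fun i x => ltac:(by rewrite invr_ge0 addr_ge0// sqr_ge0)).
apply: rintegrable_le iP _ => [|s]; first exact: measurable_jbV.
rewrite (ger0_norm (ltW (jbV_gt0 _ _))); apply: (le_trans (jbV_homo _ nk)).
rewrite exprM -[X in (_ ^+ X)^-1 <= _]card_ord -prodr_const -prodfV.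
apply: ler_prod => i _; rewrite invr_ge0 exprn_ge0 ?(ltW (jb_gt0 _))//=.
rewrite lef_pV2 ?posrE ?exprn_gt0 ?jb_gt0//; last by rewrite ltr_pwDl// sqr_ge0.
have := normr_coord_le (row_of_tuple s) i; rewrite row_of_tupleE /jb => H.
rewrite -(real_normK (num_real (tnth s i))); have := normr_ge0 (tnth s i); nra.
Qed.

Lemma gauss_integral_rV n (a : 'I_n -> R) : (forall j, 0 < a j) ->
  rintegrable (leb n)
    (fun s => expR (- \sum_j (a j / 2 * row_of_tuple s 0 j ^+ 2))) /\
  \int[leb n]_s expR (- \sum_j (a j / 2 * row_of_tuple s 0 j ^+ 2)) =
    \prod_j Num.sqrt (2 * pi / a j).
Proof.
move=> a0.
have [i1 e1] := leb_prod (g := fun j x => expR (- (a j / 2 * x ^+ 2)))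
  (fun j => (gauss_integral1 (a0 j)).1) (fun j x => expR_ge0 _).
have E : (fun s : n.-tuple mR => expR (- \sum_j (a j / 2 * row_of_tuple s 0 j ^+ 2))) =
    fun s => \prod_(j < n) expR (- (a j / 2 * tnth s j ^+ 2)).
  apply/funext => s; rewrite -sumrN expR_sum.
  by apply: eq_bigr => j _; rewrite row_of_tupleE.
rewrite E; split => //; rewrite e1; apply: eq_bigr => j _.
exact: (gauss_integral1 (a0 j)).2.
Qed.

Lemma row_of_tshift n (a : 'rV[R]_n) s :
  row_of_tuple (tshift a s) = row_of_tuple s + a.
Proof. by apply/rowP => i; rewrite !mxE tnth_mktuple. Qed.

Lemma Rint_shift n (F : 'rV[R]_n -> R) (a : 'rV[R]_n) :
  measurable_fun setT (fun s => F (row_of_tuple s)) ->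
  \int[leb n]_s F (row_of_tuple s + a) = \int[leb n]_s F (row_of_tuple s).
Proof.
move=> mF; rewrite /Rintegral; congr fine.
rewrite -(integral_tshift a (F := fun s => (F (row_of_tuple s))%:E)); last exact/measurable_EFinP.
by apply: eq_integral => s _; rewrite row_of_tshift.
Qed.

Lemma measurable_shift n (F : 'rV[R]_n -> R) (a : 'rV[R]_n) :
  measurable_fun setT (fun s => F (row_of_tuple s)) ->
  measurable_fun setT (fun s => F (row_of_tuple s + a)).
Proof.
move=> mF; under eq_fun do rewrite -row_of_tshift.
by apply: (measurableT_comp mF); exact: measurable_tshift.
Qed.

Lemma rintegrable_shift n (F : 'rV[R]_n -> R) (a : 'rV[R]_n) :
  rintegrable (leb n) (fun s => F (row_of_tuple s)) ->
  rintegrable (leb n) (fun s => F (row_of_tuple s + a)).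
Proof.
move=> iF; have mF := rintegrable_measurable iF.
apply/integrableP; split.
  by apply/measurable_EFinP; exact: measurable_shift.
under eq_integral => s _ do rewrite /= -row_of_tshift.
rewrite (integral_tshift a (F := fun s => `|F (row_of_tuple s)|%:E)).
  by move/integrableP : iF => [].
by apply/measurable_EFinP; exact: measurableT_comp.
Qed.

Lemma cintegrable_shift n (F : 'rV[R]_n -> R[i]) (a : 'rV[R]_n) :
  cintegrable (leb n) (fun s => F (row_of_tuple s)) ->
  cintegrable (leb n) (fun s => F (row_of_tuple s + a)).
Proof.
by move=> [i1 i2]; split; [exact: (rintegrable_shift (F := fun x => cRe (F x)))
                         |exact: (rintegrable_shift (F := fun x => cIm (F x)))].
Qed.

Lemma cint_shift n (F : 'rV[R]_n -> R[i]) (a : 'rV[R]_n) :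
  cmfun (fun s => F (row_of_tuple s)) ->
  cint (leb n) (fun s => F (row_of_tuple s + a)) =
  cint (leb n) (fun s => F (row_of_tuple s)).
Proof.
by move=> [i1 i2]; rewrite /cint (Rint_shift (F := fun x => cRe (F x)))//
  (Rint_shift (F := fun x => cIm (F x))).
Qed.

End RowVectors.

(** * Differentiation on R^n *)
Section LineDerivatives.
Context {R : realType} {n : nat}.
Local Notation V := 'rV[R]_n.
Local Notation C := (R[i]).

(** Both difference quotients are the same function of the increment. One-variable results such as
    the chain rule and the mean value theorem are thereby available for directional derivatives. *)
Lemma is_derive_lineP (f : V -> R) (u v : V) (h l : R) :
  is_derive (u + h *: v) v f l <-> is_derive h (1 : R) (fun t : R => f (u + t *: v)) l.
Proof.
have E : (fun t : R => t^-1 *: ((f \o shift (u + h *: v)) (t *: v) - f (u + h *: v))) =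
    (fun t : R => t^-1 *: (((fun t : R => f (u + t *: v)) \o shift h) (t *: (1 : R)) - f (u + h *: v))).
  apply/funext => t /=; congr (_ *: (f _ - _)).
  by rewrite /shift /= -[t *: 1]/(t * 1) mulr1 addrC -addrA -scalerDl addrC [in LHS]addrC [h + t]addrC.
by split=> -[d e]; split; move: d e; rewrite /derivable /derive E.
Qed.

Lemma is_derive_comp1 (g : R -> R) (f : V -> R) (u v : V) (a b : R) :
  is_derive (f u) (1 : R) g a -> is_derive u v f b -> is_derive u v (g \o f) (a * b).
Proof.
move=> dg; rewrite -{1 2}[u](addr0 u) -(scale0r v) => /is_derive_lineP df.
apply/is_derive_lineP.
have := @is_derive1_comp R g (fun t => f (u + t *: v)) 0 a b.
by rewrite scale0r addr0; apply.
Qed.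

(** A relation that carries existence and value together, so that the rules of calculus compose
    without separate derivability conditions. *)
Definition cder (F : V -> C) (u v : V) (l : C) :=
  is_derive u v (fun x => cRe (F x)) (cRe l) /\
  is_derive u v (fun x => cIm (F x)) (cIm l).

Lemma cder_eq F u v l l' : cder F u v l -> l = l' -> cder F u v l'.
Proof. by move=> + <-. Qed.

Lemma cder_cst a u v : cder (fun=> a) u v 0.
Proof. by split; exact: is_derive_cst. Qed.

Lemma cderD F G u v l m : cder F u v l -> cder G u v m ->
  cder (fun x => F x + G x) u v (l + m).
Proof.
move=> [F1 F2] [G1 G2]; split.
  rewrite ReD (_ : (fun x => _) = (fun x => cRe (F x)) + (fun x => cRe (G x))).
    exact: is_deriveD.
  by apply/funext => x; rewrite ReD.
rewrite ImD (_ : (fun x => _) = (fun x => cIm (F x)) + (fun x => cIm (G x))).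
  exact: is_deriveD.
by apply/funext => x; rewrite ImD.
Qed.

Lemma cderM F G u v l m : cder F u v l -> cder G u v m ->
  cder (fun x => F x * G x) u v (l * G u + F u * m).
Proof.
move=> [F1 F2] [G1 G2]; split.
  rewrite (_ : (fun x => _) = (fun x => cRe (F x)) * (fun x => cRe (G x)) -
                              (fun x => cIm (F x)) * (fun x => cIm (G x))).
    apply: is_derive_eq (is_deriveB (is_deriveM F1 G1) (is_deriveM F2 G2)) _.
    by rewrite !ReD !ReM /GRing.scale /=; ring.
  by apply/funext => x; rewrite ReM.
rewrite (_ : (fun x => _) = (fun x => cRe (F x)) * (fun x => cIm (G x)) +
                            (fun x => cIm (F x)) * (fun x => cRe (G x))).
  apply: is_derive_eq (is_deriveD (is_deriveM F1 G2) (is_deriveM F2 G1)) _.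
  by rewrite !ImD !ImM /GRing.scale /=; ring.
by apply/funext => x; rewrite ImM.
Qed.

Lemma cderZ a F u v l : cder F u v l -> cder (fun x => a * F x) u v (a * l).
Proof.
by move=> dF; apply: cder_eq (cderM (cder_cst a u v) dF) _; rewrite mul0r add0r.
Qed.

Lemma cder_sum (I : Type) (r : seq I) (F : I -> V -> C) u v (l : I -> C) :
  (forall i, cder (F i) u v (l i)) ->
  cder (fun x => \sum_(i <- r) F i x) u v (\sum_(i <- r) l i).
Proof.
move=> dF; elim: r => [|i r IH].
  by rewrite big_nil; under eq_fun do rewrite big_nil; exact: cder_cst.
by rewrite big_cons; under eq_fun do rewrite big_cons; exact: cderD.
Qed.

Lemma cder_real (f : V -> R) u v l : is_derive u v f l -> cder (fun x => (f x)%:C) u v l%:C.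
Proof. by move=> df; split => //=; exact: is_derive_cst. Qed.

Lemma is_derive_coord (j : 'I_n) (u v : V) : is_derive u v (fun x : V => x 0 j) (v 0 j).
Proof.
rewrite -[u](addr0 u) -(scale0r v); apply/is_derive_lineP.
rewrite (_ : (fun t : R => _) = cst (u 0 j) + (v 0 j \*: (id : R -> R))).
  apply: is_derive_eq.
  by rewrite add0r /GRing.scale /= mulr1.
by apply/funext => t; rewrite !mxE /= /GRing.scale /= [RHS]/GRing.add /= mulrC.
Qed.

Lemma cder_coord (j : 'I_n) (u v : V) : cder (fun x => (x 0 j)%:C) u v (v 0 j)%:C.
Proof. by apply: cder_real; exact: is_derive_coord. Qed.

Lemma cder_cexp F u v l : cder F u v l ->
  cder (fun x => cexp (F x)) u v (l * cexp (F u)).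
Proof.
move=> [F1 F2].
have e1 : is_derive u v (fun x => expR (cRe (F x))) (expR (cRe (F u)) * cRe l).
  exact: (@is_derive_comp1 expR (fun x => cRe (F x))).
have e2 : is_derive u v (fun x => cos (cIm (F x))) (- sin (cIm (F u)) * cIm l).
  exact: (@is_derive_comp1 (@cos R) (fun x => cIm (F x))).
have e3 : is_derive u v (fun x => sin (cIm (F x))) (cos (cIm (F u)) * cIm l).
  exact: (@is_derive_comp1 (@sin R) (fun x => cIm (F x))).
split.
  rewrite (_ : (fun x => _) = (fun x => expR (cRe (F x))) * (fun x => cos (cIm (F x)))).
    apply: is_derive_eq (is_deriveM e1 e2) _.
    by rewrite ReM Re_cexp Im_cexp /GRing.scale /=; ring.
  by apply/funext => x; rewrite Re_cexp.
rewrite (_ : (fun x => _) = (fun x => expR (cRe (F x))) * (fun x => sin (cIm (F x)))).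
  apply: is_derive_eq (is_deriveM e1 e3) _.
  by rewrite ImM Re_cexp Im_cexp /GRing.scale /=; ring.
by apply/funext => x; rewrite Im_cexp.
Qed.

Lemma real_mvt_le (f : V -> R) (u v : V) (L : R -> R) (B : R) :
  (forall h, is_derive (u + h *: v) v f (L h)) ->
  (forall h, 0 <= h <= 1 -> `|L h| <= B) -> `|f (u + v) - f u| <= B.
Proof.
move=> df LB; pose p (t : R) := f (u + t *: v).
have dp (t : R) : is_derive t (1 : R) p (L t) by apply/is_derive_lineP.
have cp : {within `[0, 1], continuous p}.
  by apply: derivable_within_continuous => t _; have [] := dp t.
have [c c01 E] := @MVT_segment R p L 0 1 ler01 (fun x _ => dp x) cp.
move: E; rewrite subr0 mulr1 /p scale1r scale0r addr0 => ->; apply: LB.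
by move: c01; rewrite in_itv.
Qed.

(** Real and imaginary parts have their own intermediate points, whence the factor 2. It is
    harmless: the lemma serves Lipschitz bounds with unspecified constants, and the case of a
    vanishing derivative. *)
Lemma cder_mvt (F : V -> C) (u v : V) (L : R -> C) (B : R) :
  (forall h, cder F (u + h *: v) v (L h)) ->
  (forall h, 0 <= h <= 1 -> nc (L h) <= B) -> nc (F (u + v) - F u) <= B *+ 2.
Proof.
move=> dF LB; apply: le_trans (normc_le_ReIm _) _.
rewrite ReD ReN ImD ImN mulr2n; apply: lerD.
  apply: (@real_mvt_le (fun x => cRe (F x)) u v (fun h => cRe (L h))) => h.
    by have [] := dF h.
  by move=> h01; exact: le_trans (normr_Re_le _) (LB h h01).
apply: (@real_mvt_le (fun x => cIm (F x)) u v (fun h => cIm (L h))) => h.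
  by have [] := dF h.
by move=> h01; exact: le_trans (normr_Im_le _) (LB h h01).
Qed.

Definition ccont (F : V -> C) :=
  continuous (fun x => cRe (F x)) /\ continuous (fun x => cIm (F x)).

(* Unification unfolds neighbourhoods of matrices, so that the instance
   [nbhs_filter] has to be given explicitly. *)
Lemma rcontD (f g : V -> R) : continuous f -> continuous g -> continuous (fun x => f x + g x).
Proof. by move=> cf cg u; apply: (@cvgD _ _ _ _ (nbhs_filter u)); [exact: cf|exact: cg]. Qed.

Lemma rcontB (f g : V -> R) : continuous f -> continuous g -> continuous (fun x => f x - g x).
Proof. by move=> cf cg u; apply: (@cvgB _ _ _ _ (nbhs_filter u)); [exact: cf|exact: cg]. Qed.

Lemma rcontM (f g : V -> R) : continuous f -> continuous g -> continuous (fun x => f x * g x).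
Proof. by move=> cf cg u; apply: (@cvgM _ _ _ (nbhs_filter u)); [exact: cf|exact: cg]. Qed.

Lemma rcont_cst (a : R) : continuous (fun _ : V => a).
Proof. by move=> u; exact: (@cvg_cst _ _ _ _ (nbhs_filter u)). Qed.

Lemma rcont_comp (h : R -> R) (f : V -> R) :
  continuous h -> continuous f -> continuous (fun x => h (f x)).
Proof. by move=> ch cf u; exact: (@cvg_comp _ _ _ f h (nbhs u) (nbhs (f u)) _ (cf u) (ch (f u))). Qed.

Lemma ccontD F G : ccont F -> ccont G -> ccont (fun x => F x + G x).
Proof.
move=> [F1 F2] [G1 G2]; split.
  by under eq_fun do rewrite ReD; exact: rcontD.
by under eq_fun do rewrite ImD; exact: rcontD.
Qed.

Lemma ccontM F G : ccont F -> ccont G -> ccont (fun x => F x * G x).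
Proof.
move=> [F1 F2] [G1 G2]; split.
  by under eq_fun do rewrite ReM; apply: rcontB; exact: rcontM.
by under eq_fun do rewrite ImM; apply: rcontD; exact: rcontM.
Qed.

Lemma ccont_cst a : ccont (fun=> a).
Proof. by split; exact: rcont_cst. Qed.

Lemma ccont_real (f : V -> R) : continuous f -> ccont (fun x => (f x)%:C).
Proof. by move=> cf; split => //=; exact: rcont_cst. Qed.

Lemma ccont_coord (j : 'I_n) : ccont (fun x => (x 0 j)%:C).
Proof. by apply: ccont_real; exact: coord_continuous. Qed.

Lemma ccont_cexp F : ccont F -> ccont (fun x => cexp (F x)).
Proof.
move=> [F1 F2]; split.
  under eq_fun do rewrite Re_cexp.
  by apply: rcontM; apply: rcont_comp => //; [exact: continuous_expR|exact: continuous_cos].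
under eq_fun do rewrite Im_cexp.
by apply: rcontM; apply: rcont_comp => //; [exact: continuous_expR|exact: continuous_sin].
Qed.

Lemma lipschitz_continuous (f : V -> R) (B : V -> R) :
  (forall u v, `|v| <= 1 -> `|f (u + v) - f u| <= B u * `|v|) -> continuous f.
Proof.
move=> fB u; apply/(@cvgrPdist_le _ _ _ _ (nbhs_filter u)) => e e0.
pose d := Num.min 1 (e / (1 + `|B u|)).
have d0 : 0 < d by rewrite lt_min ltr01 divr_gt0// ltr_pwDl.
apply/(@nbhs_ballP _ V); exists d => //; rewrite mx_norm_ball => w /= /ltW wd.
move: wd; rewrite distrC le_min => /andP[w1 w2].
have := fB u (w - u) w1; rewrite (addrC u) subrK distrC => fw; apply: (le_trans fw).
have H : B u <= 1 + `|B u| by rewrite ler_wpDl// ler_norm.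
apply: (le_trans (ler_wpM2r (normr_ge0 _) H)).
by rewrite mulrC -ler_pdivlMr// ltr_pwDl.
Qed.

Lemma clipschitz_ccont (F : V -> C) (B : V -> R) :
  (forall u v, `|v| <= 1 -> nc (F (u + v) - F u) <= B u * `|v|) -> ccont F.
Proof.
move=> FB; split; apply: (lipschitz_continuous (B := B)) => u v v1.
  by rewrite -ReN -ReD; exact: le_trans (normr_Re_le _) (FB _ _ v1).
by rewrite -ImN -ImD; exact: le_trans (normr_Im_le _) (FB _ _ v1).
Qed.

(** Polynomials as a closure predicate: growth bounds and gradients follow by one induction each,
    and the polynomial factor of a differentiated Gaussian never has to be computed. *)
Inductive cpoly : (V -> C) -> Prop :=
| cpoly_cst a : cpoly (fun=> a)
| cpoly_coord j : cpoly (fun x => (x 0 j)%:C)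
| cpolyD P Q : cpoly P -> cpoly Q -> cpoly (fun x => P x + Q x)
| cpolyM P Q : cpoly P -> cpoly Q -> cpoly (fun x => P x * Q x).

Lemma cpoly_sum (I : Type) (r : seq I) (P : I -> V -> C) :
  (forall i, cpoly (P i)) -> cpoly (fun x => \sum_(i <- r) P i x).
Proof.
move=> cP; elim: r => [|i r IH].
  by under eq_fun do rewrite big_nil; exact: cpoly_cst.
by under eq_fun do rewrite big_cons; exact: cpolyD.
Qed.

Lemma cpoly_prod (I : Type) (r : seq I) (P : I -> V -> C) :
  (forall i, cpoly (P i)) -> cpoly (fun x => \prod_(i <- r) P i x).
Proof.
move=> cP; elim: r => [|i r IH].
  by under eq_fun do rewrite big_nil; exact: cpoly_cst.
by under eq_fun do rewrite big_cons; exact: cpolyM.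
Qed.

Lemma cpoly_ccont P : cpoly P -> ccont P.
Proof.
elim=> *; [exact: ccont_cst|exact: ccont_coord|exact: ccontD|exact: ccontM].
Qed.

Lemma cpoly_bound P : cpoly P ->
  exists B k, 0 <= B /\ forall u, nc (P u) <= B * jb u ^+ k.
Proof.
elim=> {P} [a|j|P Q _ [B [k [B0 HB]]] _ [D [l [D0 HD]]]
            |P Q _ [B [k [B0 HB]]] _ [D [l [D0 HD]]]].
- by exists (nc a), 0%N; split=> [|u]; rewrite ?normc_ge0// mulr1.
- exists 1, 1%N; split=> // u; rewrite normc_real mul1r expr1.
  by apply: le_trans (normr_coord_le _ _) _; rewrite lerDr.
- exists (B + D), (maxn k l); split=> [|u]; first exact: addr_ge0.
  apply: le_trans (le_normcD _ _) _; rewrite mulrDl; apply: lerD.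
    by apply: le_trans (HB u) _; rewrite ler_wpM2l// jbX_homo// leq_maxl.
  by apply: le_trans (HD u) _; rewrite ler_wpM2l// jbX_homo// leq_maxr.
- exists (B * D), (k + l)%N; split=> [|u]; first exact: mulr_ge0.
  rewrite Normc.normcM exprD mulrACA.
  by apply: ler_pM; rewrite ?normc_ge0.
Qed.

Lemma cpoly_grad P : cpoly P -> exists D : 'I_n -> V -> C,
  (forall j, cpoly (D j)) /\
  forall u v, cder P u v (\sum_j (v 0 j)%:C * D j u).
Proof.
elim=> {P} [a|j|P Q cP [D [cD dP]] cQ [E [cE dQ]]
            |P Q cP [D [cD dP]] cQ [E [cE dQ]]].
- exists (fun j _ => 0); split=> [j|u v]; first exact: cpoly_cst.
  by rewrite big1 => [|j _]; [exact: cder_cst|rewrite mulr0].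
- exists (fun i _ => (i == j)%:R); split=> [i|u v]; first exact: cpoly_cst.
  rewrite (bigD1 j)//= eqxx mulr1 big1 ?addr0; first exact: cder_coord.
  by move=> i /negPf ->; rewrite mulr0.
- exists (fun j x => D j x + E j x); split=> [j|u v]; first exact: cpolyD.
  apply: cder_eq (cderD (dP u v) (dQ u v)) _; rewrite -big_split /=.
  by apply: eq_bigr => j _; rewrite mulrDr.
- exists (fun j x => D j x * Q x + P x * E j x); split=> [j|u v].
    by apply: cpolyD; exact: cpolyM.
  apply: cder_eq (cderM (dP u v) (dQ u v)) _.
  rewrite mulr_suml mulr_sumr -big_split /=.
  by apply: eq_bigr => j _; ring.
Qed.

End LineDerivatives.

(** For a positive exponent K, exp(c r^2) is the K-th power of exp(c r^2 / K), which is at least 1 +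
    c r^2 / K. It remains to compare 1 + r with a multiple of this quadratic. *)
Lemma gauss_poly_bound (R : realType) (k : nat) (c : R) : 0 < c ->
  exists B, 0 <= B /\ forall r, 0 <= r -> (1 + r) ^+ k * expR (- (c * r ^+ 2)) <= B.
Proof.
move=> c0; case: k => [|k].
  exists 1; split=> // r r0; rewrite expr0 mul1r -expR0 ler_expR.
  by rewrite oppr_le0 mulr_ge0 ?sqr_ge0// ltW.
have K0 : 0 < k.+1%:R :> R by [].
(* With this choice the product B (1 + c r^2 / K) contains 2 + r^2, which exceeds 1 + r. *)
pose B := 2 + k.+1%:R / c.
have B0 : 0 <= B by rewrite addr_ge0// divr_ge0// ltW.
exists (B ^+ k.+1); split=> [|r r0]; first exact: exprn_ge0.
rewrite expRN ler_pdivrMr ?expR_gt0//.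
have -> : c * r ^+ 2 = k.+1%:R * (c * r ^+ 2 / k.+1%:R) by field.
rewrite expRM_natl -exprMn; apply: lerXn2r; rewrite ?nnegrE ?addr_ge0//.
  by rewrite mulr_ge0// expR_ge0.
apply: le_trans (_ : B * (1 + c * r ^+ 2 / k.+1%:R) <= _); last first.
  by rewrite ler_wpM2l// expR_ge1Dx.
have -> : B * (1 + c * r ^+ 2 / k.+1%:R) =
    2 + r ^+ 2 + k.+1%:R / c + 2 * (c * r ^+ 2 / k.+1%:R).
  by rewrite /B; move: (k.+1%:R) K0 => K K0; field; rewrite !gt_eqF.
have : 0 <= k.+1%:R / c by rewrite divr_ge0// ltW.
have : 0 <= c * r ^+ 2 / k.+1%:R by rewrite !mulr_ge0// ?invr_ge0 ?sqr_ge0// ltW.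
move: (c * _ / _) (_ / c) => a b *; nra.
Qed.

(* Completing the square reduces this to [gauss_poly_bound]. *)
Lemma gauss_poly_bound_lin (R : realType) (k : nat) (c b : R) : 0 < c ->
  exists B, 0 <= B /\
    forall r, 0 <= r -> (1 + r) ^+ k * expR (- (c * r ^+ 2) + b * r) <= B.
Proof.
move=> c0; have [B [B0 HB]] := @gauss_poly_bound R k (c / 2) ltac:(by rewrite divr_gt0).
exists (B * expR (b ^+ 2 / (2 * c))); split=> [|r r0]; first by rewrite mulr_ge0// expR_ge0.
apply: le_trans (ler_wpM2r (expR_ge0 (b ^+ 2 / (2 * c))) (HB r r0)).
rewrite -[leRHS]mulrA -expRD.
rewrite ler_wpM2l ?exprn_ge0 ?addr_ge0// ler_expR -subr_ge0.
have -> : - (c / 2 * r ^+ 2) + b ^+ 2 / (2 * c) - (- (c * r ^+ 2) + b * r) =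
    (c * r - b) ^+ 2 / (2 * c) by field; rewrite gt_eqF.
by rewrite divr_ge0 ?sqr_ge0// mulr_ge0// ltW.
Qed.

(** * Schwartz functions and tempered distributions *)
Section SchwartzSpace.
Context {R : realType} {n : nat}.
Local Notation V := 'rV[R]_n.
Local Notation C := (R[i]).
Implicit Types (f g : V -> C) (r a : seq 'I_n).

Lemma cder_pderivable f x i l : cder f x (delta_mx 0 i) l -> pderivable i f x.
Proof. by case=> -[d1 _] [d2 _]; exact: conj d1 d2. Qed.

Lemma cder_pderive f x i l : cder f x (delta_mx 0 i) l -> pderive i f x = l.
Proof. by move=> [[_ e1] [_ e2]]; apply: complex_eqP. Qed.

Lemma pderivable_cder f x i : pderivable i f x -> cder f x (delta_mx 0 i) (pderive i f x).
Proof. by case=> d1 d2; exact: conj (DeriveDef d1 erefl) (DeriveDef d2 erefl). Qed.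

Lemma smooth_cder f r i x : smooth f ->
  cder (pderives r f) x (delta_mx 0 i) (pderives (i :: r) f x).
Proof. by move=> sf; have [_ _ d] := sf r; exact: pderivable_cder. Qed.

Lemma smooth_ccont f r : smooth f -> ccont (pderives r f).
Proof. by move=> sf; have [c1 c2 _] := sf r. Qed.

Lemma pderives_rcons f r i : pderives (rcons r i) f = pderives r (pderive i f).
Proof. by rewrite /pderives foldr_rcons. Qed.

Lemma smooth_pderive f i : smooth f -> smooth (pderive i f).
Proof. by move=> sf r; rewrite -pderives_rcons; exact: sf. Qed.

Lemma monomial_le a (x : V) : `|monomial a x| <= jb x ^+ size a.
Proof.
rewrite /monomial; elim: a => [|j a IH]; first by rewrite big_nil normr1 expr0.
rewrite big_cons normrM exprS; apply: ler_pM => //.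
by rewrite (le_trans (normr_coord_le x j))// lerDr.
Qed.

Lemma rV_norm_attained (x : V) : `|x| = 0 \/ exists j, `|x| = `|x 0 j|.
Proof.
have [->|x0] := eqVneq `|x| 0; first by left.
right; have [[i j] /= E] := mx_norm_neq0 x0.
by exists j; move: E; rewrite (ord1 i).
Qed.

Lemma jbX_split (x : V) k : jb x ^+ k <= 2 ^+ k * (1 + `|x| ^+ k).
Proof.
have [x1|x1] := leP `|x| 1.
  apply: (@le_trans _ _ (2 ^+ k)).
    by apply: lerXn2r; rewrite ?nnegrE ?(ltW (jb_gt0 _))// /jb; lra.
  by rewrite ler_peMr ?exprn_ge0// lerDl exprn_ge0.
apply: (@le_trans _ _ ((2 * `|x|) ^+ k)).
  by apply: lerXn2r; rewrite ?nnegrE ?(ltW (jb_gt0 _)) ?mulr_ge0// /jb; lra.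
by rewrite exprMn ler_wpM2l ?exprn_ge0// lerDr.
Qed.

(* All weights [jb x ^+ k] instead of monomials. *)
Definition rapid f := forall r k, exists B, 0 <= B /\
  forall x, jb x ^+ k * nc (pderives r f x) <= B.

Lemma seminorm_le a r f (B : R) :
  (forall x, `|monomial a x| * nc (pderives r f x) <= B) -> (seminorm a r f <= B%:E)%E.
Proof. by move=> H; apply: ge_ereal_sup => _ [x _ <-]; rewrite lee_fin. Qed.

Lemma rapid_schwartz f : smooth f -> rapid f -> schwartz f.
Proof.
move=> sf rf; split => // a r; have [B [B0 HB]] := rf r (size a).
apply: (@le_lt_trans _ _ B%:E); last by rewrite ltry.
apply: seminorm_le => x; apply: le_trans (HB x).
by rewrite ler_wpM2r ?normc_ge0// monomial_le.
Qed.

(** The sup norm of x is attained at some coordinate j, so |x|^k is the modulus of the monomial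
    x_j^k, and [jbX_split] reduces the weight to the constant monomial and these n pure powers. *)
Lemma schwartz_rapid f : schwartz f -> rapid f.
Proof.
move=> [_ sf] r k.
have bnd a : exists B, 0 <= B /\ forall x, `|monomial a x| * nc (pderives r f x) <= B.
  have := sf a r; rewrite /seminorm; set s := ereal_sup _ => slt.
  exists `|fine s|; split=> // x.
  have xs : ((`|monomial a x| * nc (pderives r f x))%:E <= s)%E.
    by apply: ereal_sup_ubound; exists x.
  have sf1 : s \is a fin_num.
    rewrite ge0_fin_numE//; apply: le_trans xs.
    by rewrite lee_fin mulr_ge0 ?normc_ge0.
  by move: xs; rewrite -(fineK sf1) lee_fin => xs; exact: le_trans xs (ler_norm _).
have [B HB] := choice (fun j => bnd (nseq k j)).
have [D [D0 HD]] := bnd [::].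
exists (2 ^+ k * (D + \sum_j B j)); split=> [|x].
  rewrite mulr_ge0 ?exprn_ge0// addr_ge0// sumr_ge0// => j _.
  by have [] := HB j.
have S0 : 0 <= \sum_j B j by apply: sumr_ge0 => j _; have [] := HB j.
have HDx : nc (pderives r f x) <= D.
  by have := HD x; rewrite /monomial big_nil normr1 mul1r.
have [x0|[j xj]] := rV_norm_attained x.
  rewrite /jb x0 addr0 expr1n mul1r (le_trans HDx)// (@le_trans _ _ (D + \sum_j B j))//.
    by rewrite lerDl.
  by rewrite ler_peMl ?addr_ge0// exprn_ege1// ler1n.
apply: le_trans (ler_wpM2r (normc_ge0 _) (jbX_split x k)) _.
rewrite -mulrA ler_wpM2l ?exprn_ge0// mulrDl mul1r; apply: lerD => //.
apply: (@le_trans _ _ (B j)).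
  have [_ /(_ x)] := HB j.
  by rewrite /monomial big_nseq -Monoid.iteropE /= -/(_ ^+ _) normrX -xj.
by rewrite (bigD1 j)//= lerDl sumr_ge0// => i _; have [] := HB i.
Qed.

(* Bounds and Lipschitz bounds in the parameter, polynomial in the parameter,
   for every Schwartz seminorm of the members of a family. *)
Definition tame m (G : 'rV[R]_m -> V -> C) :=
  [/\ forall s, smooth (G s),
      forall a r, exists B k, 0 <= B /\ forall s y,
        `|monomial a y| * nc (pderives r (G s) y) <= B * jb s ^+ k &
      forall a r, exists B k, 0 <= B /\ forall s d y, `|d| <= 1 ->
        `|monomial a y| * nc (pderives r (G (s + d)) y - pderives r (G s) y) <=
        B * jb s ^+ k * `|d|].

Lemma tame_schwartz m (G : 'rV[R]_m -> V -> C) s : tame G -> schwartz (G s).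
Proof.
case=> sG bG _; split=> // a r; have [B [k [_ HB]]] := bG a r.
by apply: le_lt_trans (seminorm_le (HB s)) _; rewrite ltry.
Qed.

Lemma smooth_comb c f g : smooth f -> smooth g ->
  smooth (fun x => c * f x + g x) /\
  forall r x, pderives r (fun x => c * f x + g x) x = c * pderives r f x + pderives r g x.
Proof.
move=> sf sg; have E r : pderives r (fun x => c * f x + g x) =
    fun x => c * pderives r f x + pderives r g x.
  elim: r => [//|i r IH] /=; apply/funext => x; rewrite -/(pderives r _) IH.
  apply: cder_pderive; apply: cderD; last exact: (smooth_cder r i x sg).
  apply: cderZ; exact: (smooth_cder r i x sf).
split=> [r|r x]; last by rewrite E.
rewrite E; have [c1 c2] : ccont (fun x => c * pderives r f x + pderives r g x).
  apply: ccontD; last exact: smooth_ccont.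
  by apply: ccontM; [exact: ccont_cst|exact: smooth_ccont].
split => // i x; apply: (@cder_pderivable _ _ _ (c * pderives (i :: r) f x + pderives (i :: r) g x)).
apply: cderD; last exact: (smooth_cder r i x sg).
by apply: cderZ; exact: (smooth_cder r i x sf).
Qed.

Lemma schwartz_comb c f g : schwartz f -> schwartz g -> schwartz (fun x => c * f x + g x).
Proof.
move=> hf hg; have [sf _] := hf; have [sg _] := hg.
have [sfg E] := smooth_comb c sf sg.
apply: rapid_schwartz => // r k.
have [B [B0 HB]] := schwartz_rapid hf r k; have [D [D0 HD]] := schwartz_rapid hg r k.
exists (nc c * B + D); split=> [|x]; first by rewrite addr_ge0// mulr_ge0// normc_ge0.
rewrite E; apply: le_trans (ler_wpM2l (ltW (jbX_gt0 _ _)) (le_normcD _ _)) _.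
rewrite Normc.normcM mulrDr mulrCA; apply: lerD (HD x).
by rewrite ler_wpM2l ?normc_ge0.
Qed.

Lemma pderives0 r (x : V) : pderives r (fun=> 0 : C) x = 0.
Proof.
suff -> : pderives r (fun=> 0 : C) = fun=> 0 by [].
elim: r => [//|i r IH] /=; rewrite -/(pderives r _) IH; apply/funext => y.
by apply: cder_pderive; exact: cder_cst.
Qed.

Lemma schwartz0 : schwartz (fun _ : V => 0 : C).
Proof.
have E r : pderives r (fun=> 0 : C) = fun _ : V => 0 by apply/funext => x; exact: pderives0.
apply: rapid_schwartz => [r|r k].
  rewrite E; have [c1 c2] := @ccont_cst R n 0.
  split => // i x; exact: cder_pderivable (cder_cst 0 x (delta_mx 0 i)).
by exists 0; split => // x; rewrite E Normc.normc0 mulr0.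
Qed.

Lemma schwartz_sum (I : Type) (q : seq I) (c : I -> C) (F : I -> V -> C) :
  (forall i, schwartz (F i)) ->
  schwartz (fun x => \sum_(i <- q) c i * F i x) /\
  forall r x, pderives r (fun x => \sum_(i <- q) c i * F i x) x =
    \sum_(i <- q) c i * pderives r (F i) x.
Proof.
move=> sF; elim: q => [|i q [IH1 IH2]].
  rewrite (_ : (fun x => _) = fun=> 0); last by apply/funext => x; rewrite big_nil.
  by split=> [|r x]; [exact: schwartz0|rewrite big_nil pderives0].
rewrite (_ : (fun x => _) = fun x => c i * F i x + \sum_(j <- q) c j * F j x); last first.
  by apply/funext => x; rewrite big_cons.
split=> [|r x]; first exact: schwartz_comb.
have [_ ->] := smooth_comb (c i) (sF i).1 IH1.1.
by rewrite big_cons IH2.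
Qed.

Lemma schwartz_pderive i f : schwartz f -> schwartz (pderive i f).
Proof.
move=> [sf bf]; split=> [|a r]; first exact: smooth_pderive.
by have := bf a (rcons r i); rewrite /seminorm pderives_rcons.
Qed.

Lemma schwartz_cmfun f d (T : measurableType d) (p : T -> V) : schwartz f ->
  (forall i, measurable_fun setT (fun t => p t 0 i)) -> cmfun (fun t => f (p t)).
Proof.
by move=> [sf _] mp; have [c1 c2] := smooth_ccont [::] sf; exact: cmfun_continuous_rV.
Qed.

Lemma schwartz_decay f k : schwartz f ->
  exists B, 0 <= B /\ forall x, nc (f x) <= B * jb x ^- k.
Proof.
move=> /schwartz_rapid/(_ [::] k)[B [B0 HB]]; exists B; split=> // x.
by rewrite ler_pdivlMr ?jbX_gt0// mulrC.
Qed.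

Lemma schwartz_cintegrable f : schwartz f ->
  cintegrable (leb n) (fun s => f (row_of_tuple s)).
Proof.
move=> sf; have [B [B0 HB]] := schwartz_decay (2 * n) sf.
apply: (@cintegrable_le _ _ _ _ _ (fun s => B * jb (row_of_tuple s) ^- (2 * n))).
- by apply: schwartz_cmfun => // i; exact: measurable_coord.
- by apply: rintegrableZ; exact: rintegrable_jbV.
- by move=> s; exact: HB.
Qed.

End SchwartzSpace.

Section TemperedDistributions.
Context {R : realType} {n : nat}.
Local Notation V := 'rV[R]_n.
Local Notation C := (R[i]).
Variable (u : @functional R n).
Hypothesis tu : tempered u.

Lemma tempered0 : u (fun=> 0) = 0.
Proof.
have := tu.1 1 (fun=> 0) (fun=> 0) schwartz0 schwartz0.
rewrite (_ : (fun x => _) = fun=> 0); last by apply/funext => x; rewrite mulr0 addr0.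
by rewrite mul1r => /eqP; rewrite -subr_eq0 opprD addrA subrr sub0r oppr_eq0 => /eqP.
Qed.

Lemma temperedZ c f : schwartz f -> u (fun x => c * f x) = c * u f.
Proof.
move=> sf; have := tu.1 c f (fun=> 0) sf schwartz0.
rewrite tempered0 addr0 => <-; congr u; apply/funext => x; by rewrite addr0.
Qed.

Lemma temperedB f g : schwartz f -> schwartz g -> u (fun x => f x - g x) = u f - u g.
Proof.
move=> sf sg; have := tu.1 (-1) g f sg sf.
rewrite mulN1r addrC => <-; congr u; apply/funext => x; by rewrite mulN1r addrC.
Qed.

Lemma tempered_sum (I : Type) (q : seq I) (c : I -> C) (F : I -> V -> C) :
  (forall i, schwartz (F i)) ->
  u (fun x => \sum_(i <- q) c i * F i x) = \sum_(i <- q) c i * u (F i).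
Proof.
move=> sF; elim: q => [|i q IH].
  rewrite (_ : (fun x => _) = fun=> 0); last by apply/funext => x; rewrite big_nil.
  by rewrite big_nil tempered0.
rewrite (_ : (fun x => _) = fun x => c i * F i x + \sum_(j <- q) c j * F j x); last first.
  by apply/funext => x; rewrite big_cons.
rewrite tu.1//; first by rewrite big_cons IH.
by have [] := schwartz_sum q c sF.
Qed.

(** Homogeneity turns continuity at 0 into a linear bound by a single seminorm level: f is scaled
    until its seminorms fall below the threshold d. The slack e allows B = 0 and is removed at the
    end. *)
Lemma tempered_order : exists N K, 0 <= K /\ forall f (B : R), schwartz f -> 0 <= B ->
  (forall a r x, (size a <= N)%N -> (size r <= N)%N ->
     `|monomial a x| * nc (pderives r f x) <= B) -> nc (u f) <= K * B.
Proof.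
have [N [d d0 Hd]] := tu.2 1 ltr01.
exists N, (2 / d); split=> [|f B sf B0 HB]; first by rewrite divr_ge0// ltW.
suff H e : 0 < e -> nc (u f) <= 2 / d * (B + e).
  apply/ler_addgt0Pr => e e0; apply: le_trans (H (e / (2 / d)) _) _.
    by rewrite !divr_gt0.
  by rewrite mulrDr mulrCA mulfV ?mulr1// gt_eqF// divr_gt0.
move=> e0; have Be : 0 < B + e by rewrite ltr_wpDl.
(* The factor 2 leaves seminorms of at most d / 2, hence the strict inequality that continuity
   requires. *)
pose c := d / (2 * (B + e)).
have c0 : 0 < c by rewrite divr_gt0// mulr_gt0.
have sc : schwartz (fun x => c%:C * f x).
  have := schwartz_comb c%:C sf schwartz0.
  by rewrite (_ : (fun x => _) = fun x => c%:C * f x)//; apply/funext => x; rewrite addr0.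
have := Hd _ sc; rewrite temperedZ// Normc.normcM normc_real gtr0_norm// => H.
rewrite -ler_pdivrMl; last by rewrite divr_gt0.
have -> : (2 / d)^-1 * nc (u f) = c * nc (u f) * (B + e).
  by rewrite /c; field; rewrite !gt_eqF.
rewrite -[leRHS]mul1r ler_pM2r//; apply/ltW/H => a r aN rN.
apply: (@le_lt_trans _ _ (d / 2)%:E); last by rewrite lte_fin; lra.
apply: seminorm_le => x.
have [_ E] := smooth_comb c%:C sf.1 (@schwartz0 R n).1.
rewrite (_ : (fun x => c%:C * f x) = fun x => c%:C * f x + 0); last first.
  by apply/funext => z; rewrite addr0.
rewrite E pderives0 addr0 Normc.normcM normc_real (gtr0_norm c0) mulrCA.
apply: le_trans (ler_wpM2l (ltW c0) (HB a r x aN rN)) _.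
rewrite /c mulrAC ler_pdivrMr ?mulr_gt0//.
have -> : d / 2 * (2 * (B + e)) = d * (B + e) by field.
by rewrite ler_wpM2l ?lerDl ?ltW.
Qed.

End TemperedDistributions.

Section RowBlocks.
Context {R : realType}.

Lemma row_mx_norm_le m n (x : 'rV[R]_m) (y : 'rV[R]_n) : `|row_mx x y| <= `|x| + `|y|.
Proof.
apply: rV_norm_le => [|i]; first by rewrite addr_ge0.
rewrite mxE; case: split_ordP => j _.
  by rewrite (le_trans (normr_coord_le _ _))// lerDl.
by rewrite (le_trans (normr_coord_le _ _))// lerDr.
Qed.

Lemma normr_lsubmx_le m n (x : 'rV[R]_(m + n)) : `|lsubmx x| <= `|x|.
Proof. by apply: rV_norm_le => // i; rewrite mxE normr_coord_le. Qed.

Lemma row_mx_line m n (x d : 'rV[R]_m) (y e : 'rV[R]_n) h :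
  row_mx x y + h *: row_mx d e = row_mx (x + h *: d) (y + h *: e).
Proof. by rewrite scale_row_mx add_row_mx. Qed.

Lemma cder_row_mxr m n (F : 'rV[R]_(m + n) -> R[i]) x y v l :
  cder F (row_mx x y) (row_mx 0 v) l -> cder (fun y => F (row_mx x y)) y v l.
Proof.
have E (f : 'rV[R]_(m + n) -> R) c : is_derive (row_mx x y) (row_mx 0 v) f c ->
    is_derive y v (fun y => f (row_mx x y)) c.
  rewrite -[row_mx x y](addr0 _) -(scale0r (row_mx 0 v)) => /is_derive_lineP H.
  rewrite -[y](addr0 _) -(scale0r v); apply/is_derive_lineP.
  move: H; congr (is_derive _ _ _ _); apply/funext => t.
  by rewrite row_mx_line scaler0 addr0.
by move=> [/E d1 /E d2]; exact: conj d1 d2.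
Qed.

Lemma row_mx0_delta m n (i : 'I_n) :
  row_mx (0 : 'rV[R]_m) (delta_mx 0 i) = delta_mx 0 (rshift m i).
Proof.
apply/rowP => j; rewrite mxE; case: split_ordP => k ->; rewrite !mxE /=.
  by rewrite eq_lrshift.
by rewrite eq_rshift.
Qed.

Lemma ccont_row_mxr m n (F : 'rV[R]_(m + n) -> R[i]) x :
  ccont F -> ccont (fun y => F (row_mx x y)).
Proof.
have E (f : 'rV[R]_(m + n) -> R) : continuous f -> continuous (fun y => f (row_mx x y)).
  move=> cf y; apply: (@cvg_comp _ _ _ (row_mx x) f (nbhs y) (nbhs (row_mx x y)) _ _ (cf _)).
  apply/(@cvgrPdist_lt _ _ _ _ (nbhs_filter y)) => e e0.
  apply/(@nbhs_ballP _ 'rV[R]_n); exists e => //; rewrite mx_norm_ball => z /= yz.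
  rewrite opp_row_mx add_row_mx subrr; apply: le_lt_trans (row_mx_norm_le _ _) _.
  by rewrite normr0 add0r.
by move=> [/E c1 /E c2]; exact: conj c1 c2.
Qed.

End RowBlocks.

(** * Time-frequency shifts of a Gaussian as a tame family *)

Section GaussianFamily.
Context {R : realType} {n : nat}.
Local Notation V := 'rV[R]_n.
Local Notation C := (R[i]).
Variables (kap : 'I_n -> R) (lam : R).
Hypothesis kap_gt0 : forall j, 0 < kap j.
Local Notation N := (n + n + n)%N.

Let X j (u : 'rV[R]_N) : C := (u 0 (lshift n (lshift n j)))%:C.
Let Xi j (u : 'rV[R]_N) : C := (u 0 (lshift n (rshift n j)))%:C.
Let Y j (u : 'rV[R]_N) : C := (u 0 (rshift (n + n) j))%:C.

(** The exponent is a polynomial in position, frequency and variable jointly, so that derivatives in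
    the variable and increments of the parameter come from one and the same gradient. *)
Definition gexp (u : 'rV[R]_N) : C :=
  \sum_j ((- (kap j / 2))%:C * ((Y j u + (-1) * X j u) * (Y j u + (-1) * X j u)) +
          (0 +i* - lam) * (Xi j u * Y j u)).

Lemma cpoly_gexp : cpoly gexp.
Proof.
apply: cpoly_sum => j; apply: cpolyD; apply: cpolyM; try exact: cpoly_cst.
  by apply: cpolyM; apply: cpolyD; try exact: cpoly_coord;
     apply: cpolyM; [exact: cpoly_cst|exact: cpoly_coord|exact: cpoly_cst|exact: cpoly_coord].
by apply: cpolyM; exact: cpoly_coord.
Qed.

(* The time-frequency shift [exp(-sum kap_j (y_j - x_j)^2 / 2 - i lam xi.y)] of
   a Gaussian, with parameter s = (x, xi). *)
Definition gatom (s : 'rV[R]_(n + n)) (y : V) : C := cexp (gexp (row_mx s y)).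

Lemma gexpE x xi y : gexp (row_mx (row_mx x xi) y) =
  (- \sum_j (kap j / 2 * (y 0 j - x 0 j) ^+ 2)) +i* (- (lam * dot xi y)).
Proof.
rewrite /gexp /X /Xi /Y.
under eq_bigr do rewrite !row_mxEl !row_mxEr.
apply: complex_eqP; rewrite ?Re_sum ?Im_sum /= /dot ?mxE ?mulr_sumr -?sumrN; apply: eq_bigr => j _.
  by ring.
by rewrite mxE; ring.
Qed.

Lemma gatomE x xi y : gatom (row_mx x xi) y =
  (expR (- \sum_j (kap j / 2 * (y 0 j - x 0 j) ^+ 2)))%:C * cis (- (lam * dot xi y)).
Proof. by rewrite /gatom gexpE. Qed.

Lemma kap_lb : exists c, 0 < c /\ forall v : V, c * `|v| ^+ 2 <= \sum_j (kap j / 2 * v 0 j ^+ 2).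
Proof.
exists (\big[Num.min/1]_j (kap j / 2)); split=> [|v].
  by apply/bigmin_gtP; split => // j _; rewrite divr_gt0.
have [->|[j ->]] := rV_norm_attained v.
  rewrite expr0n mulr0 sumr_ge0// => j _.
  by rewrite mulr_ge0 ?sqr_ge0// divr_ge0// ltW.
rewrite real_normK ?num_real// [leRHS](bigD1 j)//= ler_wpDr//.
  by apply: sumr_ge0 => i _; rewrite mulr_ge0 ?sqr_ge0// divr_ge0// ltW.
by rewrite ler_wpM2r ?sqr_ge0// bigmin_le_cond.
Qed.

(** The weight of the joint vector (s, y) is at most 2 [jb s] [jb (y - x)]; the Gaussian absorbs the
    powers of the last factor and only polynomial growth in the parameter remains. *)
Lemma polyG_bound (P : 'rV[R]_N -> C) : cpoly P -> exists B k, 0 <= B /\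
  forall s y, nc (P (row_mx s y) * cexp (gexp (row_mx s y))) <= B * jb s ^+ k.
Proof.
move=> /cpoly_bound[B [k [B0 HB]]].
have [c [c0 Hc]] := kap_lb; have [D [D0 HD]] := gauss_poly_bound k c0.
exists (B * 2 ^+ k * D), k; split=> [|s y]; first by rewrite !mulr_ge0// exprn_ge0.
rewrite -[s]hsubmxK; set x := lsubmx s; set xi := rsubmx s.
rewrite Normc.normcM normc_cexp gexpE /=.
have J : jb (row_mx (row_mx x xi) y) <= 2 * (jb s * jb (y - x)).
  rewrite hsubmxK; apply: (@le_trans _ _ (1 + (`|s| + `|y|))).
    by rewrite lerD2l row_mx_norm_le.
  have : `|y| <= `|y - x| + `|s|.
    rewrite -{1}[y](subrK x) (le_trans (ler_normD _ _))// lerD2l.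
    exact: normr_lsubmx_le.
  rewrite /jb; have := normr_ge0 s; have := normr_ge0 (y - x).
  by move: (`|y|) (`|s|) (`|y - x|) => *; nra.
have E : expR (- \sum_j kap j / 2 * (y 0 j - x 0 j) ^+ 2) <= expR (- (c * `|y - x| ^+ 2)).
  rewrite ler_expR lerN2; apply: le_trans (Hc (y - x)) _.
  by apply: ler_sum => j _; rewrite !mxE.
apply: (@le_trans _ _ (B * (2 * (jb s * jb (y - x))) ^+ k * expR (- (c * `|y - x| ^+ 2)))).
  apply: ler_pM => //; rewrite ?normc_ge0 ?expR_ge0//.
  apply: le_trans (HB _) _; rewrite ler_wpM2l//.
  by apply: lerXn2r; rewrite ?nnegrE ?(ltW (jb_gt0 _))// mulr_ge0// mulr_ge0 ?(ltW (jb_gt0 _)).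
rewrite hsubmxK !exprMn -!mulrA ler_wpM2l// ler_wpM2l ?exprn_ge0//.
by rewrite [leRHS]mulrC ler_wpM2l ?(ltW (jbX_gt0 _ _))// HD.
Qed.

Lemma polyG_grad (P : 'rV[R]_N -> C) : cpoly P -> exists D : 'I_N -> 'rV[R]_N -> C,
  (forall j, cpoly (D j)) /\
  forall u v, cder (fun u => P u * cexp (gexp u)) u v
    (\sum_j (v 0 j)%:C * (D j u * cexp (gexp u))).
Proof.
move=> cP; have [D [cD dP]] := cpoly_grad cP.
have [E [cE dE]] := cpoly_grad cpoly_gexp.
exists (fun j u => D j u + P u * E j u); split=> [j|u v].
  by apply: cpolyD => //; exact: cpolyM.
apply: cder_eq (cderM (dP u v) (cder_cexp (dE u v))) _.
rewrite !mulr_suml mulr_sumr -big_split /=.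
by apply: eq_bigr => j _; ring.
Qed.

(** Differentiation keeps the form polynomial times exponential. Since the polynomial lives on the
    joint space, it serves all parameters at once, and this yields the uniform bounds of [tame]. *)
Lemma gatom_pderives r : exists P, cpoly P /\
  forall s, pderives r (gatom s) = fun y => P (row_mx s y) * cexp (gexp (row_mx s y)).
Proof.
elim: r => [|i r [P [cP EP]]].
  by exists (fun=> 1); split=> [|s]; [exact: cpoly_cst|apply/funext => y; rewrite mul1r].
have [D [cD dP]] := polyG_grad cP.
exists (D (rshift _ i)); split=> // s /=; rewrite -/(pderives r _) EP.
apply/funext => y; apply: cder_pderive.
apply: (@cder_row_mxr _ _ _ (fun u => P u * cexp (gexp u))); rewrite row_mx0_delta.
apply: cder_eq (dP _ _) _; rewrite (bigD1 (rshift _ i))//= mxE !eqxx mul1r big1 ?addr0// => j ji.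
by rewrite mxE (negPf ji) andbF mul0r.
Qed.

Lemma gatom_smooth s : smooth (gatom s).
Proof.
move=> r; have [P [cP EP]] := gatom_pderives r.
have [c1 c2] : ccont (pderives r (gatom s)).
  rewrite EP; apply: (@ccont_row_mxr _ _ _ (fun u => P u * cexp (gexp u))).
  apply: ccontM; first exact: cpoly_ccont.
  by apply: ccont_cexp; exact: cpoly_ccont cpoly_gexp.
split => // i x; rewrite EP; have [D [_ dP]] := polyG_grad cP.
apply: cder_pderivable.
exact: (@cder_row_mxr _ _ _ (fun u => P u * cexp (gexp u)) _ _ _ _ (dP _ _)).
Qed.

(** Growth is [polyG_bound] applied to monomial times derivative. The Lipschitz part is the mean
    value theorem on the joint space in the direction (d, 0), whose partial derivatives are bounded
    in the same way. *)
Lemma gatom_tame : tame gatom.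
Proof.
have cM a : cpoly (fun u : 'rV[R]_N => \prod_(j <- a) (u 0 (rshift (n + n) j))%:C).
  by apply: cpoly_prod => j; exact: cpoly_coord.
have EM a s (y : V) :
    (monomial a y)%:C = \prod_(j <- a) (row_mx s y 0 (rshift (n + n) j))%:C.
  by rewrite /monomial rmorph_prod; apply: eq_bigr => j _; rewrite row_mxEr.
split=> [|a r|a r]; first exact: gatom_smooth.
- have [P [cP EP]] := gatom_pderives r.
  have [B [k [B0 HB]]] := polyG_bound (cpolyM (cM a) cP).
  exists B, k; split=> // s y; rewrite EP -normc_real -Normc.normcM (EM a s) mulrA.
  exact: HB.
- have [P [cP EP]] := gatom_pderives r.
  have [D [cD dP]] := polyG_grad (cpolyM (cM a) cP).
  have [B HB] := choice (fun j => polyG_bound (cD j)).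
  have [k Hk] := choice HB.
  pose K := \max_j k j; pose S := \sum_j B j.
  have S0 : 0 <= S by apply: sumr_ge0 => j _; have [] := Hk j.
  (* [2 ^+ K] comes from jb(s + h d) <= 2 jb(s) for |h d| <= 1, and the outer doubling from
     [cder_mvt]. *)
  exists ((S * 2 ^+ K) *+ 2), K; split=> [|s d y d1].
    by rewrite mulrn_wge0// mulr_ge0// exprn_ge0.
  rewrite EP EP -normc_real -Normc.normcM mulrBr {1}(EM a (s + d)) (EM a s) (mulrA _ (P (row_mx s y))) (mulrA _ (P (row_mx (s + d) y))).
  pose F (u : 'rV[R]_N) := (\prod_(j <- a) (u 0 (rshift (n + n) j))%:C) * P u * cexp (gexp u).
  have -> : row_mx (s + d) y = row_mx s y + row_mx d 0 by rewrite add_row_mx addr0.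
  rewrite -/(F (row_mx s y + _)) -/(F (row_mx s y)).
  apply: le_trans (@cder_mvt _ _ F (row_mx s y) (row_mx d 0)
    (fun h => \sum_j (row_mx d 0 0 j)%:C * (D j (row_mx s y + h *: row_mx d 0) *
       cexp (gexp (row_mx s y + h *: row_mx d 0)))) (S * 2 ^+ K * jb s ^+ K * `|d|) _ _) _.
  + by move=> h; exact: dP.
  + move=> h /andP[h0 h1]; rewrite row_mx_line scaler0 addr0.
    apply: le_trans (normc_sum _ _ _) _.
    rewrite [S * _ * _]mulrAC mulrC !mulr_suml mulr_sumr; apply: ler_sum => j _.
    rewrite Normc.normcM normc_real; apply: ler_pM; rewrite ?normc_ge0//.
      apply: le_trans (normr_coord_le _ _) _; apply: le_trans (row_mx_norm_le _ _) _.
      by rewrite normr0 addr0.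
    have [Bj0 Hj] := Hk j; apply: le_trans (Hj _ _) _; rewrite -mulrA ler_wpM2l//.
    apply: (@le_trans _ _ (jb (s + h *: d) ^+ K)).
      by apply: jbX_homo; rewrite /K (leq_bigmax j).
    rewrite -exprMn; apply: lerXn2r; rewrite ?nnegrE ?mulr_ge0 ?(ltW (jb_gt0 _))//.
    apply: le_trans (jbD _ _) _; rewrite ler_wpM2l ?(ltW (jb_gt0 _))// /jb.
    have : `|h *: d| <= 1.
      by rewrite mx_normZ ger0_norm// -[leRHS]mulr1; apply: ler_pM.
    by move: (`|h *: d|) => z; lra.
  + by rewrite !mulrnAl.
Qed.

Lemma gatom_schwartz s : schwartz (gatom s).
Proof. exact: tame_schwartz gatom_tame. Qed.

End GaussianFamily.

(** * Integral superpositions of Schwartz functions *)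
Section UnderTheIntegral.
Context {R : realType} {n : nat} d {T : measurableType d} (nu : {measure set T -> \bar R}).
Local Notation V := 'rV[R]_n.
Local Notation C := (R[i]).

Lemma is_derive_Rint (f f' : R -> T -> R) (q : T -> R) :
  (forall h, rintegrable nu (f h)) -> rintegrable nu q ->
  (forall (h : R) t, -1 < h < 1 -> is_derive h (1 : R) (f^~ t) (f' h t)) ->
  (forall (h : R) t, -1 < h < 1 -> `|f' h t| <= q t) ->
  is_derive (0 : R) (1 : R) (fun h => \int[nu]_t f h t) (\int[nu]_t f' 0 t).
Proof.
move=> fi qi df f'q.
have I0 : `]-1, 1[%classic (0 : R) by rewrite /= in_itv /= ltrN10 ltr01.
have df1 h t : `]-1, 1[%classic h -> setT t -> derivable (f^~ t) h 1.
  by rewrite /= in_itv /= => hI _; have [] := df h t hI.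
have E h t : -1 < h < 1 -> partial1of2 f h t = f' h t.
  by move=> hI; rewrite partial1of2E; have [] := df h t hI.
have q0 t : 0 <= q t by apply: le_trans (normr_ge0 _) (f'q 0 t _); rewrite ltrN10 ltr01.
have ub h t : `]-1, 1[%classic h -> setT t -> `|partial1of2 f h t| <= q t.
  by rewrite /= in_itv /= => hI _; rewrite E// f'q.
have d1 := derivable_under_integral measurableT I0 (fun h _ => fi h) df1 q0 qi ub.
have d2 := differentiation_under_integral measurableT I0 (fun h _ => fi h) df1 q0 qi ub.
apply: DeriveDef => //; rewrite -derive1E d2; apply: eq_Rintegral => t _.
by rewrite E// ltrN10 ltr01.
Qed.

Lemma cder_cint (F F' : T -> V -> C) (q : T -> R) y v :
  (forall z, cintegrable nu (F^~ z)) -> rintegrable nu q ->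
  (forall (h : R) t, -1 < h < 1 -> cder (F t) (y + h *: v) v (F' t (y + h *: v))) ->
  (forall (h : R) t, -1 < h < 1 -> nc (F' t (y + h *: v)) <= q t) ->
  cder (fun z => cint nu (F^~ z)) y v (cint nu (F'^~ y)).
Proof.
move=> Fi qi dF F'q; split; rewrite -{1}[y](addr0 y) -(scale0r v); apply/is_derive_lineP.
  have := @is_derive_Rint (fun h t => cRe (F t (y + h *: v)))
    (fun h t => cRe (F' t (y + h *: v))) q.
  rewrite scale0r addr0; apply => //.
  - by move=> h; have [] := Fi (y + h *: v).
  - move=> h t hI; apply: (is_derive_lineP (fun z => cRe (F t z)) _ _ _ _).1.
    by have [] := dF h t hI.
  - by move=> h t hI; apply: le_trans (normr_Re_le _) (F'q h t hI).
have := @is_derive_Rint (fun h t => cIm (F t (y + h *: v)))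
  (fun h t => cIm (F' t (y + h *: v))) q.
rewrite scale0r addr0; apply => //.
- by move=> h; have [] := Fi (y + h *: v).
- move=> h t hI; apply: (is_derive_lineP (fun z => cIm (F t z)) _ _ _ _).1.
  by have [] := dF h t hI.
- by move=> h t hI; apply: le_trans (normr_Im_le _) (F'q h t hI).
Qed.

End UnderTheIntegral.

Section PartialDerivatives.
Context {R : realType} {n : nat}.
Local Notation V := 'rV[R]_n.
Local Notation C := (R[i]).

Lemma is_derive_scale (f : V -> R) u v (c l : R) :
  is_derive u v f l -> is_derive u (c *: v) f (c * l).
Proof.
rewrite -[u](addr0 u) -(scale0r v) => /is_derive_lineP H.
have -> : u + 0 *: v = u + 0 *: (c *: v) by rewrite !scale0r.
apply/is_derive_lineP.
have g : is_derive (0 : R) (1 : R) (fun t : R => c * t) c.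
  rewrite (_ : (fun t => _) = c \*: (id : R -> R)); last by apply/funext.
  by apply: is_derive_eq; rewrite /GRing.scale /= mulr1.
have := @is_derive1_comp R (fun t => f (u + t *: v)) (fun t => c * t) 0 l c.
rewrite mulr0 mulrC => /(_ H g); congr (is_derive _ _ _ _).
by apply/funext => t /=; rewrite scalerA mulrC.
Qed.

Lemma cder_scale (F : V -> C) u v (c : R) l : cder F u v l -> cder F u (c *: v) (c%:C * l).
Proof.
move=> [d1 d2]; split.
  by rewrite ReM /= mul0r subr0; exact: is_derive_scale.
by rewrite ImM /= mul0r addr0; exact: is_derive_scale.
Qed.

(** The segment from y to y + v is replaced by a path along the coordinate axes; the mean value
    theorem on each of its n pieces gives a Lipschitz bound. *)
Lemma bounded_partials_ccont (F : V -> C) (D : 'I_n -> V -> C) (B : R) :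
  (forall i x, cder F x (delta_mx 0 i) (D i x)) ->
  (forall i x, nc (D i x) <= B) -> ccont F.
Proof.
move=> dF DB.
have step (r : seq 'I_n) (y v : V) :
    nc (F (y + \sum_(i <- r) v 0 i *: delta_mx 0 i) - F y) <=
    \sum_(i <- r) (`|v| * B) *+ 2.
  elim: r y => [|i r IH] y.
    by rewrite !big_nil addr0 subrr Normc.normc0.
  rewrite !big_cons addrA.
  rewrite (_ : F _ - F y = (F (y + v 0 i *: delta_mx 0 i) - F y) +
    (F (y + v 0 i *: delta_mx 0 i + \sum_(j <- r) v 0 j *: delta_mx 0 j) -
     F (y + v 0 i *: delta_mx 0 i))); last by ring.
  apply: le_trans (le_normcD _ _) _; apply: lerD; last exact: IH.
  apply: (@cder_mvt _ _ F y (v 0 i *: delta_mx 0 i)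
    (fun h => (v 0 i)%:C * D i (y + h *: (v 0 i *: delta_mx 0 i)))) => [h|h _].
    by apply: cder_scale; exact: dF.
  rewrite Normc.normcM normc_real; apply: ler_pM; rewrite ?normc_ge0//.
  exact: normr_coord_le.
apply: (clipschitz_ccont (B := fun _ => B *+ 2 *+ n)) => u v _.
rewrite {1}(row_sum_delta v); apply: le_trans (step _ _ _) _.
rewrite sumr_const cardE /= size_enum_ord /=.
by rewrite mulrnAl mulrnAl mulrC.
Qed.

End PartialDerivatives.

(** * Tempered distributions commute with superpositions *)

Section Exchange.
Context {R : realType} {n m : nat} d {T : measurableType d}.
Variable nu : {measure set T -> \bar R}.
Local Notation V := 'rV[R]_n.
Local Notation C := (R[i]).
Variables (rho : T -> 'rV[R]_m) (A : T -> C) (G : 'rV[R]_m -> V -> C).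
Hypothesis mrho : forall i, measurable_fun setT (fun t => rho t 0 i).
Hypothesis mA : cmfun A.
Hypothesis iA : forall k, rintegrable nu (fun t => nc (A t) * jb (rho t) ^+ k).
Hypothesis tG : tame G.

Lemma tame_ccont r y : ccont (fun s => pderives r (G s) y).
Proof.
have [_ _ /(_ [::] r)[B [k [B0 HB]]]] := tG.
apply: (clipschitz_ccont (B := fun s => B * jb s ^+ k)) => s d0 d1.
by have := HB s d0 y d1; rewrite /monomial big_nil normr1 mul1r.
Qed.

Lemma cmfun_param (H : 'rV[R]_m -> C) : ccont H -> cmfun (fun t => H (rho t)).
Proof. by move=> [c1 c2]; exact: cmfun_continuous_rV. Qed.

Lemma cintegrable_weight (H : T -> C) (B : R) k : cmfun H ->
  (forall t, nc (H t) <= B * jb (rho t) ^+ k) -> cintegrable nu (fun t => A t * H t).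
Proof.
move=> mH HB; apply: (@cintegrable_le _ _ _ _ _ (fun t => B * (nc (A t) * jb (rho t) ^+ k))).
- exact: cmfunM.
- exact: rintegrableZ.
- by move=> t; rewrite Normc.normcM mulrCA ler_wpM2l ?normc_ge0.
Qed.

Lemma tame_bound r : exists B k, 0 <= B /\
  forall s y, nc (pderives r (G s) y) <= B * jb s ^+ k.
Proof.
have [_ /(_ [::] r)[B [k [B0 HB]]] _] := tG.
exists B, k; split=> // s y.
by have := HB s y; rewrite /monomial big_nil normr1 mul1r.
Qed.

Lemma tame_cintegrable r y : cintegrable nu (fun t => A t * pderives r (G (rho t)) y).
Proof.
have [B [k [B0 HB]]] := tame_bound r.
apply: (cintegrable_weight (B := B) (k := k)) => //.
exact: (cmfun_param (tame_ccont r y)).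
Qed.

Definition superpos (y : V) : C := cint nu (fun t => A t * G (rho t) y).

Lemma superpos_pderives r :
  pderives r superpos = fun y => cint nu (fun t => A t * pderives r (G (rho t)) y).
Proof.
elim: r => [//|i r IH] /=; rewrite -/(pderives r _) IH; apply/funext => y.
have [B [k [B0 HB]]] := tame_bound (i :: r).
apply: cder_pderive; apply: (@cder_cint _ _ _ _ nu
  (fun t y => A t * pderives r (G (rho t)) y)
  (fun t y => A t * pderives (i :: r) (G (rho t)) y)
  (fun t => B * (nc (A t) * jb (rho t) ^+ k))).
- by move=> z; exact: tame_cintegrable.
- exact: rintegrableZ.
- by move=> h t _; apply: cderZ; apply: smooth_cder; have [] := tG.
- by move=> h t _; rewrite Normc.normcM mulrCA ler_wpM2l ?normc_ge0.
Qed.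

(** Every derivative passes under the integral, so each seminorm is bounded by an integral of [iA].
    Continuity of a derivative then follows from boundedness of the partial derivatives one order
    higher. *)
Lemma superpos_schwartz : schwartz superpos.
Proof.
have D r i y : cder (pderives r superpos) y (delta_mx 0 i) (pderives (i :: r) superpos y).
  rewrite !superpos_pderives; have [B [k [B0 HB]]] := tame_bound (i :: r).
  apply: (@cder_cint _ _ _ _ nu
    (fun t y => A t * pderives r (G (rho t)) y)
    (fun t y => A t * pderives (i :: r) (G (rho t)) y)
    (fun t => B * (nc (A t) * jb (rho t) ^+ k))).
  - by move=> z; exact: tame_cintegrable.
  - exact: rintegrableZ.
  - by move=> h t _; apply: cderZ; apply: smooth_cder; have [] := tG.
  - by move=> h t _; rewrite Normc.normcM mulrCA ler_wpM2l ?normc_ge0.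
have bd a r : exists B, forall y, `|monomial a y| * nc (pderives r superpos y) <= B.
  have [_ /(_ a r)[B [k [B0 HB]]] _] := tG.
  exists (\int[nu]_t (B * (nc (A t) * jb (rho t) ^+ k))) => y.
  rewrite superpos_pderives -normc_real -Normc.normcM -cintZ; last exact: tame_cintegrable.
  apply: normc_cint_le; [exact/cintegrableZ/tame_cintegrable|exact: rintegrableZ|] => t.
  rewrite !Normc.normcM normc_real mulrCA [leRHS]mulrCA ler_wpM2l ?normc_ge0//.
split=> [r|a r]; last first.
  by have [B HB] := bd a r; apply: le_lt_trans (seminorm_le HB) _; rewrite ltry.
have [c1 c2] : ccont (pderives r superpos).
  have [B HB] := choice (fun i => bd [::] (i :: r)).
  apply: (@bounded_partials_ccont _ _ _ (fun i => pderives (i :: r) superpos) (\sum_i `|B i|)).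
    exact: D.
  move=> i x; have := HB i x; rewrite /monomial big_nil normr1 mul1r => H.
  apply: le_trans H _; rewrite (bigD1 i)//=; apply: le_trans (ler_norm _) _.
  by rewrite lerDl sumr_ge0.
by split => // i x; exact: cder_pderivable (D r i x).
Qed.

(** Words of length at most N form a finite type, so constants can be summed and exponents maximised
    over all seminorms that a distribution of order N sees. *)
Lemma tame_uniform N : exists B k, 0 <= B /\ forall a r, (size a <= N)%N -> (size r <= N)%N ->
  (forall s y, `|monomial a y| * nc (pderives r (G s) y) <= B * jb s ^+ k) /\
  (forall s e y, `|e| <= 1 ->
    `|monomial a y| * nc (pderives r (G (s + e)) y - pderives r (G s) y) <=
    B * jb s ^+ k * `|e|).
Proof.
have [_ T1 T2] := tG.
have H (ar : (N.-bseq 'I_n) * (N.-bseq 'I_n)) : exists Bk : R * nat, 0 <= Bk.1 /\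
  (forall s y, `|monomial ar.1 y| * nc (pderives ar.2 (G s) y) <= Bk.1 * jb s ^+ Bk.2) /\
  (forall s e y, `|e| <= 1 ->
    `|monomial ar.1 y| * nc (pderives ar.2 (G (s + e)) y - pderives ar.2 (G s) y) <=
    Bk.1 * jb s ^+ Bk.2 * `|e|).
  have [B1 [k1 [B10 H1]]] := T1 ar.1 ar.2; have [B2 [k2 [B20 H2]]] := T2 ar.1 ar.2.
  have le1 (s : 'rV[R]_m) : B1 * jb s ^+ k1 <= (B1 + B2) * jb s ^+ maxn k1 k2.
    by apply: ler_pM; rewrite ?lerDl ?(ltW (jbX_gt0 _ _)) ?jbX_homo ?leq_maxl.
  have le2 (s : 'rV[R]_m) : B2 * jb s ^+ k2 <= (B1 + B2) * jb s ^+ maxn k1 k2.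
    by apply: ler_pM; rewrite ?lerDr ?(ltW (jbX_gt0 _ _)) ?jbX_homo ?leq_maxr.
  exists (B1 + B2, maxn k1 k2) => /=; split; first exact: addr_ge0.
  split=> [s y|s e y e1]; first exact: le_trans (H1 s y) (le1 s).
  by apply: le_trans (H2 s e y e1) _; rewrite ler_wpM2r.
have [Bk HBk] := choice H.
have B0 ar : 0 <= (Bk ar).1 by have [] := HBk ar.
exists (\sum_ar (Bk ar).1), (\max_ar (Bk ar).2); split; first exact: sumr_ge0.
move=> a r aN rN; pose ar := (Bseq aN, Bseq rN).
have le (s : 'rV[R]_m) : (Bk ar).1 * jb s ^+ (Bk ar).2 <=
    (\sum_ar (Bk ar).1) * jb s ^+ (\max_ar (Bk ar).2).
  apply: ler_pM; rewrite ?(ltW (jbX_gt0 _ _))//.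
    by rewrite (bigD1 ar)//= lerDl sumr_ge0.
  by apply: jbX_homo; exact: (leq_bigmax ar).
have [_ [H1 H2]] := HBk ar.
split=> [s y|s e y e1]; first exact: le_trans (H1 s y) (le s).
by apply: le_trans (H2 s e y e1) _; rewrite ler_wpM2r.
Qed.

Section Sampling.
Variable k : nat.
Local Notation M := (2 * (k.+1 * k.+1))%N.
Local Notation K := ((k.+1 * k.+1)%N%:Z).

(** Mesh 1 / (k+1) on a box of half-width k+1: the floors run from -(k+1)^2 to (k+1)^2 - 1, that is
    over [M] values, and the shift by [K] makes the indices start at 0. *)
Definition cell (v : {ffun 'I_m -> 'I_M}) (t : T) : bool :=
  [forall j, Num.floor (k.+1%:R * rho t 0 j) == (v j)%:Z - K].

Definition cell_point (v : {ffun 'I_m -> 'I_M}) : 'rV[R]_m :=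
  \row_j (((v j)%:Z - K)%:~R / k.+1%:R).

Definition in_box (t : T) : bool :=
  [forall j, - K <= Num.floor (k.+1%:R * rho t 0 j) < K].

Definition sample (H : 'rV[R]_m -> C) (t : T) : C :=
  \sum_v (cell v t)%:R * H (cell_point v).

Lemma sampleE H t : sample H t = if in_box t then H (grid k (rho t)) else 0.
Proof.
rewrite /sample; case: ifPn => [/forallP tb|ntb].
  have vlt j : (absz (Num.floor (k.+1%:R * rho t 0 j) + K)%R < M)%N.
    by have /andP[] := tb j; lia.
  pose v0 : {ffun 'I_m -> 'I_M} := [ffun j => Ordinal (vlt j)].
  have v0E j : (v0 j)%:Z - K = Num.floor (k.+1%:R * rho t 0 j).
    by rewrite ffunE /=; have /andP[] := tb j; lia.
  rewrite (bigD1 v0)//= big1 ?addr0.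
    have -> : cell v0 t by apply/forallP => j; rewrite v0E.
    rewrite mul1r; congr H; apply/rowP => j.
    by rewrite !mxE v0E.
  move=> v vv0; rewrite (_ : cell v t = false) ?mul0r//.
  apply/negbTE; apply: contra vv0 => /forallP cv; apply/eqP/ffunP => j.
  apply: val_inj => /=; have /eqP := cv j; rewrite -v0E; lia.
rewrite big1// => v _; rewrite (_ : cell v t = false) ?mul0r//.
apply/negbTE; apply: contra ntb => /forallP cv; apply/forallP => j.
have /eqP -> := cv j; apply/andP; split; first by rewrite lerDr.
by rewrite ltrBlDr -PoszD ltz_nat addnn -mul2n ltn_ord.
Qed.

Lemma out_box t : ~~ in_box t -> k.+1%:R <= `|rho t|.
Proof.
rewrite negb_forall => /existsP[j]; rewrite negb_and => H.
apply: le_trans (normr_coord_le _ j).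
have k0 : 0 < k.+1%:R :> R by [].
rewrite -(ler_pM2l k0) -{3}(ger0_norm (ltW k0)) -normrM -natrM.
case/orP: H; rewrite -?ltNge -?leNgt => H.
  have : Num.floor (k.+1%:R * rho t 0 j) + 1 <= - K by lia.
  rewrite -(ler_int R) mulrNz => H1; have := floorD1_gt (k.+1%:R * rho t 0 j).
  by move=> H2; rewrite ler0_norm; have : (0 : R) <= (k.+1 * k.+1)%:R by []; lra.
move: H; rewrite -(ler_int R) => H; have := floor_le (k.+1%:R * rho t 0 j).
by move=> H2; apply: le_trans (ler_norm _); exact: le_trans H2.
Qed.

Lemma measurable_cell v : measurable_fun setT (fun t => ((cell v t)%:R : R)).
Proof.
rewrite (_ : (fun t => _) = \1_[set t | cell v t]); last first.
  by apply/funext => t; rewrite indicE; congr ((nat_of_bool _)%:R);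
    apply/idP/idP => [?|/set_mem//]; exact/mem_set.
apply: measurable_indic.
rewrite (_ : [set t | cell v t] = \bigcap_(j in [set: 'I_m])
   ((fun t => k.+1%:R * rho t 0 j) @^-1`
     [set` `[((v j)%:Z - K)%:~R, ((v j)%:Z - K + 1)%:~R[ ])); last first.
  apply/seteqP; split=> [t /forallP H j _ /=|t H].
    by have /eqP <- := H j; rewrite in_itv /= floor_le floorD1_gt.
  by apply/forallP => j; have := H j I; rewrite /= in_itv /= => /floor_def ->.
apply: fin_bigcap_measurable => // j _; rewrite -[X in measurable X]setTI.
by apply: measurable_funM => //; exact: mrho.
Qed.

Lemma cmfun_cell v : cmfun (fun t => ((cell v t)%:R : C)).
Proof.
rewrite (_ : (fun t => _) = fun t => ((cell v t)%:R : R)%:C); last first.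
  by apply/funext => t; case: (cell v t).
by apply: cmfun_real; exact: measurable_cell.
Qed.

Lemma cintegrable_cell v : cintegrable nu (fun t => A t * (cell v t)%:R).
Proof.
apply: (cintegrable_weight (B := 1) (k := 0)); first exact: cmfun_cell.
by move=> t; rewrite expr0 mulr1; case: (cell v t); rewrite ?Normc.normc1// Normc.normc0.
Qed.

Lemma cint_sample H : cintegrable nu (fun t => A t * sample H t) /\
  cint nu (fun t => A t * sample H t) =
  \sum_v cint nu (fun t => A t * (cell v t)%:R) * H (cell_point v).
Proof.
have E : (fun t => A t * sample H t) =
    fun t => \sum_v H (cell_point v) * (A t * (cell v t)%:R).
  by apply/funext => t; rewrite mulr_sumr; apply: eq_bigr => v _; ring.
have I v : cintegrable nu (fun t => H (cell_point v) * (A t * (cell v t)%:R)).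
  by apply: cintegrableZ; exact: cintegrable_cell.
rewrite E; split; first exact: cintegrable_sum.
rewrite cint_sum//; apply: eq_bigr => v _.
by rewrite (cintZ (H (cell_point v)) (cintegrable_cell v)) mulrC.
Qed.

(* A Lipschitz function of polynomial growth differs from its samples by
   [O(1/k)], inside the box by the Lipschitz bound and outside by growth. *)
Lemma sample_error (H : 'rV[R]_m -> C) B l : 0 <= B ->
  (forall s, nc (H s) <= B * jb s ^+ l) ->
  (forall s e, `|e| <= 1 -> nc (H (s + e) - H s) <= B * jb s ^+ l * `|e|) ->
  forall t, nc (H (rho t) - sample H t) <= B * jb (rho t) ^+ l.+1 / k.+1%:R.
Proof.
move=> B0 H1 H2 t; rewrite sampleE; case: ifPn => [_|/out_box ob].
  have g1 := grid_dist k (rho t).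
  have := H2 (rho t) (grid k (rho t) - rho t); rewrite [_ + (_ - _)]addrC subrK.
  rewrite -normcN opprB => /(_ _)/le_trans; apply.
    by apply: le_trans g1 _; rewrite invf_le1// ler1n.
  apply: ler_pM => //; first by rewrite mulr_ge0// (ltW (jbX_gt0 _ _)).
  by rewrite ler_wpM2l// jbX_homo.
rewrite subr0; apply: le_trans (H1 _) _; rewrite exprSr mulrA -mulrA ler_peMr//.
  by rewrite mulr_ge0// (ltW (jbX_gt0 _ _)).
by rewrite ler_pdivlMr// mul1r (le_trans ob)// lerDr.
Qed.

Lemma cint_sample_error (H : 'rV[R]_m -> C) B l : 0 <= B -> ccont H ->
  (forall s, nc (H s) <= B * jb s ^+ l) ->
  (forall s e, `|e| <= 1 -> nc (H (s + e) - H s) <= B * jb s ^+ l * `|e|) ->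
  nc (cint nu (fun t => A t * H (rho t)) - cint nu (fun t => A t * sample H t)) <=
  B * (\int[nu]_t (nc (A t) * jb (rho t) ^+ l.+1)) / k.+1%:R.
Proof.
move=> B0 cH H1 H2; have iH : cintegrable nu (fun t => A t * H (rho t)).
  by apply: (cintegrable_weight (B := B) (k := l)) => //; exact: cmfun_param.
have [iS _] := cint_sample H.
rewrite -cintB// -mulrAC -[leRHS](RintegralZl (B / k.+1%:R) measurableT (iA l.+1)).
apply: normc_cint_le.
- have := cintegrableD iH (cintegrableZ (-1) iS).
  by congr (cintegrable _ _); apply/funext => t; rewrite mulN1r.
- exact: rintegrableZ.
- move=> t; rewrite -mulrBr Normc.normcM.
  apply: le_trans (ler_wpM2l (normc_ge0 _) (sample_error B0 H1 H2 t)) _.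
  by rewrite le_eqVlt; apply/orP; left; apply/eqP; ring.
Qed.

End Sampling.
Arguments cell : clear implicits.
Arguments cell_point : clear implicits.

(** The order of [u] transfers the bounds of the family to the scalar function u(G s). The same
    sampling estimate then applies twice: to this function, and inside every seminorm to the
    superposition itself. *)
Theorem tempered_superpos (u : @functional R n) : tempered u ->
  ccont (fun s => u (G s)) /\
  (exists B k, 0 <= B /\ forall s, nc (u (G s)) <= B * jb s ^+ k) /\
  u superpos = cint nu (fun t => A t * u (G (rho t))).
Proof.
move=> tu; have [N [L [L0 HL]]] := tempered_order tu.
have [B [l [B0 HB]]] := tame_uniform N.
have sG s : schwartz (G s) := tame_schwartz s tG.
have sGB s s' : schwartz (fun y => G s y - G s' y) /\ forall r y,
    pderives r (fun y => G s y - G s' y) y = pderives r (G s) y - pderives r (G s') y.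
  have E : (fun y => G s y - G s' y) = fun y => (-1) * G s' y + G s y.
    by apply/funext => y; rewrite mulN1r addrC.
  rewrite E; split; first exact: schwartz_comb.
  by move=> r y; rewrite (smooth_comb (-1) (sG s').1 (sG s).1).2 mulN1r addrC.
have U1 s : nc (u (G s)) <= L * B * jb s ^+ l.
  rewrite -mulrA; apply: HL => //; first by rewrite mulr_ge0// (ltW (jbX_gt0 _ _)).
  by move=> a r y aN rN; have [H _] := HB a r aN rN.
have U2 s e : `|e| <= 1 -> nc (u (G (s + e)) - u (G s)) <= L * B * jb s ^+ l * `|e|.
  move=> e1; rewrite -temperedB// -!mulrA; apply: HL; first by have [] := sGB (s + e) s.
    by rewrite !mulr_ge0// (ltW (jbX_gt0 _ _)).
  move=> a r y aN rN; have [_ ->] := sGB (s + e) s.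
  by have [_ H] := HB a r aN rN; rewrite mulrA; exact: H.
have U0 : 0 <= L * B by exact: mulr_ge0.
have cU : ccont (fun s => u (G s)).
  by apply: (clipschitz_ccont (B := fun s => L * B * jb s ^+ l)) => s e; exact: U2.
split=> //; split; first by exists (L * B), l.
apply/eqP; rewrite -subr_eq0 -normc_eq0 eq_le normc_ge0 andbT.
pose J := \int[nu]_t (nc (A t) * jb (rho t) ^+ l.+1).
(* Both sides lie within O(1/k) of one finite combination of atoms; the doubling counts the two
   errors. *)
suff main k : nc (u superpos - cint nu (fun t => A t * u (G (rho t)))) <=
    (L * B * J *+ 2) / k.+1%:R.
  apply/ler_addgt0Pr => e e0; rewrite add0r.
  have [k Hk] : exists k : nat, (L * B * J *+ 2) / e <= k.+1%:R.
    by exists (Num.truncn ((L * B * J *+ 2) / e)); rewrite ltW// truncnS_gt.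
  apply: le_trans (main k) _; by rewrite ler_pdivrMr// [leRHS]mulrC -ler_pdivrMr//.
(* The weights integrate the exact amplitude over a cell, so that only the atoms are sampled and no
   regularity of [A] enters the error. *)
pose c v := cint nu (fun t => A t * (cell k v t)%:R).
have [sS dS] := schwartz_sum (index_enum _) c (fun v => sG (cell_point k v)).
have uS : u (fun y => \sum_v c v * G (cell_point k v) y) =
    cint nu (fun t => A t * sample k (fun s => u (G s)) t).
  by rewrite tempered_sum// (cint_sample k (fun s => u (G s))).2.
have sP := superpos_schwartz.
rewrite -[u superpos](subrK (u (fun y => \sum_v c v * G (cell_point k v) y))) -addrA.
rewrite mulr2n mulrDl; apply: le_trans (le_normcD _ _) _; apply: lerD; last first.
  rewrite uS -normcN opprB.
  exact: (cint_sample_error k (H := fun s => u (G s))).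
rewrite -temperedB// -!mulrA; apply: HL.
- have := schwartz_comb (-1) sS sP.
  by congr schwartz; apply/funext => y; rewrite mulN1r addrC.
- rewrite mulr_ge0// divr_ge0//; apply: Rintegral_ge0 => t _.
  by rewrite mulr_ge0 ?normc_ge0 ?(ltW (jbX_gt0 _ _)).
move=> a r y aN rN; have [H1 H2] := HB a r aN rN.
have E : (fun y => superpos y - \sum_v c v * G (cell_point k v) y) =
    fun y => (-1) * (\sum_v c v * G (cell_point k v) y) + superpos y.
  by apply/funext => z; rewrite mulN1r addrC.
rewrite E (smooth_comb (-1) sS.1 sP.1).2 mulN1r addrC dS superpos_pderives.
rewrite -(cint_sample k (fun s => pderives r (G s) y)).2.
rewrite -normc_real -Normc.normcM mulrBr.
pose H s := (monomial a y)%:C * pderives r (G s) y.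
have EH t : sample k H t = (monomial a y)%:C * sample k (fun s => pderives r (G s) y) t.
  by rewrite /sample mulr_sumr; apply: eq_bigr => v _; rewrite mulrCA.
have -> : (monomial a y)%:C * cint nu (fun t => A t * pderives r (G (rho t)) y) =
    cint nu (fun t => A t * H (rho t)).
  rewrite -cintZ; last exact: tame_cintegrable.
  by congr cint; apply/funext => t; rewrite /H mulrCA.
have -> : (monomial a y)%:C * cint nu (fun t => A t * sample k (fun s => pderives r (G s) y) t) =
    cint nu (fun t => A t * sample k H t).
  rewrite -cintZ; last exact: (cint_sample k _).1.
  by congr cint; apply/funext => t; rewrite EH mulrCA.
rewrite mulrA; apply: (cint_sample_error k (H := H)) => //.
- by apply: ccontM; [exact: ccont_cst|exact: tame_ccont].
- by move=> s; rewrite Normc.normcM normc_real; exact: H1.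
- by move=> s e e1; rewrite -mulrBr Normc.normcM normc_real; exact: H2.
Qed.

End Exchange.

(** * Gaussian integrals *)
(* Unification would otherwise unfold every exponential into a product. *)
#[global] Opaque cexp.

Section IntegralOfDerivative.
Context {R : realType} {n : nat}.
Local Notation V := 'rV[R]_n.
Local Notation C := (R[i]).

Lemma cintegrable_decay (F : V -> C) (B : R) :
  cmfun (fun s => F (row_of_tuple s)) -> (forall x, nc (F x) <= B * jb x ^- (2 * n)) ->
  cintegrable (leb n) (fun s => F (row_of_tuple s)).
Proof.
move=> mF FB; apply: (@cintegrable_le _ _ _ _ _ (fun s => B * jb (row_of_tuple s) ^- (2 * n))) => //.
by apply: rintegrableZ; exact: rintegrable_jbV.
Qed.

Lemma jbV_shift (x y : V) k : jb (x + y) ^- k <= jb y ^+ k * jb x ^- k.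
Proof.
rewrite ler_pdivlMr ?jbX_gt0// mulrC ler_pdivrMr ?jbX_gt0// -exprMn.
apply: lerXn2r; rewrite ?nnegrE ?mulr_ge0 ?(ltW (jb_gt0 _))//.
by rewrite -{1}[x](addrK y) -(jbN y) mulrC jbD.
Qed.

(* By translation invariance, [int F(x + h e_i) dx] does not depend on h. *)
Lemma cint_partial0 (F F' : V -> C) i (B : R) : ccont F ->
  (forall x, cder F x (delta_mx 0 i) (F' x)) ->
  (forall x, nc (F x) <= B * jb x ^- (2 * n)) ->
  (forall x, nc (F' x) <= B * jb x ^- (2 * n)) ->
  cint (leb n) (fun s => F' (row_of_tuple s)) = 0.
Proof.
move=> cF dF FB F'B.
have mF : cmfun (fun s => F (row_of_tuple s)).
  by case: cF => c1 c2; apply: cmfun_continuous_rV => // j; exact: measurable_coord.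
have B0 : 0 <= B.
  by have := le_trans (normc_ge0 _) (FB 0); rewrite pmulr_lge0// jbV_gt0.
have iF := cintegrable_decay mF FB.
have := @cder_cint R n _ _ (leb n) (fun s z => F (row_of_tuple s + z))
  (fun s z => F' (row_of_tuple s + z))
  (fun s => B * (2 ^+ (2 * n) * jb (row_of_tuple s) ^- (2 * n))) 0 (delta_mx 0 i).
move=> H; have {H} : cder (fun z => cint (leb n) (fun s => F (row_of_tuple s + z))) 0
    (delta_mx 0 i) (cint (leb n) (fun s => F' (row_of_tuple s + 0))).
  apply: H => [z|||h s].
  - exact: cintegrable_shift.
  - by apply: rintegrableZ; apply: rintegrableZ; exact: rintegrable_jbV.
  - move=> h s _; have := dF (row_of_tuple s + (0 + h *: delta_mx 0 i)).
    have sh (f : V -> R) u v w c : is_derive (u + w) v f c -> is_derive w v (fun z => f (u + z)) c.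
      rewrite -{1}[u + w](addr0 _) -{2}[w](addr0 _) -!(scale0r v) => /is_derive_lineP K.
      apply/is_derive_lineP; move: K; congr (is_derive _ _ _ _).
      by apply/funext => t; rewrite addrA.
    by move=> [d1 d2]; split; exact: sh.
  - move=> h1; apply: le_trans (F'B _) _; rewrite ler_wpM2l// add0r.
    apply: le_trans (jbV_shift _ _ _) _; rewrite ler_wpM2r ?(ltW (jbV_gt0 _ _))//.
    apply: lerXn2r; rewrite ?nnegrE ?(ltW (jb_gt0 _))// /jb mx_normZ.
    have : `|delta_mx 0 i : V| <= 1.
      apply: rV_norm_le => // j; rewrite mxE; case: (_ && _); rewrite ?normr1 ?normr0//.
    have : `|h| <= 1 by rewrite ler_norml; case/andP: h1 => *; apply/andP; split; apply: ltW.
    by have := normr_ge0 h; have := normr_ge0 (delta_mx 0 i : V); move=> *; nra.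
have -> : (fun z => cint (leb n) (fun s => F (row_of_tuple s + z))) =
    fun=> cint (leb n) (fun s => F (row_of_tuple s)).
  by apply/funext => z; exact: cint_shift.
move=> dc; transitivity (cint (leb n) (fun s => F' (row_of_tuple s + 0))).
  by congr cint; apply/funext => s; rewrite addr0.
by rewrite -(cder_pderive dc); exact: cder_pderive (cder_cst _ _ _).
Qed.

End IntegralOfDerivative.

Section GaussianIntegrals.
Context {R : realType} {n : nat}.
Local Notation V := 'rV[R]_n.
Local Notation C := (R[i]).
Implicit Types (z w : 'I_n -> C).

Definition qpoly z w (x : V) : C :=
  \sum_j (- (z j / 2) * ((x 0 j)%:C * (x 0 j)%:C) + w j * (x 0 j)%:C).

Definition qexp z w (x : V) : C := cexp (qpoly z w x).

(** No branch of a complex square root is chosen: the dependence on [w] is computed exactly, while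
    at w = 0 the value is computed for real [z] and only its modulus for complex [z]. *)
Definition qint z w : C := cint (leb n) (fun s => qexp z w (row_of_tuple s)).

Lemma cpoly_qpoly z w : cpoly (qpoly z w).
Proof.
apply: cpoly_sum => j; apply: cpolyD; apply: cpolyM; try exact: cpoly_cst.
  by apply: cpolyM; exact: cpoly_coord.
exact: cpoly_coord.
Qed.

Lemma qexp_ccont z w : ccont (qexp z w).
Proof. by apply: ccont_cexp; exact: cpoly_ccont (cpoly_qpoly z w). Qed.

Lemma qexp_cmfun z w d (T : measurableType d) (r : T -> V) :
  (forall i, measurable_fun setT (fun t => r t 0 i)) -> cmfun (fun t => qexp z w (r t)).
Proof. by move=> mr; have [c1 c2] := qexp_ccont z w; exact: cmfun_continuous_rV. Qed.

Lemma Re_half (a : C) : cRe (a / 2) = cRe a / 2.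
Proof.
have -> : (a / 2 : C) = a * (2^-1 : R)%:C.
  by rewrite rmorphV/= ?unitfE// rmorph_nat.
by rewrite ReM /= mulr0 subr0.
Qed.

Lemma Re_qpoly z w x :
  cRe (qpoly z w x) = \sum_j (- (cRe (z j) / 2 * x 0 j ^+ 2) + cRe (w j) * x 0 j).
Proof.
rewrite /qpoly Re_sum; apply: eq_bigr => j _.
by rewrite ReD !ReM ReN Re_half !ImM /=; ring.
Qed.

(** Uniformity in the scale [c] provides the majorant for differentiating along the segment in
    [qint_shift]. *)
Lemma qexp_decay z w (T : R) k : (forall j, 0 < cRe (z j)) -> exists B, 0 <= B /\
  forall (c : R), `|c| <= T -> forall x,
    nc (qexp z (fun j => c%:C * w j) x) <= B * jb x ^- k.
Proof.
move=> z0; have [c0 [c00 Hc]] := kap_lb (kap := fun j => cRe (z j)) z0.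
pose S := T * \sum_j `|cRe (w j)|.
have [B [B0 HB]] := gauss_poly_bound_lin k S c00.
exists B; split=> // c cT x; rewrite ler_pdivlMr ?jbX_gt0// mulrC.
apply: le_trans (HB `|x| (normr_ge0 _)); rewrite /jb ler_wpM2l ?exprn_ge0 ?addr_ge0//.
rewrite normc_cexp ler_expR Re_qpoly big_split /=; apply: lerD.
  by rewrite sumrN lerN2 Hc.
rewrite /S mulr_sumr mulr_suml; apply: ler_sum => j _.
rewrite ReM /= mul0r subr0; apply: le_trans (ler_norm _) _; rewrite !normrM.
by apply: ler_pM; rewrite ?mulr_ge0//; [exact: ler_pM|exact: normr_coord_le].
Qed.

Lemma mul1_fun w : (fun j => 1%:C * w j) = w.
Proof. by apply/funext => j; rewrite mul1r. Qed.

Lemma qexp_decay1 z w k : (forall j, 0 < cRe (z j)) -> exists B, 0 <= B /\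
  forall x, nc (qexp z w x) <= B * jb x ^- k.
Proof.
move=> z0; have [B [B0 HB]] := qexp_decay w 1 k z0.
exists B; split=> // x; have := HB 1; rewrite normr1 lexx => /(_ isT x).
by rewrite mul1_fun.
Qed.

Lemma qexp_cintegrable z w : (forall j, 0 < cRe (z j)) ->
  cintegrable (leb n) (fun s => qexp z w (row_of_tuple s)).
Proof.
move=> z0; have [B [B0 HB]] := qexp_decay1 w (2 * n) z0.
apply: cintegrable_decay HB; apply: qexp_cmfun => i; exact: measurable_coord.
Qed.

Lemma cder_qexp z w x j :
  cder (qexp z w) x (delta_mx 0 j) ((- z j * (x 0 j)%:C + w j) * qexp z w x).
Proof.
apply: cder_cexp; have -> : - z j * (x 0 j)%:C + w j =
    \sum_i (- (z i / 2) * ((i == j)%:R%:C * (x 0 i)%:C + (x 0 i)%:C * (i == j)%:R%:C) +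
      w i * (i == j)%:R%:C).
  rewrite (bigD1 j)//= eqxx rmorph1 big1 ?addr0 => [|i /negPf ->]; first by field.
  by rewrite mul0r mulr0 addr0 mulr0 mulr0 addr0.
apply: cder_sum => i; apply: cderD; apply: cderZ.
  have := cderM (cder_coord i x (delta_mx 0 j)) (cder_coord i x (delta_mx 0 j)).
  by rewrite mxE eqxx.
by have := cder_coord i x (delta_mx 0 j); rewrite mxE eqxx.
Qed.

Lemma qexp_moment_decay z w (T : R) (j : 'I_n) : (forall j, 0 < cRe (z j)) -> exists B, 0 <= B /\
  forall (c : R), `|c| <= T -> forall x : V,
    nc ((x 0 j)%:C * qexp z (fun j => c%:C * w j) x) <= B * jb x ^- (2 * n).
Proof.
move=> z0; have [B [B0 HB]] := qexp_decay w T (2 * n).+1 z0.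
exists B; split=> // c cT x; rewrite Normc.normcM normc_real.
apply: le_trans (ler_wpM2l (normr_ge0 _) (HB c cT x)) _.
rewrite mulrCA ler_wpM2l// exprS invfM mulrA ler_piMl ?(ltW (jbV_gt0 _ _))//.
rewrite ler_pdivrMr ?jb_gt0// mul1r.
by rewrite (le_trans (normr_coord_le _ _))// lerDr.
Qed.

Lemma qexp_moment_cintegrable z w j : (forall j, 0 < cRe (z j)) ->
  cintegrable (leb n) (fun s => (row_of_tuple s 0 j)%:C * qexp z w (row_of_tuple s)).
Proof.
move=> z0; have [B [B0 HB]] := qexp_moment_decay w 1 j z0.
apply: (@cintegrable_decay R n (fun x => (x 0 j)%:C * qexp z w x) B).
  apply: cmfunM; first by apply: cmfun_real; exact: measurable_coord.
  by apply: qexp_cmfun => i; exact: measurable_coord.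
move=> x; have := HB 1; rewrite normr1 lexx => /(_ isT x).
by rewrite mul1_fun.
Qed.

(** The j-th partial derivative of the Gaussian is - z_j x_j + w_j times the Gaussian, and its
    integral vanishes. *)
Lemma qint_moment z w j : (forall j, 0 < cRe (z j)) ->
  cint (leb n) (fun s => (row_of_tuple s 0 j)%:C * qexp z w (row_of_tuple s)) =
  w j / z j * qint z w.
Proof.
move=> z0; have zj0 : z j != 0 by apply: contraTneq (z0 j) => ->; rewrite ltxx.
have iM := qexp_moment_cintegrable w j z0; have iQ := qexp_cintegrable w z0.
have [B1 [B10 HB1]] := qexp_decay1 w (2 * n) z0.
have [B2 [B20 HB2]] := qexp_moment_decay w 1 j z0.
have E : cint (leb n) (fun s => - z j * ((row_of_tuple s 0 j)%:C * qexp z w (row_of_tuple s)) +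
    w j * qexp z w (row_of_tuple s)) = 0.
  have := @cint_partial0 R n (qexp z w) (fun x => (- z j * (x 0 j)%:C + w j) * qexp z w x) j
    (B1 + (nc (z j) * B2 + nc (w j) * B1)) (qexp_ccont z w) (cder_qexp z w ^~ j).
  move=> H; rewrite -[RHS]H.
  - by congr cint; apply/funext => s; ring.
  - move=> x; apply: le_trans (HB1 x) _; rewrite ler_wpM2r ?(ltW (jbV_gt0 _ _))//.
    by rewrite lerDl addr_ge0// mulr_ge0// normc_ge0.
  - move=> x; rewrite mulrDl; apply: le_trans (le_normcD _ _) _.
    rewrite -mulrA (Normc.normcM (- z j)) normcN (Normc.normcM (w j)).
    apply: (@le_trans _ _ ((nc (z j) * B2 + nc (w j) * B1) * jb x ^- (2 * n))); last first.
      by rewrite ler_wpM2r ?(ltW (jbV_gt0 _ _))// lerDr.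
    rewrite mulrDl -!mulrA; apply: lerD; rewrite ler_wpM2l ?normc_ge0//.
    have := HB2 1; rewrite normr1 lexx => /(_ isT x).
    by rewrite mul1_fun.
move: E; rewrite cintD; [|exact: cintegrableZ|exact: cintegrableZ].
rewrite !cintZ// -/(qint z w) => /eqP; rewrite addr_eq0 => /eqP E.
apply: (@mulfI _ (- z j)); first by rewrite oppr_eq0.
by rewrite E; move: (qint z w) => I; field.
Qed.

(* ODE along the segment from 0 to w. *)
Lemma qint_shift z w : (forall j, 0 < cRe (z j)) ->
  qint z w = qint z (fun=> 0) * cexp (\sum_j (w j ^+ 2 / (2 * z j))).
Proof.
move=> z0; have zj0 j : z j != 0 by apply: contraTneq (z0 j) => ->; rewrite ltxx.
pose S := \sum_j (w j ^+ 2 / (2 * z j)).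
(* The scale parameter is a row vector of length 1, so that the calculus of [cder] applies to it. *)
pose e : 'rV[R]_1 := delta_mx 0 0.
pose J (y : 'rV[R]_1) := qint z (fun j => (y 0 0)%:C * w j).
have dJ y : cder J y e (2 * (y 0 0)%:C * S * J y).
  (* The radius |y| + 1 covers the steps of length below 1 that [cder_cint] considers. *)
  have [B HB] := choice (fun j => qexp_moment_decay w (`|y 0 0| + 1) j z0).
  have e1 : e 0 0 = 1 by rewrite mxE.
  have := @cder_cint R 1 _ _ (leb n)
    (fun s y => qexp z (fun j => (y 0 0)%:C * w j) (row_of_tuple s))
    (fun s y => (\sum_j w j * (row_of_tuple s 0 j)%:C) *
       qexp z (fun j => (y 0 0)%:C * w j) (row_of_tuple s))
    (fun s => (\sum_j nc (w j) * B j) * jb (row_of_tuple s) ^- (2 * n)) y e.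
  move=> H; apply: cder_eq (H _ _ _ _) _.
  - by move=> x; exact: qexp_cintegrable.
  - by apply: rintegrableZ; exact: rintegrable_jbV.
  - move=> h s _; apply: cder_cexp; apply: cder_sum => j.
    apply: cder_eq (cderD (cder_cst _ _ _)
      (cderM (cderM (cder_coord 0 _ e) (cder_cst (w j) _ _)) (cder_cst _ _ _))) _.
    by rewrite e1; ring.
  - move=> h s /andP[h1 h2]; rewrite mulr_suml mulr_suml.
    apply: le_trans (normc_sum _ _ _) _; apply: ler_sum => j _.
    rewrite -!mulrA Normc.normcM ler_wpM2l ?normc_ge0//; have [_ K] := HB j; apply: K.
    rewrite !mxE eqxx mulr1 (le_trans (ler_normD _ _))// lerD2l ler_norml.
    by rewrite !ltW.
  - rewrite /= (_ : (fun s => _) = fun s => \sum_j w j *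
      ((row_of_tuple s 0 j)%:C * qexp z (fun j => (y 0 0)%:C * w j) (row_of_tuple s))); last first.
      by apply/funext => s; rewrite mulr_suml; apply: eq_bigr => j _; rewrite mulrA.
    rewrite cint_sum => [|j]; last exact/cintegrableZ/qexp_moment_cintegrable.
    rewrite /S mulr_sumr mulr_suml; apply: eq_bigr => j _.
    rewrite cintZ; last exact: qexp_moment_cintegrable.
    rewrite qint_moment// -/(J y); move: (J y) => Jy.
    by field; exact: zj0.
(* An integrating factor: J' = 2 y S J makes [K] constant, and the mean value bound with derivative
   0 compares y = 0 with y = 1. *)
pose K (y : 'rV[R]_1) := J y * cexp (- S * ((y 0 0)%:C * (y 0 0)%:C)).
have dK y : cder K y e 0.
  have e1 : e 0 0 = 1 by rewrite mxE.
  apply: cder_eq (cderM (dJ y) (cder_cexp (cderZ (- S)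
    (cderM (cder_coord 0 y e) (cder_coord 0 y e))))) _.
  by rewrite e1; move: (cexp _) (J y) => u v; ring.
have := @cder_mvt _ _ K 0 e (fun=> 0) 0 (fun h => dK _).
rewrite Normc.normc0 mul0rn => /(_ (fun _ _ => lexx _)).
rewrite le_eqVlt ltNge normc_ge0 orbF normc_eq0 subr_eq0 add0r => /eqP.
rewrite /K /J mxE eqxx /= mxE !mul1r mulr1 !mulr0 cexp0 mulr1.
have -> : qint z (fun j => 0 * w j) = qint z (fun=> 0).
  by congr qint; apply/funext => j; rewrite mul0r.
have -> : qint z (fun j => 1 * w j) = qint z w.
  by congr qint; apply/funext => j; rewrite mul1r.
move=> <-; rewrite -mulrA -cexpD addNr cexp0 mulr1//.
Qed.

Lemma qint_real (a : 'I_n -> R) : (forall j, 0 < a j) ->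
  qint (fun j => (a j)%:C) (fun=> 0) = (\prod_j Num.sqrt (2 * pi / a j))%:C.
Proof.
move=> a0; have [ia <-] := gauss_integral_rV a0.
have E x : qexp (fun j => (a j)%:C) (fun=> 0) x =
    (expR (- \sum_j (a j / 2 * x 0 j ^+ 2)))%:C.
  rewrite /qexp -cexp_real; congr cexp; apply: complex_eqP.
    by rewrite Re_qpoly /= -sumrN; apply: eq_bigr => j _; rewrite mul0r addr0.
  transitivity (0 : R) => //; rewrite /qpoly Im_sum big1// => j _; rewrite mul0r addr0.
  have -> : ((a j)%:C / 2 : C) = (a j / 2)%:C by rewrite rmorphM/= rmorphV/= ?unitfE// rmorph_nat.
  by rewrite ImM ImN ImM /=; ring.
rewrite /qint; apply: complex_eqP => /=.
  by apply: eq_Rintegral => s _; rewrite E.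
under eq_Rintegral do rewrite E /=.
by rewrite /Rintegral integral0.
Qed.

End GaussianIntegrals.

Section GaussianModulus.
Context {R : realType} {n : nat}.
Local Notation V := 'rV[R]_n.
Local Notation C := (R[i]).
Implicit Types (z w : 'I_n -> C).

Lemma cexp_conj (a : C) : (cexp a)^* = cexp a^*.
Proof.
by apply: complex_eqP; rewrite ?Re_conj ?Im_conj ?Re_cexp ?Im_cexp ?Re_conj ?Im_conj ?cosN ?sinN ?mulrN.
Qed.

Lemma cint_conj d (T : measurableType d) (mu : {measure set T -> \bar R}) (f : T -> C) :
  cintegrable mu f -> cint mu (fun t => (f t)^*) = (cint mu f)^*.
Proof.
move=> [f1 f2]; apply: complex_eqP; rewrite ?Re_conj ?Im_conj /=.
  by apply: eq_Rintegral => t _; rewrite Re_conj.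
under eq_Rintegral do rewrite Im_conj -mulN1r.
by rewrite RintegralZl// mulN1r.
Qed.

(* Shear [(x, x') = (v + y, y)] in the double integral of
   [qexp z 0 x * conj (qexp z 0 x')], then the integral over [y] is Gaussian with
   real quadratic part. *)
Lemma normc_qint0 z : (forall j, 0 < cRe (z j)) ->
  nc (qint z (fun=> 0)) ^+ 2 = \prod_j (2 * pi / nc (z j)).
Proof.
(* After the shear the integral over y has coefficient 2 a; completing its square leaves the
   coefficient b for v, and 2 a b = |z|^2. *)
move=> z0; pose a j := cRe (z j); pose b j := (nc (z j) ^+ 2) / (2 * a j).
have nz j : 0 < nc (z j) by apply: lt_le_trans (z0 j) (Re_le_normc _).
have a2 j : 0 < 2 * a j by rewrite mulr_gt0// z0.
have b0 j : 0 < b j by rewrite divr_gt0// exprn_gt0.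
pose Q := qexp z (fun=> 0).
have mQ d (T : measurableType d) (r : T -> V) :
    (forall i, measurable_fun setT (fun t => r t 0 i)) -> cmfun (fun t => Q (r t)).
  exact: qexp_cmfun.
have iQ : cintegrable (leb n) (fun s => Q (row_of_tuple s)) by exact: qexp_cintegrable.
(* Of the 4n powers carried by the factor in y, 2n pay for the translation in the other factor and
   2n make the integral over y converge. *)
have [B [B0 HB]] := qexp_decay1 (fun=> 0) (4 * n) z0.
pose F (v y : n.-tuple (measurableTypeR R)) :=
  Q (row_of_tuple v + row_of_tuple y) * conjc (Q (row_of_tuple y)).
have mF : cmfun (fun p : n.-tuple (measurableTypeR R) * n.-tuple (measurableTypeR R) => F p.1 p.2).
  have m1 i : measurable_fun setT (fun p : n.-tuple (measurableTypeR R) * n.-tuple (measurableTypeR R) => row_of_tuple p.1 0 i).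
    by apply: (measurableT_comp (measurable_coord i)).
  have m2 i : measurable_fun setT (fun p : n.-tuple (measurableTypeR R) * n.-tuple (measurableTypeR R) => row_of_tuple p.2 0 i).
    by apply: (measurableT_comp (measurable_coord i)).
  apply: cmfunM; last exact/cmfun_conj/mQ.
  by apply: mQ => i; under eq_fun do rewrite mxE; exact: measurable_funD.
have iF : cintegrable (leb n \x leb n)%E (fun p => F p.1 p.2).
  apply: (@cintegrable_prod_le _ _ _ _ _ (leb n) (leb n) (fun p => F p.1 p.2)
    (fun v => (B ^+ 2) * jb (row_of_tuple v) ^- (2 * n)) (fun y => jb (row_of_tuple y) ^- (2 * n))) => //=.
  - by apply: rintegrableZ; exact: rintegrable_jbV.
  - exact: rintegrable_jbV.
  - by move=> v; rewrite mulr_ge0 ?sqr_ge0 ?(ltW (jbV_gt0 _ _)).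
  - by move=> y; rewrite (ltW (jbV_gt0 _ _)).
  - move=> v y; rewrite /F Normc.normcM normc_conj.
    apply: le_trans (ler_pM (normc_ge0 _) (normc_ge0 _) (HB _) (HB _)) _.
    rewrite mulrACA -expr2 -[leRHS]mulrA ler_wpM2l ?sqr_ge0//.
    have e4 : (4 * n = 2 * n + 2 * n)%N by lia.
    rewrite {2}e4 exprD invfM mulrA ler_wpM2r ?(ltW (jbV_gt0 _ _))//.
    apply: le_trans (ler_wpM2r (ltW (jbV_gt0 _ _)) (jbV_homo _ (_ : (2 * n <= 4 * n)%N))) _.
      by rewrite leq_mul2r orbT.
    apply: le_trans (ler_wpM2r (ltW (jbV_gt0 _ _)) (jbV_shift _ _ _)) _.
    by rewrite mulrAC mulfV ?mul1r// gt_eqF// jbX_gt0.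
have E1 : qint z (fun=> 0) * conjc (qint z (fun=> 0)) =
    cint (leb n) (fun y => cint (leb n) (fun v => F v y)).
  have -> : conjc (qint z (fun=> 0)) = cint (leb n) (fun s => conjc (Q (row_of_tuple s))).
    by rewrite cint_conj.
  rewrite -cintZ; last first.
    by have [i1 i2] := iQ; split; under eq_fun do rewrite ?Re_conj ?Im_conj;
      [exact: i1|under eq_fun do rewrite -mulN1r; exact: rintegrableZ].
  congr cint; apply/funext => y.
  rewrite /qint -(cint_shift (row_of_tuple y) (F := Q)); last exact: (cintegrable_cmfun iQ).
  rewrite mulrC -cintZ; last exact: (cintegrable_shift (F := Q)).
  by congr cint; apply/funext => v; rewrite mulrC.
have E2 v : cint (leb n) (fun y => F v y) =
    (\prod_j Num.sqrt (2 * pi / (2 * a j)))%:C *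
    qexp (fun j => (b j)%:C) (fun=> 0) (row_of_tuple v).
  have FE y : F v y = Q (row_of_tuple v) *
      qexp (fun j => (2 * a j)%:C) (fun j => - z j * (row_of_tuple v 0 j)%:C) (row_of_tuple y).
    rewrite /F /Q /qexp cexp_conj -!cexpD; congr cexp.
    rewrite /qpoly (raddf_sum (conjc (R := R))) /= -!big_split /=; apply: eq_bigr => j _.
    rewrite !mxE !mul0r !addr0.
    have h2 (c : C) : c / 2 = c * (2^-1 : R)%:C by rewrite rmorphV/= ?unitfE// rmorph_nat.
    by rewrite !h2 /a; case: (z j) => p q; apply: complex_eqP => /=; field.
  rewrite (_ : (fun y => F v y) = fun y => Q (row_of_tuple v) *
      qexp (fun j => (2 * a j)%:C) (fun j => - z j * (row_of_tuple v 0 j)%:C) (row_of_tuple y)); last first.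
    by apply/funext => y; exact: FE.
  rewrite cintZ; last exact: qexp_cintegrable.
  rewrite -/(qint _ _) qint_shift// qint_real// mulrCA; congr (_ * _).
  rewrite /Q /qexp -cexpD; congr cexp; rewrite /qpoly -big_split /=; apply: eq_bigr => j _.
  rewrite !mul0r !addr0 /b sqr_normc /a; have := z0 j.
  case: (z j) => p q /= p0.
  have h2 (c : C) : c / 2 = c * (2^-1 : R)%:C by rewrite rmorphV/= ?unitfE// rmorph_nat.
  have h3 (c : C) : c / (2 * (2 * p)%:C) = c * ((4 * p)^-1 : R)%:C.
    rewrite rmorphV/= ?unitfE ?gt_eqF ?mulr_gt0//; congr (_ / _).
    by rewrite !rmorphM/= !rmorph_nat mulrA -natrM.
  by rewrite !h2 h3; apply: complex_eqP; rewrite /= ?expr2 /=; field; rewrite gt_eqF.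
have E : qint z (fun=> 0) * conjc (qint z (fun=> 0)) =
    (\prod_j Num.sqrt (2 * pi / (2 * a j)) * \prod_j Num.sqrt (2 * pi / b j))%:C.
  rewrite E1 -(cfubini iF).
  rewrite (_ : (fun x => _) = fun v => (\prod_j Num.sqrt (2 * pi / (2 * a j)))%:C *
    qexp (fun j => (b j)%:C) (fun=> 0) (row_of_tuple v)); last by apply/funext => v; exact: E2.
  rewrite cintZ; last by apply: qexp_cintegrable => j; exact: b0.
  by rewrite -/(qint _ _) qint_real// rmorphM.
have := congr1 (@complex.Re R) E; rewrite sqr_normc.
have -> : cRe (qint z (fun=> 0) * conjc (qint z (fun=> 0))) =
    cRe (qint z (fun=> 0)) ^+ 2 + cIm (qint z (fun=> 0)) ^+ 2.
  by case: (qint _ _) => p q /=; ring.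
move=> -> /=; rewrite -big_split /=; apply: eq_bigr => j _.
have p0 : 0 <= 2 * (pi : R) by rewrite mulr_ge0// pi_ge0.
rewrite -sqrtrM ?divr_ge0// ?(ltW (a2 j))//.
have -> : 2 * pi / (2 * a j) * (2 * pi / b j) = (2 * pi / nc (z j)) ^+ 2.
  by rewrite /b; field; rewrite !gt_eqF//= ?z0.
by rewrite sqrtr_sqr ger0_norm// divr_ge0// ltW.
Qed.

Lemma normc_qint z w : (forall j, 0 < cRe (z j)) ->
  nc (qint z w) = (\prod_j Num.sqrt (2 * pi / nc (z j))) *
    expR (\sum_j cRe (w j ^+ 2 / (2 * z j))).
Proof.
move=> z0; rewrite qint_shift// Normc.normcM normc_cexp Re_sum; congr (_ * _).
have p0 j : 0 <= 2 * pi / nc (z j) by rewrite divr_ge0 ?normc_ge0// mulr_ge0// pi_ge0.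
rewrite -[LHS]ger0_norm ?normc_ge0// -sqrtr_sqr normc_qint0//.
elim: (index_enum _) => [|j r IH]; first by rewrite !big_nil sqrtr1.
by rewrite !big_cons sqrtrM// IH.
Qed.

End GaussianModulus.

Section Characters.
Context {R : realType} {n : nat}.
Local Notation V := 'rV[R]_n.
Local Notation C := (R[i]).
Variable lam : R.
Implicit Types (x y w : V) (mu kap : 'I_n -> R).

Lemma normcN (c : C) : nc (- c) = nc c.
Proof. by rewrite !normcE ReN ImN !sqrrN. Qed.

Lemma realc_half (c : R) : c%:C / 2 = (c / 2)%:C.
Proof. by rewrite rmorphM/= fmorphV rmorph_nat. Qed.

Lemma realc_doubleV (c : R) : (2 * c%:C)^-1 = ((2 * c)^-1)%:C.
Proof. by rewrite fmorphV rmorphM/= rmorph_nat. Qed.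

Definition echar x y : C := cis (lam * dot x y).

Lemma dotE x y : dot x y = \sum_j x 0 j * y 0 j.
Proof. by rewrite /dot mxE; apply: eq_bigr => j _; rewrite mxE. Qed.

Lemma normc_echar x y : nc (echar x y) = 1.
Proof. exact: normc_cis. Qed.

Lemma echarC x y : echar x y = echar y x.
Proof. by rewrite /echar !dotE; congr cis; congr (_ * _); apply: eq_bigr => j _; rewrite mulrC. Qed.

Lemma dotDl x x' y : dot (x + x') y = dot x y + dot x' y.
Proof. by rewrite !dotE -big_split; apply: eq_bigr => j _; rewrite mxE mulrDl. Qed.

Lemma dotDr x y y' : dot x (y + y') = dot x y + dot x y'.
Proof. by rewrite !dotE -big_split; apply: eq_bigr => j _; rewrite mxE mulrDr. Qed.

Lemma dotNl x y : dot (- x) y = - dot x y.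
Proof. by rewrite !dotE -sumrN; apply: eq_bigr => j _; rewrite mxE mulNr. Qed.

Lemma dotZl a x y : dot (a *: x) y = a * dot x y.
Proof. by rewrite !dotE mulr_sumr; apply: eq_bigr => j _; rewrite mxE mulrA. Qed.

Lemma dotC x y : dot x y = dot y x.
Proof. by rewrite !dotE; apply: eq_bigr => j _; rewrite mulrC. Qed.

Lemma measurable_dot d (T : measurableType d) (p r : T -> V) :
  (forall i, measurable_fun setT (fun t => p t 0 i)) ->
  (forall i, measurable_fun setT (fun t => r t 0 i)) ->
  measurable_fun setT (fun t => dot (p t) (r t)).
Proof.
move=> mp mr; under eq_fun do rewrite dotE.
by apply: measurable_sum => i; exact: measurable_funM.
Qed.

Lemma cmfun_echar d (T : measurableType d) (p r : T -> V) :
  (forall i, measurable_fun setT (fun t => p t 0 i)) ->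
  (forall i, measurable_fun setT (fun t => r t 0 i)) ->
  cmfun (fun t => echar (p t) (r t)).
Proof. by move=> mp mr; apply: cmfun_cis; apply: measurable_funM => //; exact: measurable_dot. Qed.

Lemma measurable_rowD d (T : measurableType d) (p r : T -> V) :
  (forall i, measurable_fun setT (fun t => p t 0 i)) ->
  (forall i, measurable_fun setT (fun t => r t 0 i)) ->
  forall i, measurable_fun setT (fun t => (p t + r t) 0 i).
Proof. by move=> mp mr i; under eq_fun do rewrite mxE; exact: measurable_funD. Qed.

Lemma measurable_rowB d (T : measurableType d) (p r : T -> V) :
  (forall i, measurable_fun setT (fun t => p t 0 i)) ->
  (forall i, measurable_fun setT (fun t => r t 0 i)) ->
  forall i, measurable_fun setT (fun t => (p t - r t) 0 i).
Proof. by move=> mp mr i; under eq_fun do rewrite !mxE; exact: measurable_funB. Qed.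

Lemma measurable_rowN d (T : measurableType d) (p : T -> V) :
  (forall i, measurable_fun setT (fun t => p t 0 i)) ->
  forall i, measurable_fun setT (fun t => (- p t) 0 i).
Proof. by move=> mp i; under eq_fun do rewrite mxE; exact: measurable_funN. Qed.

Lemma measurable_row_cst d (T : measurableType d) (x : V) i :
  measurable_fun setT (fun _ : T => x 0 i).
Proof. exact: measurable_cst. Qed.

Lemma measurable_rowZ d (T : measurableType d) (a : R) (p : T -> V) :
  (forall i, measurable_fun setT (fun t => p t 0 i)) ->
  forall i, measurable_fun setT (fun t => (a *: p t) 0 i).
Proof. by move=> mp i; under eq_fun do rewrite mxE; exact: measurable_funM. Qed.

Lemma echarE x : echar x = fun y => cexp (\sum_j (0 +i* (lam * x 0 j)) * (y 0 j)%:C).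
Proof.
apply/funext => z; rewrite /echar cis_cexp dotE; congr cexp.
apply: complex_eqP; rewrite ?Re_sum ?Im_sum /=.
  by rewrite big1// => j _; rewrite mul0r mulr0 subrr.
by rewrite mulr_sumr; apply: eq_bigr => j _; rewrite mul0r add0r mulrA.
Qed.

Lemma ccont_echar x : ccont (echar x).
Proof.
rewrite echarE; apply: ccont_cexp; apply: cpoly_ccont; apply: cpoly_sum => j.
by apply: cpolyM; [exact: cpoly_cst|exact: cpoly_coord].
Qed.

Lemma cder_echar x y i : cder (echar x) y (delta_mx 0 i) ((0 +i* (lam * x 0 i)) * echar x y).
Proof.
rewrite echarE; apply: cder_cexp; apply: cder_eq.
  by apply: cder_sum => j; apply: cderZ; exact: cder_coord.
rewrite (bigD1 i) //= mxE !eqxx /= mulr1 big1 ?addr0 // => j ji.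
by rewrite mxE eqxx (negbTE ji) mulr0.
Qed.

Definition rgauss mu : V -> C := qexp (fun j => (mu j)%:C) (fun=> 0).
Definition rmass mu : R := \prod_j Num.sqrt (2 * pi / mu j).

Lemma rmass_gt0 mu : (forall j, 0 < mu j) -> 0 < rmass mu.
Proof. by move=> h; apply: prodr_gt0 => j _; rewrite sqrtr_gt0 divr_gt0// mulr_gt0// pi_gt0. Qed.

Lemma rgaussE mu x : rgauss mu x = (expR (- \sum_j (mu j / 2 * x 0 j ^+ 2)))%:C.
Proof.
rewrite /rgauss /qexp -cexp_real; congr cexp.
apply: complex_eqP; first by rewrite Re_qpoly /= -sumrN; apply: eq_bigr => j _; rewrite mul0r addr0.
rewrite /qpoly Im_sum big1// => j _.
by rewrite realc_half /=; ring.
Qed.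

Lemma rgaussN mu x : rgauss mu (- x) = rgauss mu x.
Proof. by rewrite !rgaussE; congr (expR (- _))%:C; apply: eq_bigr => j _; rewrite mxE sqrrN. Qed.

Lemma cmfun_rgauss mu d (T : measurableType d) (r : T -> V) :
  (forall i, measurable_fun setT (fun t => r t 0 i)) -> cmfun (fun t => rgauss mu (r t)).
Proof. exact: qexp_cmfun. Qed.

Lemma rgauss_decay mu k : (forall j, 0 < mu j) -> exists B, 0 <= B /\
  forall x, nc (rgauss mu x) <= B * jb x ^- k.
Proof. by move=> h; exact: qexp_decay1. Qed.

Lemma rgauss_cintegrable mu : (forall j, 0 < mu j) ->
  cintegrable (leb n) (fun s => rgauss mu (row_of_tuple s)).
Proof. by move=> h; exact: qexp_cintegrable. Qed.

(** The integrand carries the dual coefficient lam^2 / mu so that the right-hand side is the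
    Gaussian [mu]: read backwards, this writes a given Gaussian as a superposition of characters. *)
Lemma rgauss_fourier mu w : lam != 0 -> (forall j, 0 < mu j) ->
  cint (leb n) (fun s => rgauss (fun j => lam ^+ 2 / mu j) (row_of_tuple s) * echar w (row_of_tuple s)) =
  (rmass (fun j => lam ^+ 2 / mu j))%:C * rgauss mu w.
Proof.
move=> l0 m0.
have l2 : 0 < lam ^+ 2 by rewrite exprn_even_gt0.
have p0 j : 0 < lam ^+ 2 / mu j by rewrite divr_gt0.
transitivity (qint (fun j => (lam ^+ 2 / mu j)%:C) (fun j => 0 +i* (lam * w 0 j))).
  congr cint; apply/funext => s; rewrite /rgauss /qexp /echar cis_cexp -cexpD; congr cexp.
  rewrite /qpoly dotE mulr_sumr.
  have -> : 0 +i* (\sum_i lam * (w 0 i * row_of_tuple s 0 i)) =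
      \sum_i (0 +i* (lam * (w 0 i * row_of_tuple s 0 i))) :> C.
    by apply: complex_eqP; rewrite ?Re_sum ?Im_sum //= big1.
  rewrite -big_split /=; apply: eq_bigr => j _; rewrite mul0r addr0; congr (_ + _).
  by apply: complex_eqP; rewrite /=; ring.
rewrite qint_shift// qint_real//; congr (_ * _); rewrite rgaussE -cexp_real; congr cexp.
rewrite -sumrN (raddf_sum (real_complex R)) /=; apply: eq_bigr => j _.
rewrite realc_doubleV; have mj := m0 j.
by apply: complex_eqP; rewrite /= ?expr2 /=; field; rewrite ?l0 ?gt_eqF.
Qed.

(** Coefficients are inverse variances up to scale, and variances add under convolution, whence mu
    kap / (mu + kap). *)
Lemma rgauss_conv mu kap w : (forall j, 0 < mu j) -> (forall j, 0 < kap j) ->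
  cint (leb n) (fun s => rgauss mu (w - row_of_tuple s) * rgauss kap (row_of_tuple s)) =
  (rmass (fun j => mu j + kap j))%:C * rgauss (fun j => mu j * kap j / (mu j + kap j)) w.
Proof.
move=> m0 k0; have s0 j : 0 < mu j + kap j by rewrite addr_gt0.
transitivity (cint (leb n) (fun s => rgauss mu w * qexp (fun j => (mu j + kap j)%:C)
   (fun j => (mu j * w 0 j)%:C) (row_of_tuple s))).
  congr cint; apply/funext => s; rewrite /rgauss /qexp -!cexpD; congr cexp.
  rewrite /qpoly -!big_split /=; apply: eq_bigr => j _; rewrite !mxE !mul0r !addr0.
  by rewrite !realc_half; apply: complex_eqP; rewrite /=; field.
rewrite cintZ; last exact: qexp_cintegrable.
rewrite -/(qint _ _) qint_shift// qint_real// mulrCA; congr (_ * _).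
rewrite !rgaussE -!cexp_real -cexpD; congr cexp.
rewrite -!sumrN !(raddf_sum (real_complex R)) /= -big_split; apply: eq_bigr => j _ /=.
rewrite realc_doubleV; have sj := s0 j.
by apply: complex_eqP; rewrite /= ?expr2 /=; field; rewrite ?gt_eqF.
Qed.

End Characters.

(** * The upper bound *)

Section FourierDecay.
Context {R : realType} {n : nat}.
Local Notation V := 'rV[R]_n.
Local Notation C := (R[i]).
Local Notation T := (n.-tuple (measurableTypeR R)).
Local Notation row := (@row_of_tuple R n).
Variable lam : R.
Hypothesis lam_neq0 : lam != 0.
Implicit Types (phi : V -> C) (x y a xi : V).

Lemma measurable_coord1 i : measurable_fun setT (fun p : T * T => row p.1 0 i).
Proof. by apply: (measurableT_comp (measurable_coord i)). Qed.

Lemma measurable_coord2 i : measurable_fun setT (fun p : T * T => row p.2 0 i).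
Proof. by apply: (measurableT_comp (measurable_coord i)). Qed.

Lemma cintegrable_prod_jb (F : T * T -> C) (B : R) : cmfun F ->
  (forall x y : T, nc (F (x, y)) <= B * jb (row x) ^- (2 * n) * jb (row y) ^- (2 * n)) ->
  cintegrable (leb n \x leb n)%E F.
Proof.
move=> mF FB.
have B0 : 0 <= B.
  have := le_trans (normc_ge0 _) (FB [tuple 0 | i < n] [tuple 0 | i < n]).
  by rewrite pmulr_lge0 ?jbV_gt0// pmulr_lge0// jbV_gt0.
apply: (@cintegrable_prod_le _ _ _ _ _ (leb n) (leb n) F
  (fun s => B * jb (row s) ^- (2 * n)) (fun s => jb (row s) ^- (2 * n))) => //.
- by apply: rintegrableZ; exact: rintegrable_jbV.
- exact: rintegrable_jbV.
- by move=> x; rewrite mulr_ge0 ?(ltW (jbV_gt0 _ _)).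
- by move=> y; exact: ltW (jbV_gt0 _ _).
Qed.

Lemma jbV_split x k l : jb x ^- (k + l) = jb x ^- k * jb x ^- l.
Proof. by rewrite exprD invfM. Qed.

Lemma jbVK x k : jb x ^+ k * jb x ^- k = 1.
Proof. by rewrite mulfV// gt_eqF// jbX_gt0. Qed.

(* Peetre: decay in [y] of one factor pays for the translation of the other. *)
Lemma jb_peetre x y k l : jb y ^- (k + l) * jb (x + y) ^- k <= jb y ^- l * jb x ^- k.
Proof.
apply: le_trans (ler_wpM2l (ltW (jbV_gt0 _ _)) (jbV_shift _ _ _)) _.
by rewrite jbV_split [jb y ^- k * _]mulrC -mulrA ler_wpM2l ?(ltW (jbV_gt0 _ _))// mulrA
  [_ * jb y ^+ k]mulrC jbVK mul1r.
Qed.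

(** For lam = 1 / hbar this is the inverse Fourier transform without its constant; it carries the
    positive sign because duality applies [ifourier] to the test function first. *)
Definition hat phi xi : C := cint (leb n) (fun s => phi (row s) * echar lam xi (row s)).

Lemma cmfun_hat phi d (U : measurableType d) (r : U -> V) : schwartz phi ->
  (forall i, measurable_fun setT (fun t => r t 0 i)) -> cmfun (fun t => hat phi (r t)).
Proof.
move=> sphi mr.
apply: (@cmfun_cint _ _ _ U T (leb n) (fun p => phi (row p.2) * echar lam (r p.1) (row p.2))).
have m2 i : measurable_fun setT (fun p : U * T => row p.2 0 i).
  by apply: (measurableT_comp (measurable_coord i)).
apply: cmfunM; first exact: schwartz_cmfun.
by apply: cmfun_echar => // i; apply: (measurableT_comp (mr i)).
Qed.

Lemma hat_cintegrable phi xi : schwartz phi ->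
  cintegrable (leb n) (fun s => phi (row s) * echar lam xi (row s)).
Proof.
move=> sphi; apply: (cintegrable_le (q := fun s => nc (phi (row s)))).
- apply: cmfunM; first by apply: schwartz_cmfun => // i; exact: measurable_coord.
  by apply: cmfun_echar => // i; exact: measurable_coord.
- exact/cintegrable_norm/schwartz_cintegrable.
- by move=> s; rewrite Normc.normcM normc_echar mulr1.
Qed.

(** Integration by parts: the derivative of phi times a character has integral zero. *)
Lemma hat_ibp phi xi i : schwartz phi ->
  (0 +i* (lam * xi 0 i)) * hat phi xi = - hat (pderive i phi) xi.
Proof.
move=> sphi; have s' := schwartz_pderive i sphi.
have [B [B0 HB]] := schwartz_decay (2 * n) sphi.
have [B' [B'0 HB']] := schwartz_decay (2 * n) s'.
have HF := @cint_partial0 R n (fun z => phi z * echar lam xi z)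
  (fun z => pderive i phi z * echar lam xi z + phi z * ((0 +i* (lam * xi 0 i)) * echar lam xi z)) i
  (B + (B' + B * nc (0 +i* (lam * xi 0 i)))).

have b1 x : nc (phi x * echar lam xi x) <= B * jb x ^- (2 * n).
  by rewrite Normc.normcM normc_echar mulr1.
have b2 x : nc (pderive i phi x * echar lam xi x) <= B' * jb x ^- (2 * n).
  by rewrite Normc.normcM normc_echar mulr1.
have b3 x : nc (phi x * ((0 +i* (lam * xi 0 i)) * echar lam xi x)) <=
    B * nc (0 +i* (lam * xi 0 i)) * jb x ^- (2 * n).
  rewrite mulrCA (Normc.normcM (0 +i* (lam * xi 0 i))) [B * _]mulrC -mulrA.
  by rewrite ler_wpM2l ?normc_ge0.
have cw : 0 <= B * nc (0 +i* (lam * xi 0 i)) by rewrite mulr_ge0 ?normc_ge0.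
have {}HF : cint (leb n) (fun s => pderive i phi (row s) * echar lam xi (row s) +
    phi (row s) * ((0 +i* (lam * xi 0 i)) * echar lam xi (row s))) = 0.
  apply: HF; [|move=> x|move=> x|move=> x].
  - by apply: ccontM; [exact: (smooth_ccont [::] sphi.1)|exact: ccont_echar].
  - by apply: cderM; [exact: (smooth_cder [::] _ _ sphi.1)|exact: cder_echar].
  - by apply: le_trans (b1 x) _; rewrite ler_wpM2r ?(ltW (jbV_gt0 _ _))// lerDl addr_ge0.
  - apply: le_trans (le_normcD _ _) _.
    apply: le_trans (lerD (b2 x) (b3 x)) _.
    by rewrite -mulrDl ler_wpM2r ?(ltW (jbV_gt0 _ _))// lerDr.
have i1 := hat_cintegrable xi s'.
have i2 := hat_cintegrable xi sphi.
rewrite -cintZ//; apply/eqP; rewrite -addr_eq0 addrC -cintD//; last exact: cintegrableZ.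
by rewrite -HF; apply/eqP; congr cint; apply/funext => s; rewrite [in RHS]mulrCA.
Qed.

Lemma hat_bound phi : schwartz phi -> exists B, 0 <= B /\ forall xi, nc (hat phi xi) <= B.
Proof.
move=> sphi; exists (\int[leb n]_s nc (phi (row s))); split.
  by apply: Rintegral_ge0 => s _; exact: normc_ge0.
move=> xi; apply: normc_cint_le; first exact: hat_cintegrable.
  exact/cintegrable_norm/schwartz_cintegrable.
by move=> s; rewrite Normc.normcM normc_echar mulr1.
Qed.

Lemma hat_ibpX phi xi i k : schwartz phi ->
  schwartz (iter k (pderive i) phi) /\
  `|lam * xi 0 i| ^+ k * nc (hat phi xi) = nc (hat (iter k (pderive i) phi) xi).
Proof.
move=> sphi; elim: k => [|k [sk IH]]; first by rewrite expr0 mul1r.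
rewrite iterS; split; first exact: schwartz_pderive.
rewrite -[RHS]normcN -hat_ibp// (Normc.normcM (0 +i* _)).
rewrite -IH exprS mulrA; congr (_ * _ * _).
by rewrite normcE /= expr0n add0r sqrtr_sqr.
Qed.

(** Integration by parts k times in the coordinate where the sup norm of xi is attained controls
    |xi|^k. *)
Lemma hat_decay phi k : schwartz phi ->
  exists B, 0 <= B /\ forall xi, nc (hat phi xi) <= B * jb xi ^- k.
Proof.
move=> sphi; have [B0 [B00 HB0]] := hat_bound sphi.
have /choice [Bi HBi] : forall i, exists B, 0 <= B /\
    forall xi, nc (hat (iter k (pderive i) phi) xi) <= B.
  by move=> i; apply: hat_bound; have [] := hat_ibpX 0 i k sphi.
have lk : 0 < `|lam| ^+ k by rewrite exprn_gt0// normr_gt0.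
pose S := \sum_i Bi i.
have S0 : 0 <= S by apply: sumr_ge0 => i _; have [] := HBi i.
exists (2 ^+ k * (B0 + (B0 + S / `|lam| ^+ k))); split.
  by rewrite mulr_ge0 ?exprn_ge0// !addr_ge0// divr_ge0// ltW.
move=> xi; rewrite ler_pdivlMr ?jbX_gt0// mulrC.
apply: le_trans (ler_wpM2r (normc_ge0 _) (jbX_split _ _)) _.
rewrite -mulrA ler_wpM2l ?exprn_ge0// mulrDl mul1r lerD//.
have [x0|[j xj]] := rV_norm_attained xi.
  have S1 : 0 <= S / `|lam| ^+ k by rewrite divr_ge0// ltW.
  apply: (@le_trans _ _ (nc (hat phi xi))); last by rewrite (le_trans (HB0 _))// lerDl.
  by rewrite x0 ler_piMl ?normc_ge0// expr0n; case: (k == 0)%N.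
apply: (@le_trans _ _ (S / `|lam| ^+ k)); last by rewrite lerDr.
rewrite xj ler_pdivlMr// mulrAC -exprMn -normrM [xi 0 j * _]mulrC.
have [_ ->] := hat_ibpX xi j k sphi.
apply: le_trans (proj2 (HBi j) xi) _.
by rewrite /S (bigD1 j)//= lerDl sumr_ge0// => i _; have [] := HBi i.
Qed.

End FourierDecay.

(** * Gaussian wave packet coefficients of a test function *)

Section WavePackets.
Context {R : realType} {n : nat}.
Local Notation V := 'rV[R]_n.
Local Notation C := (R[i]).
Local Notation T := (n.-tuple (measurableTypeR R)).
Local Notation row := (@row_of_tuple R n).
Variable lam : R.
Hypothesis lam_neq0 : lam != 0.
Variable phi : V -> C.
Hypothesis sphi : schwartz phi.
Implicit Types (a xi w : V) (mu kap : 'I_n -> R).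

Let mc := @measurable_coord R n.
Let mc1 := @measurable_coord1 R n.
Let mc2 := @measurable_coord2 R n.

(** The amplitude of the overview without its chirp: a short-time transform of [phi] with window
    [rgauss mu], the analogue of [hat] localised near a. *)
Definition packet mu a xi : C :=
  cint (leb n) (fun s => phi (row s) * echar lam xi (row s) * rgauss mu (row s - a)).

Lemma packet_cintegrable mu a xi : (forall j, 0 < mu j) ->
  cintegrable (leb n) (fun s => phi (row s) * echar lam xi (row s) * rgauss mu (row s - a)).
Proof.
move=> m0.
have [B [B0 HB]] := schwartz_decay (2 * n) sphi.
have [D [D0 HD]] := rgauss_decay 0 m0.
apply: (cintegrable_decay (F := fun x => phi x * echar lam xi x * rgauss mu (x - a)) (B := B * D)).
  apply: cmfunM; first by apply: cmfunM; [exact: schwartz_cmfun|exact: cmfun_echar].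
  by apply: cmfun_rgauss; exact: measurable_rowB.
move=> x; rewrite Normc.normcM [nc (phi _ * _)]Normc.normcM normc_echar mulr1 mulrAC.
by rewrite ler_pM ?normc_ge0// (le_trans (HD _))// expr0 invr1 mulr1.
Qed.

(** The window is expanded into characters by [rgauss_fourier]; after exchanging the integrals, the
    inner one is [hat] at a shifted frequency. *)
Lemma packet_fourier mu a xi : (forall j, 0 < mu j) ->
  (rmass (fun j => lam ^+ 2 / mu j))%:C * packet mu a xi =
  cint (leb n) (fun s => rgauss (fun j => lam ^+ 2 / mu j) (row s) *
    echar lam (- a) (row s) * hat lam phi (xi + row s)).
Proof.
move=> m0; set gam := fun j => lam ^+ 2 / mu j.
have g0 j : 0 < gam j by rewrite divr_gt0// exprn_even_gt0.
pose F (z e : T) := (phi (row z) * echar lam xi (row z)) *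
  (rgauss gam (row e) * echar lam (row z - a) (row e)).
have [B [B0 HB]] := schwartz_decay (2 * n) sphi.
have [B' [B'0 HB']] := rgauss_decay (2 * n) g0.
have mF : cmfun (fun p : T * T => F p.1 p.2).
  apply: cmfunM; apply: cmfunM.
  - exact: schwartz_cmfun.
  - exact: cmfun_echar.
  - exact: cmfun_rgauss.
  - by apply: cmfun_echar => //; exact: measurable_rowB.
have iF : cintegrable (leb n \x leb n)%E (fun p => F p.1 p.2).
  apply: (@cintegrable_prod_jb _ _ _ (B * B')) => // z e /=.
  rewrite /F Normc.normcM [nc (phi _ * _)]Normc.normcM [nc (rgauss _ _ * _)]Normc.normcM.
  by rewrite !normc_echar !mulr1 -mulrA mulrACA ler_pM ?normc_ge0.
rewrite -cintZ; last exact: packet_cintegrable.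
transitivity (cint (leb n) (fun z => cint (leb n) (F z))).
  congr cint; apply/funext => z; rewrite mulrCA -rgauss_fourier// -cintZ//.
  apply: (cintegrable_le (q := fun s => nc (rgauss gam (row s)))).
  - by apply: cmfunM; [exact: cmfun_rgauss|apply: cmfun_echar => // i; exact: measurable_cst].
  - exact/cintegrable_norm/rgauss_cintegrable.
  - by move=> s; rewrite Normc.normcM normc_echar mulr1.
rewrite (cfubini iF); congr cint; apply/funext => e.
rewrite -cintZ; last exact: hat_cintegrable.
congr cint; apply/funext => z; rewrite /F.
have -> : echar lam (row z - a) (row e) = echar lam (- a) (row e) * echar lam (row e) (row z).
  by rewrite [echar lam (row e) _]echarC /echar -cisD -mulrDr -dotDl [- a + _]addrC.
have -> : echar lam (xi + row e) (row z) = echar lam xi (row z) * echar lam (row e) (row z).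
  by rewrite /echar dotDl mulrDr cisD.
ring.
Qed.

(* Decay in the position is immediate; decay in the frequency is read off
   [packet_fourier].  The geometric mean of both bounds gives joint decay. *)
Lemma packet_decay mu k l : (forall j, 0 < mu j) -> exists B, 0 <= B /\
  forall a xi, nc (packet mu a xi) <= B * jb a ^- k * jb xi ^- l.
Proof.
move=> m0.
pose I := \int[leb n]_s jb (row s) ^- (2 * n).
have I0 : 0 <= I by apply: Rintegral_ge0 => s _; exact: ltW (jbV_gt0 _ _).
have [B1 [B10 H1]] : exists B, 0 <= B /\ forall a xi, nc (packet mu a xi) <= B * jb a ^- (2 * k).
  have [B [B0 HB]] := schwartz_decay (2 * k + 2 * n) sphi.
  have [D [D0 HD]] := rgauss_decay (2 * k) m0.
  exists (B * D * I); split; first by rewrite !mulr_ge0.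
  move=> a xi; rewrite mulrAC -/(Rintegral _ _ _) -RintegralZl//; last exact: rintegrable_jbV.
  apply: normc_cint_le; first exact: packet_cintegrable.
    by apply: rintegrableZ; exact: rintegrable_jbV.
  move=> s; rewrite Normc.normcM [nc (phi _ * _)]Normc.normcM normc_echar mulr1.
  apply: le_trans (ler_pM (normc_ge0 _) (normc_ge0 _) (HB _) (HD _)) _.
  rewrite mulrACA -[leRHS]mulrA ler_wpM2l ?mulr_ge0// [leRHS]mulrC.
  by have := jb_peetre (- a) (row s) (2 * k) (2 * n); rewrite jbN [- a + _]addrC.
have [B2 [B20 H2]] : exists B, 0 <= B /\ forall a xi, nc (packet mu a xi) <= B * jb xi ^- (2 * l).
  set gam := fun j => lam ^+ 2 / mu j.
  have g0 j : 0 < gam j by rewrite divr_gt0// exprn_even_gt0.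
  have [B [B0 HB]] := hat_decay lam_neq0 (2 * l) sphi.
  have [D [D0 HD]] := rgauss_decay (2 * l + 2 * n) g0.
  have r0 := rmass_gt0 g0.
  exists (D * B * I / rmass gam); split; first by rewrite !mulr_ge0// invr_ge0 ltW.
  move=> a xi; rewrite mulrAC ler_pdivlMr// mulrC.
  have -> : rmass gam * nc (packet mu a xi) = nc ((rmass gam)%:C * packet mu a xi).
    by rewrite Normc.normcM normc_real gtr0_norm.
  rewrite packet_fourier// -/gam mulrAC -RintegralZl//; last exact: rintegrable_jbV.
  have bnd s : nc (rgauss gam (row s) * echar lam (- a) (row s) * hat lam phi (xi + row s)) <=
      D * B * jb xi ^- (2 * l) * jb (row s) ^- (2 * n).
    rewrite Normc.normcM [nc (rgauss _ _ * _)]Normc.normcM normc_echar mulr1.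
    apply: le_trans (ler_pM (normc_ge0 _) (normc_ge0 _) (HD _) (HB _)) _.
    rewrite mulrACA -[leRHS]mulrA ler_wpM2l ?mulr_ge0// [leRHS]mulrC.
    exact: jb_peetre.
  have ij : rintegrable (leb n) (fun s => D * B * jb xi ^- (2 * l) * jb (row s) ^- (2 * n)).
    by apply: rintegrableZ; exact: rintegrable_jbV.
  apply: normc_cint_le => //; apply: cintegrable_le ij bnd.
  apply: cmfunM; first by apply: cmfunM; [exact: cmfun_rgauss|apply: cmfun_echar => // i; exact: measurable_cst].
  by apply: cmfun_hat => //; apply: measurable_rowD => // i; exact: measurable_cst.
exists (Num.sqrt (B1 * B2)); split; first exact: sqrtr_ge0.
move=> a xi; rewrite -[leLHS]ger0_norm ?normc_ge0// -sqrtr_sqr.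
have -> : Num.sqrt (B1 * B2) * jb a ^- k * jb xi ^- l =
    Num.sqrt ((B1 * jb a ^- (2 * k)) * (B2 * jb xi ^- (2 * l))).
  have -> : (B1 * jb a ^- (2 * k)) * (B2 * jb xi ^- (2 * l)) = (B1 * B2) * (jb a ^- k * jb xi ^- l) ^+ 2.
    by rewrite -!exprVn exprMn -!exprM ![(2 * _)%N]mulnC mulrACA.
  rewrite [RHS]sqrtrM ?mulr_ge0// sqrtr_sqr ger0_norm ?mulrA//.
  by rewrite mulr_ge0 ?(ltW (jbV_gt0 _ _)).
by rewrite ler_wsqrtr// expr2 ler_pM ?normc_ge0.
Qed.

Lemma cmfun_packet mu d (U : measurableType d) (p r : U -> V) : (forall j, 0 < mu j) ->
  (forall i, measurable_fun setT (fun t => p t 0 i)) ->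
  (forall i, measurable_fun setT (fun t => r t 0 i)) ->
  cmfun (fun t => packet mu (p t) (r t)).
Proof.
move=> m0 mp mr.
apply: (@cmfun_cint _ _ _ U T (leb n) (fun q => phi (row q.2) * echar lam (r q.1) (row q.2) *
  rgauss mu (row q.2 - p q.1))).
have m2 i : measurable_fun setT (fun q : U * T => row q.2 0 i).
  by apply: (measurableT_comp (measurable_coord i)).
have mp1 i : measurable_fun setT (fun q : U * T => p q.1 0 i) by apply: (measurableT_comp (mp i)).
have mr1 i : measurable_fun setT (fun q : U * T => r q.1 0 i) by apply: (measurableT_comp (mr i)).
apply: cmfunM; first by apply: cmfunM; [exact: schwartz_cmfun|exact: cmfun_echar].
by apply: cmfun_rgauss; exact: measurable_rowB.
Qed.

End WavePackets.

(** * Synthesis of the propagated test function from atoms *)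

Section Synthesis.
Context {R : realType} {n : nat}.
Local Notation V := 'rV[R]_n.
Local Notation C := (R[i]).
Local Notation T := (n.-tuple (measurableTypeR R)).
Local Notation row := (@row_of_tuple R n).
Variables (lam t : R) (mu kap : 'I_n -> R).
Hypothesis lam_neq0 : lam != 0.
Hypothesis mu_gt0 : forall j, 0 < mu j.
Hypothesis kap_gt0 : forall j, 0 < kap j.
Variable phi : V -> C.
Hypothesis sphi : schwartz phi.
Implicit Types (a xi w b y : V).

Let mc := @measurable_coord R n.
Let mc1 := @measurable_coord1 R n.
Let mc2 := @measurable_coord2 R n.

Lemma gatom_rgauss x xi y :
  gatom kap lam (row_mx x xi) y = rgauss kap (y - x) * echar lam (- xi) y.
Proof.
rewrite gatomE rgaussE /echar dotNl mulrN; congr ((expR (- _))%:C * _).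
by apply: eq_bigr => j _; rewrite !mxE.
Qed.

(** Coefficient of the convolution of the packet window [mu] with the Gaussian [kap] of the atoms,
    see [rgauss_conv]. *)
Definition nu j : R := mu j * kap j / (mu j + kap j).

Lemma nu_gt0 j : 0 < nu j.
Proof. by rewrite divr_gt0 ?mulr_gt0 ?addr_gt0. Qed.

(** Integrating out the centres of the packets convolves the packet window with the Gaussian of the
    atoms; parity and a translation by b bring the inner integral to [rgauss_conv]. *)
Lemma packet_conv b xi :
  cint (leb n) (fun s => packet lam phi mu (row s) xi * rgauss kap (b - row s)) =
  (rmass (fun j => mu j + kap j))%:C * packet lam phi nu b xi.
Proof.
pose F (s z : T) := phi (row z) * echar lam xi (row z) * rgauss mu (row z - row s) * rgauss kap (b - row s).
have mF : cmfun (fun p : T * T => F p.1 p.2).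
  apply: cmfunM; first apply: cmfunM; first apply: cmfunM.
  - exact: schwartz_cmfun.
  - by apply: cmfun_echar => // i; exact: measurable_cst.
  - by apply: cmfun_rgauss; exact: measurable_rowB.
  - by apply: cmfun_rgauss; apply: measurable_rowB => // i; exact: measurable_cst.
have iF : cintegrable (leb n \x leb n)%E (fun p => F p.1 p.2).
  have [B [B0 HB]] := schwartz_decay (2 * n + 2 * n) sphi.
  have [D [D0 HD]] := rgauss_decay (2 * n) mu_gt0.
  have [D' [D'0 HD']] := rgauss_decay 0 kap_gt0.
  apply: (@cintegrable_prod_jb _ _ _ (B * D * D')) => // s z /=.
  rewrite /F Normc.normcM [nc (_ * _ * _)]Normc.normcM [nc (phi _ * _)]Normc.normcM normc_echar mulr1.
  have g1 : nc (rgauss kap (b - row s)) <= D' by apply: le_trans (HD' _) _; rewrite expr0 invr1 mulr1.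
  apply: le_trans (ler_pM _ (normc_ge0 _) (ler_pM (normc_ge0 _) (normc_ge0 _) (HB _) (HD _)) g1) _.
    by rewrite mulr_ge0 ?normc_ge0.
  rewrite -[leRHS]mulrA [leRHS]mulrAC ler_wpM2r// mulrACA ler_wpM2l ?mulr_ge0// [leRHS]mulrC.
  have := jb_peetre (- row s) (row z) (2 * n) (2 * n); by rewrite jbN [- _ + _]addrC.
transitivity (cint (leb n) (fun s => cint (leb n) (F s))).
  congr cint; apply/funext => s; rewrite mulrC -cintZ; last exact: packet_cintegrable.
  by congr cint; apply/funext => z; rewrite mulrC.
rewrite (cfubini iF) -cintZ; last by apply: packet_cintegrable => // j; exact: nu_gt0.
congr cint; apply/funext => z; rewrite mulrCA -rgauss_conv// -cintZ; last first.
  have [D [D0 HD]] := rgauss_decay 0 mu_gt0.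
  apply: (cintegrable_le (q := fun s => D * nc (rgauss kap (row s)))).
  - apply: cmfunM; last exact: cmfun_rgauss.
    by apply: cmfun_rgauss; apply: measurable_rowB => // i; exact: measurable_cst.
  - by apply: rintegrableZ; exact/cintegrable_norm/rgauss_cintegrable.
  - move=> s; rewrite Normc.normcM ler_wpM2r ?normc_ge0// (le_trans (HD _))// expr0 invr1 mulr1 //.
rewrite -(cint_shift b (F := fun x => phi (row z) * echar lam xi (row z) * rgauss mu (row z - x) * rgauss kap (b - x))).
  congr cint; apply/funext => s; rewrite mulrA; congr (_ * rgauss mu _ * _).
    by rewrite opprD addrA addrAC.
  by rewrite opprD addrCA subrr addr0 rgaussN.
apply: cmfunM; last by apply: cmfun_rgauss; apply: measurable_rowB => // i; exact: measurable_cst.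
apply: cmfunM; first exact: cmfun_cst.
by apply: cmfun_rgauss; apply: measurable_rowB => // i; exact: measurable_cst.
Qed.

Definition chirp (c : R) xi : C := cis (c * dot xi xi).

Lemma normc_chirp c xi : nc (chirp c xi) = 1.
Proof. exact: normc_cis. Qed.

Lemma cmfun_chirp c d (U : measurableType d) (r : U -> V) :
  (forall i, measurable_fun setT (fun u => r u 0 i)) -> cmfun (fun u => chirp c (r u)).
Proof. by move=> mr; apply: cmfun_cis; apply: measurable_funM => //; exact: measurable_dot. Qed.

Definition sgam j : R := lam ^+ 2 / nu j.

Lemma sgam_gt0 j : 0 < sgam j.
Proof. by rewrite divr_gt0 ?nu_gt0// exprn_even_gt0. Qed.

(* The translation [xi -> xi - eta] turns the propagation of the packets into a
   chirp in [eta] alone. *)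
Lemma packet_propagation y :
  (rmass sgam)%:C * cint (leb n) (fun s => chirp (- (lam * t / 2)) (row s) * echar lam (- row s) y *
     packet lam phi nu (y + t *: row s) (row s)) =
  cint (leb n) (fun s => rgauss sgam (row s) * chirp (lam * t / 2) (row s)) *
  cint (leb n) (fun s => chirp (- (lam * t / 2)) (row s) * echar lam (- row s) y * hat lam phi (row s)).
Proof.
pose G x := chirp (- (lam * t / 2)) x * echar lam (- x) y * hat lam phi x.
pose F (s e : T) := chirp (- (lam * t / 2)) (row s) * echar lam (- row s) y *
  (rgauss sgam (row e) * echar lam (- (y + t *: row s)) (row e) * hat lam phi (row s + row e)).
have mF : cmfun (fun p : T * T => F p.1 p.2).
  apply: cmfunM; first apply: cmfunM.
  - exact: cmfun_chirp.
  - by apply: cmfun_echar; [exact: measurable_rowN|exact: measurable_row_cst].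
  apply: cmfunM; first apply: cmfunM.
  - exact: cmfun_rgauss.
  - apply: cmfun_echar => //; apply: measurable_rowN; apply: measurable_rowD.
      exact: measurable_row_cst.
    exact: measurable_rowZ.
  - by apply: cmfun_hat => //; exact: measurable_rowD.
have [B [B0 HB]] := hat_decay lam_neq0 (2 * n) sphi.
have iF : cintegrable (leb n \x leb n)%E (fun p => F p.1 p.2).
  have [D [D0 HD]] := rgauss_decay (2 * n + 2 * n) sgam_gt0.
  apply: (@cintegrable_prod_jb _ _ _ (D * B)) => // s e /=.
  rewrite /F Normc.normcM [nc (chirp _ _ * _)]Normc.normcM [nc (_ * hat _ _ _)]Normc.normcM.
  rewrite [nc (rgauss _ _ * _)]Normc.normcM normc_chirp !normc_echar !mul1r mulr1.
  apply: le_trans (ler_pM (normc_ge0 _) (normc_ge0 _) (HD _) (HB _)) _.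
  rewrite mulrACA -[leRHS]mulrA ler_wpM2l ?mulr_ge0// [leRHS]mulrC; exact: jb_peetre.
have mG : cmfun (fun s => G (row s)).
  apply: cmfunM; last exact: cmfun_hat.
  by apply: cmfunM; [exact: cmfun_chirp|apply: cmfun_echar; [exact: measurable_rowN|exact: measurable_row_cst]].
have iG : cintegrable (leb n) (fun s => G (row s)).
  apply: (cintegrable_decay (B := B)) => // x.
  by rewrite Normc.normcM [nc (chirp _ _ * _)]Normc.normcM normc_chirp normc_echar !mul1r.
have inner x xi : cintegrable (leb n) (fun e => rgauss sgam (row e) * echar lam x (row e) * hat lam phi (xi + row e)).
  apply: (cintegrable_le (q := fun e => B * nc (rgauss sgam (row e)))).
  - apply: cmfunM; first apply: cmfunM.
    + exact: cmfun_rgauss.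
    + by apply: cmfun_echar => //; exact: measurable_row_cst.
    + by apply: cmfun_hat => //; apply: measurable_rowD => //; exact: measurable_row_cst.
  - by apply: rintegrableZ; apply: cintegrable_norm; apply: rgauss_cintegrable => j; exact: sgam_gt0.
  - move=> e; rewrite Normc.normcM [nc (rgauss _ _ * _)]Normc.normcM normc_echar mulr1 mulrC.
    by rewrite ler_wpM2r ?normc_ge0// (le_trans (HB _))// ler_piMr ?jbV_le1.
transitivity (cint (leb n) (fun s => cint (leb n) (F s))).
  have nu0 := nu_gt0.
  have [D [D0 HD]] := packet_decay lam_neq0 sphi 0 (2 * n) nu0.
  rewrite -cintZ; last first.
    apply: (cintegrable_decay (F := fun x => chirp (- (lam * t / 2)) x * echar lam (- x) y *
      packet lam phi nu (y + t *: x) x) (B := D)).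
      apply: cmfunM; last first.
        by apply: cmfun_packet => //; apply: measurable_rowD; [exact: measurable_row_cst|exact: measurable_rowZ].
      apply: cmfunM; first exact: cmfun_chirp.
      by apply: cmfun_echar; [exact: measurable_rowN|exact: measurable_row_cst].
    move=> x; rewrite Normc.normcM [nc (chirp _ _ * _)]Normc.normcM normc_chirp normc_echar !mul1r.
    by apply: le_trans (HD _ _) _; rewrite expr0 invr1 mulr1.
  congr cint; apply/funext => s; rewrite mulrCA (packet_fourier lam_neq0 sphi _ _ nu0) -cintZ; last exact: inner.
  by [].
rewrite (cfubini iF).
transitivity (cint (leb n) (fun e => cint (leb n) (fun s => G (row s)) *
    (rgauss sgam (row e) * chirp (lam * t / 2) (row e)))); last first.
  rewrite [RHS]mulrC; apply: cintZ.
  apply: (cintegrable_le (q := fun e => nc (rgauss sgam (row e)))).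
  - by apply: cmfunM; [exact: cmfun_rgauss|exact: cmfun_chirp].
  - by apply: cintegrable_norm; apply: rgauss_cintegrable => j; exact: sgam_gt0.
  - by move=> e; rewrite Normc.normcM normc_chirp mulr1.
congr cint; apply/funext => e; rewrite mulrC.
pose H x := rgauss sgam (row e) * chirp (lam * t / 2) (row e) * G x.
have mH : cmfun (fun s => H (row s)) by apply: cmfunM => //; exact: cmfun_cst.
transitivity (cint (leb n) (fun s => H (row s))); last exact: cintZ.
transitivity (cint (leb n) (fun s => H (row s + row e))); last exact: cint_shift.
congr cint; apply/funext => s; rewrite /F /H /G.
(* The displacement t xi of the packet centre supplies exactly the cross term in the square of xi +
   eta. *)
have ph : chirp (- (lam * t / 2)) (row s) * echar lam (- row s) y * echar lam (- (y + t *: row s)) (row e) =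
    chirp (lam * t / 2) (row e) * (chirp (- (lam * t / 2)) (row s + row e) * echar lam (- (row s + row e)) y).
  rewrite /chirp /echar -!cisD; congr cis.
  by rewrite !(dotNl, dotDl, dotDr, dotZl) (dotC (row e) (row s)) (dotC (row e) y); field.
transitivity (rgauss sgam (row e) * hat lam phi (row s + row e) * (chirp (- (lam * t / 2)) (row s) *
    echar lam (- row s) y * echar lam (- (y + t *: row s)) (row e))); first by ring.
by rewrite ph; ring.
Qed.

(** Parameter of the atom attached to (a, xi): the centre is carried back by time t along the free
    trajectory of velocity xi. *)
Definition rho (p : T * T) : 'rV[R]_(n + n) := row_mx (row p.1 - t *: row p.2) (row p.2).

Definition amp (p : T * T) : C :=
  chirp (- (lam * t / 2)) (row p.2) * packet lam phi mu (row p.1) (row p.2).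

Lemma measurable_rho i : measurable_fun setT (fun p => rho p 0 i).
Proof.
rewrite /rho -(splitK i) /unsplit; case: (fintype.split i) => j.
  under eq_fun do rewrite row_mxEl.
  by apply: measurable_rowB => //; exact: measurable_rowZ.
under eq_fun do rewrite row_mxEr.
exact: mc2.
Qed.

Lemma cmfun_amp : cmfun amp.
Proof. by apply: cmfunM; [exact: cmfun_chirp|exact: cmfun_packet]. Qed.

Lemma jb_rho p : jb (rho p) <= (1 + `|t|) * (jb (row p.1) * jb (row p.2) ^+ 2).
Proof.
have h1 : jb (rho p) <= jb (row p.1 - t *: row p.2) * jb (row p.2).
  rewrite {1}/jb; apply: le_trans (lerD (lexx _) (row_mx_norm_le _ _)) _.
  have := normr_ge0 (row p.1 - t *: row p.2); have := normr_ge0 (row p.2).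
  by rewrite /jb => *; nra.
have h2 : jb (t *: row p.2) <= (1 + `|t|) * jb (row p.2).
  rewrite /jb mx_normZ; have := normr_ge0 t; have := normr_ge0 (row p.2).
  by move=> *; nra.
apply: le_trans h1 _.
apply: le_trans (ler_wpM2r (ltW (jb_gt0 _)) (jbD _ _)) _; rewrite jbN.
apply: le_trans (ler_wpM2r (ltW (jb_gt0 _)) (ler_wpM2l (ltW (jb_gt0 _)) h2)) _.
by rewrite expr2 mulrCA !mulrA.
Qed.

Lemma amp_rintegrable k :
  rintegrable (leb n \x leb n)%E (fun p => nc (amp p) * jb (rho p) ^+ k).
Proof.
(* By [jb_rho] the weight costs k powers in position and 2k in frequency; the remaining 2n in each
   variable make the product integrable. *)
have [B [B0 HB]] := packet_decay lam_neq0 sphi (k + 2 * n) (2 * k + 2 * n) mu_gt0.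
have mrho : measurable_fun setT (fun p => jb (rho p) ^+ k).
  apply: measurable_funX; apply: measurable_funD; first exact: measurable_cst.
  apply: (measurable_continuous_rV (F := fun x : 'rV[R]_(n + n) => `|x|)).
    exact: measurable_rho.
  exact: norm_continuous.
have mf : measurable_fun setT (fun p => nc (amp p) * jb (rho p) ^+ k).
  by apply: measurable_funM => //; exact: (measurable_normc cmfun_amp).
have [] // : cintegrable (leb n \x leb n)%E (fun p => (nc (amp p) * jb (rho p) ^+ k)%:C).
apply: (@cintegrable_prod_jb _ _ _ (B * (1 + `|t|) ^+ k)); first exact: cmfun_real.
move=> s e; rewrite normc_real ger0_norm; last first.
  by rewrite mulr_ge0 ?normc_ge0// exprn_ge0// (ltW (jb_gt0 _)).
have h : jb (rho (s, e)) ^+ k <= (1 + `|t|) ^+ k * (jb (row s) ^+ k * jb (row e) ^+ (2 * k)).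
  rewrite exprM -!exprMn.
  apply: lerXn2r; rewrite ?nnegrE ?(ltW (jb_gt0 _)) ?mulr_ge0 ?addr_ge0 ?exprn_ge0 ?(ltW (jb_gt0 _))//.
  exact: (jb_rho (s, e)).
rewrite /amp Normc.normcM normc_chirp mul1r.
apply: le_trans (ler_pM (normc_ge0 _) (exprn_ge0 _ (ltW (jb_gt0 _))) (HB _ _) h) _.
rewrite (jbV_split _ k (2 * n)) (jbV_split _ (2 * k) (2 * n)) le_eqVlt; apply/orP; left; apply/eqP; rewrite /=.
have := jbVK (row s) k; have := jbVK (row e) (2 * k).
set a := jb (row s) ^- k; set b := jb (row s) ^+ k; set c := jb (row e) ^- (2 * k); set d := jb (row e) ^+ (2 * k).
move=> cd ab; transitivity (B * (1 + `|t|) ^+ k * jb (row s) ^- (2 * n) * jb (row e) ^- (2 * n) * (b * a) * (d * c)).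
  by ring.
by rewrite ab cd !mulr1.
Qed.

(** Integrating first over positions turns packets of window [mu] into packets of window [nu] by
    [packet_conv]; integrating over frequencies is then [packet_propagation]. The last factor is the
    unnormalised F (m F^-1 phi), and no division has been performed yet. *)
Lemma synthesis y :
  (rmass sgam)%:C * superpos (leb n \x leb n)%E rho amp (gatom kap lam) y =
  (rmass (fun j => mu j + kap j))%:C *
  cint (leb n) (fun s => rgauss sgam (row s) * chirp (lam * t / 2) (row s)) *
  cint (leb n) (fun s => chirp (- (lam * t / 2)) (row s) * echar lam (- row s) y * hat lam phi (row s)).
Proof.
have iS := tame_cintegrable measurable_rho cmfun_amp amp_rintegrable (gatom_tame lam kap_gt0) [::] y.
rewrite /superpos -(cfubini2 iS).
have nu0 := nu_gt0.
have [D [D0 HD]] := packet_decay lam_neq0 sphi 0 (2 * n) nu0.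
pose K x := chirp (- (lam * t / 2)) x * echar lam (- x) y * packet lam phi nu (y + t *: x) x.
have iK : cintegrable (leb n) (fun s => K (row s)).
  apply: (cintegrable_decay (B := D)).
    apply: cmfunM; last first.
      by apply: cmfun_packet => //; apply: measurable_rowD; [exact: measurable_row_cst|exact: measurable_rowZ].
    apply: cmfunM; first exact: cmfun_chirp.
    by apply: cmfun_echar; [exact: measurable_rowN|exact: measurable_row_cst].
  move=> x; rewrite Normc.normcM [nc (chirp _ _ * _)]Normc.normcM normc_echar normc_chirp !mul1r.
  by apply: le_trans (HD _ _) _; rewrite expr0 invr1 mulr1.
transitivity ((rmass sgam)%:C * cint (leb n) (fun s => (rmass (fun j => mu j + kap j))%:C * K (row s))).
  congr (_ * cint _ _); apply/funext => e /=; rewrite /K mulrCA -packet_conv//.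
  have [D' [D'0 HD']] := rgauss_decay (2 * n) kap_gt0.
  have [D2 [D20 HD2]] := packet_decay lam_neq0 sphi (2 * n) 0 mu_gt0.
  have [D3 [D30 HD3]] := rgauss_decay 0 kap_gt0.
  rewrite -cintZ; last first.
    apply: (cintegrable_decay (F := fun x => packet lam phi mu x (row e) * rgauss kap (y + t *: row e - x)) (B := D2 * D3)).
      apply: cmfunM; first by apply: cmfun_packet => //; exact: measurable_row_cst.
      by apply: cmfun_rgauss; apply: measurable_rowB => //; exact: measurable_row_cst.
    move=> x; rewrite Normc.normcM mulrAC; apply: ler_pM; rewrite ?normc_ge0//.
      by apply: le_trans (HD2 _ _) _; rewrite expr0 invr1 mulr1.
    by apply: le_trans (HD3 _) _; rewrite expr0 invr1 mulr1.
  congr cint; apply/funext => s; rewrite /amp /rho /= gatom_rgauss.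
  rewrite opprB addrA [y + t *: row e - row s]addrAC [y - row s + t *: row e]addrAC.
  by ring.
by rewrite cintZ// mulrCA packet_propagation mulrA.
Qed.

End Synthesis.

(** * Measurability of a supremum over all positions *)

Section SliceSupremum.
Context {R : realType} {m n : nat}.
Variable H : 'rV[R]_(m + n) -> R.
Hypothesis cH : continuous H.

Definition slice_sup (xi : 'rV[R]_n) : \bar R :=
  ereal_sup (range (fun x : 'rV[R]_m => (H (row_mx x xi))%:E)).

(** One sequence through the lattices of all meshes 1 / (k+1). Numbers that encode nothing give the
    point 0, which is harmless because it belongs to the range of the supremum. *)
Definition grid_point (j : nat) : 'rV[R]_m :=
  if (unpickle j : option (nat * 'rV[int]_m)) is Some (k, v)
  then \row_i ((v 0 i)%:~R / k.+1%:R) else 0.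

Lemma cvg_grid_row (x : 'rV[R]_m) (xi : 'rV[R]_n) :
  (fun k => H (row_mx (grid k x) xi)) @ \oo --> H (row_mx x xi).
Proof.
apply: (@cvg_comp _ _ _ (fun k => row_mx (grid k x) xi) H _ _ _ _ (@cH (row_mx x xi))).
apply/cvgrPdist_le => e e0.
near=> k; rewrite opp_row_mx add_row_mx subrr.
apply: le_trans (row_mx_norm_le _ _) _; rewrite normr0 addr0.
rewrite distrC (le_trans (grid_dist _ _))// invf_ple ?posrE//; near: k.
have [N HN] : exists N : nat, e^-1 <= N%:R.
  by exists (Num.truncn e^-1).+1; rewrite ltW// truncnS_gt.
exists N => // l /= Nl; rewrite (le_trans HN)// ler_nat; exact: leqW.
Unshelve. all: by end_near.
Qed.

(** Continuity of [H] allows x to be replaced by its roundings, so an uncountable supremum becomes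
    that of a sequence, which is measurable in xi. *)
Lemma slice_supE xi : slice_sup xi = esups (fun j => (H (row_mx (grid_point j) xi))%:E) 0%N.
Proof.
apply/eqP; rewrite eq_le; apply/andP; split; last first.
  by apply: ge_ereal_sup => _ [j _ <-]; apply: ereal_sup_ubound; exists (grid_point j).
apply: ge_ereal_sup => _ [x _ <-].
have up k : ((H (row_mx (grid k x) xi))%:E <= esups (fun j => (H (row_mx (grid_point j) xi))%:E) 0%N)%E.
  apply: ereal_sup_ubound; exists (pickle (k, \row_i Num.floor (k.+1%:R * x 0 i))) => //.
  by rewrite /grid_point pickleK; congr (H (row_mx _ _))%:E; apply/rowP => i; rewrite !mxE.
move: up; case: (esups _ _) => [r| |] up; rewrite ?leey//.
  rewrite lee_fin; apply: cvgr_to_le (@cvg_grid_row x xi) _.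
  by apply: nearW => k; rewrite -lee_fin.
by have := up 0%N; rewrite leeNy_eq.
Qed.

Lemma measurable_slice_sup :
  measurable_fun setT (fun s : n.-tuple (measurableTypeR R) => slice_sup (row_of_tuple s)).
Proof.
under eq_fun do rewrite slice_supE.
apply: measurable_fun_esups => j; apply/measurable_EFinP.
apply: (measurable_continuous_rV (F := H)) => // i.
rewrite -(splitK i) /unsplit; case: (fintype.split i) => l.
  by under eq_fun do rewrite row_mxEl; exact: measurable_cst.
by under eq_fun do rewrite row_mxEr; exact: measurable_coord.
Qed.

End SliceSupremum.

Section LebesgueProduct.
Context {R : realType}.
Local Notation mR := (measurableTypeR R).

(* The product measure with itself is only declared sigma-finite in the library
   when it is finite, whence this alias. *)
Definition leb2 n : set (n.-tuple mR * n.-tuple mR)%type -> \bar R := (leb n \x leb n)%E.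
Arguments leb2 : clear implicits.

HB.instance Definition _ k := Measure.copy (leb2 k) (leb k \x leb k)%E.

Lemma leb2_sigma_finite n : sigma_finite setT (leb2 n).
Proof.
have /sigma_finiteP[F [TF ndF Foo]] := leb_sigma_finite (R := R) n.
exists (fun k => F k `*` F k).
  rewrite -setXTT TF predeqE => -[x y]; split.
    move=> [/= [i _ Fix] [j _ Fjy]]; exists (maxn i j) => //; split.
    - by move: x Fix; exact/subsetPset/ndF/leq_maxl.
    - by move: y Fjy; exact/subsetPset/ndF/leq_maxr.
  by move=> [i _ []/= ? ?]; split; exists i.
move=> i; have [? ?] := Foo i.
split; first exact: measurableX.
by rewrite /leb2 product_measure1E// lte_mul_pinfty// ge0_fin_numE.
Qed.

HB.instance Definition _ k := @Measure_isSigmaFinite.Build _ _ _ (leb2 k) (leb2_sigma_finite k).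

End LebesgueProduct.
Arguments leb2 {R} n.

Lemma cmfun_comp (R : realType) d1 d2 (T1 : measurableType d1) (T2 : measurableType d2)
    (f : T2 -> R[i]) (g : T1 -> T2) :
  cmfun f -> measurable_fun setT g -> cmfun (fun x => f (g x)).
Proof. by move=> [f1 f2] mg; split; [exact: (measurableT_comp f1)|exact: (measurableT_comp f2)]. Qed.

(** * The function that represents the propagated distribution *)

Section Pairing.
Context {R : realType} {n : nat}.
Local Notation V := 'rV[R]_n.
Local Notation C := (R[i]).
Local Notation T := (n.-tuple (measurableTypeR R)).
Local Notation row := (@row_of_tuple R n).
Variables (lam t : R) (mu : 'I_n -> R).
Hypothesis mu_gt0 : forall j, 0 < mu j.
Variables (W : T * T -> C) (w : T -> R).
Hypothesis mW : cmfun W.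
Hypothesis iw : rintegrable (leb n) w.
Hypothesis W_le : forall s e, nc (W (s, e)) <= w e.

Let mc := @measurable_coord R n.
Let mc1 := @measurable_coord1 R n.
Let mc2 := @measurable_coord2 R n.

Let w0 e : 0 <= w e.
Proof. exact: le_trans (normc_ge0 _) (@W_le [tuple 0 | i < n] e). Qed.

Lemma rintegrable_prod (f g : T -> R) : rintegrable (leb n) f -> rintegrable (leb n) g ->
  (forall s, 0 <= f s) -> (forall s, 0 <= g s) ->
  rintegrable (leb2 n) (fun p => f p.1 * g p.2).
Proof.
move=> if_ ig f0 g0.
have [] // : cintegrable (leb2 n) (fun p => (f p.1 * g p.2)%:C).
apply: (@cintegrable_prod_le _ _ _ _ _ (leb n) (leb n) _ f g) => //.
  apply: cmfun_real; apply: measurable_funM.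
    by apply: (measurableT_comp (rintegrable_measurable if_)).
  by apply: (measurableT_comp (rintegrable_measurable ig)).
by move=> s e; rewrite normc_real ger0_norm// mulr_ge0.
Qed.

Definition kernel_rep (z : V) : C := cint (leb2 n) (fun p =>
  chirp (- (lam * t / 2)) (row p.2) * echar lam (row p.2) z * rgauss mu (z - row p.1) * W p).

Lemma rgauss_integral a : \int[leb n]_s nc (rgauss mu (a - row s)) = rmass mu /\
  rintegrable (leb n) (fun s => nc (rgauss mu (a - row s))).
Proof.
have E : (fun s => nc (rgauss mu (a - row s))) = fun s => nc (rgauss mu (row s + (- a))).
  by apply/funext => s; rewrite -rgaussN opprB.
have i0 := cintegrable_norm (rgauss_cintegrable mu_gt0).
rewrite E; split; last exact: (rintegrable_shift (F := fun x => nc (rgauss mu x))).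
rewrite (Rint_shift (F := fun x => nc (rgauss mu x)) (- a)); last exact: (rintegrable_measurable i0).
rewrite /rmass; have [_ <-] := gauss_integral_rV mu_gt0; congr Rintegral; apply/funext => s.
by rewrite rgaussE normc_real ger0_norm// expR_ge0.
Qed.

Lemma kernel_rep_integrand_le z s e :
  nc (chirp (- (lam * t / 2)) (row e) * echar lam (row e) z * rgauss mu (z - row s) * W (s, e)) <=
  nc (rgauss mu (z - row s)) * w e.
Proof.
rewrite Normc.normcM [nc (_ * _ * _)]Normc.normcM [nc (chirp _ _ * _)]Normc.normcM.
by rewrite normc_chirp normc_echar !mul1r ler_wpM2l ?normc_ge0.
Qed.

Lemma cmfun_kernel_rep_integrand d (U : measurableType d) (z : U -> V) (r : U -> T * T) :
  (forall i, measurable_fun setT (fun u => z u 0 i)) -> measurable_fun setT r ->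
  cmfun (fun u => chirp (- (lam * t / 2)) (row (r u).2) *
    echar lam (row (r u).2) (z u) * rgauss mu (z u - row (r u).1) * W (r u)).
Proof.
move=> mz mr.
have m1 i : measurable_fun setT (fun u => row (r u).1 0 i).
  by have := @measurable_comp _ _ _ _ _ _ _ _ _ _ measurableT (@subsetT _ _) (mc1 i) mr.
have m2 i : measurable_fun setT (fun u => row (r u).2 0 i).
  by have := @measurable_comp _ _ _ _ _ _ _ _ _ _ measurableT (@subsetT _ _) (mc2 i) mr.
apply: cmfunM; first apply: cmfunM; first apply: cmfunM.
- exact: cmfun_chirp.
- exact: cmfun_echar.
- by apply: cmfun_rgauss; exact: measurable_rowB.
- exact: cmfun_comp.
Qed.

Lemma cmfun_kernel_rep : cmfun (fun s => kernel_rep (row s)).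
Proof.
have H := @cmfun_cint _ _ _ _ _ (leb2 n) (fun p : T * (T * T) => chirp (- (lam * t / 2)) (row p.2.2) *
  echar lam (row p.2.2) (row p.1) * rgauss mu (row p.1 - row p.2.1) * W p.2).
apply: H; apply: cmfun_kernel_rep_integrand => // i.
by apply: (measurableT_comp (mc i)).
Qed.

(** Chirp and character have modulus 1. A bound on [W] uniform in position leaves the mass of the
    Gaussian for the position integral and the integral of [w] for the frequency integral, which is
    where a norm of type sup in x, integral in xi enters. *)
Lemma kernel_rep_bound z : nc (kernel_rep z) <= rmass mu * \int[leb n]_s w s.
Proof.
have [E ig] := rgauss_integral z.
have iq := rintegrable_prod ig iw (fun s => normc_ge0 _) w0.
have -> : rmass mu * \int[leb n]_s w s = \int[(leb2 n)]_p (nc (rgauss mu (z - row p.1)) * w p.2).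
  rewrite -(Rfubini2 iq).2 -RintegralZl//; congr Rintegral; apply/funext => e /=.
  by rewrite RintegralZr// E.
apply: normc_cint_le => //; last by move=> [s e]; exact: kernel_rep_integrand_le.
apply: cintegrable_le iq _; last by move=> [s e]; exact: kernel_rep_integrand_le.
exact: (@cmfun_kernel_rep_integrand _ _ (fun=> z) id (measurable_row_cst z)).
Qed.

Variable phi : V -> C.
Hypothesis sphi : schwartz phi.

(** Fubini takes the variable of [phi] outermost. Since [W] need not decay in position,
    integrability there comes from the Gaussian, with part of the decay of [phi] paying for the
    translation. *)
Lemma kernel_rep_pairing :
  cint (leb2 n) (fun p => amp lam t mu phi p * W p) =
  cint (leb n) (fun s => kernel_rep (row s) * phi (row s)).
Proof.
pose F (z : T) (p : T * T) := phi (row z) * (chirp (- (lam * t / 2)) (row p.2) *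
    echar lam (row p.2) (row z) * rgauss mu (row z - row p.1) * W p).
have [B [B0 HB]] := schwartz_decay (2 * n + 2 * n) sphi.
have [D [D0 HD]] := rgauss_decay (2 * n) mu_gt0.
have mF : cmfun (fun p : T * (T * T) => F p.1 p.2).
  have m1 i : measurable_fun setT (fun p : T * (T * T) => row p.1 0 i) by apply: (measurableT_comp (mc i)).
  by apply: cmfunM; [exact: schwartz_cmfun|exact: cmfun_kernel_rep_integrand].
have iq := rintegrable_prod (rintegrable_jbV (leqnn (2 * n))) iw (fun s => ltW (jbV_gt0 _ _)) w0.
have iF : cintegrable (leb n \x leb2 n)%E (fun p => F p.1 p.2).
  apply: (@cintegrable_prod_le _ _ _ _ _ (leb n) (leb2 n) (fun p => F p.1 p.2)
    (fun z => B * D * jb (row z) ^- (2 * n)) (fun p => jb (row p.1) ^- (2 * n) * w p.2)) => //=.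
  - by apply: rintegrableZ; exact: rintegrable_jbV.
  - by move=> z; rewrite !mulr_ge0// ltW// jbV_gt0.
  - by move=> p; rewrite mulr_ge0// ltW// jbV_gt0.
  - move=> z [s e]; rewrite /F Normc.normcM.
    apply: le_trans (ler_wpM2l (normc_ge0 _) (kernel_rep_integrand_le _ _ _)) _.
    rewrite mulrA [leRHS]mulrA ler_wpM2r//.
    apply: le_trans (ler_pM (normc_ge0 _) (normc_ge0 _) (HB _) (HD _)) _.
    rewrite mulrACA -[leRHS]mulrA ler_wpM2l ?mulr_ge0//.
    by have := jb_peetre (- row s) (row z) (2 * n) (2 * n); rewrite jbN [- _ + _]addrC.
transitivity (cint (leb2 n) (fun p => cint (leb n) (fun z => F z p))).
  congr cint; apply/funext => p; rewrite /amp mulrAC /packet -cintZ; last exact: packet_cintegrable.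
  by congr cint; apply/funext => z; rewrite /F; ring.
rewrite -(cfubini iF); congr cint; apply/funext => z.
rewrite mulrC -cintZ//; have [E ig] := rgauss_integral (row z).
have iz := rintegrable_prod ig iw (fun s => normc_ge0 _) w0.
apply: cintegrable_le iz _; last by move=> [s e]; exact: kernel_rep_integrand_le.
exact: (@cmfun_kernel_rep_integrand _ _ (fun=> row z) id (measurable_row_cst (row z))).
Qed.

End Pairing.

Lemma cint_ae (R : realType) d (T : measurableType d) (m : {measure set T -> \bar R}) (f g : T -> R[i]) :
  cmfun f -> cmfun g -> {ae m, forall x, f x = g x} -> cint m f = cint m g.
Proof.
move=> [f1 f2] [g1 g2] fg; rewrite /cint /Rintegral.
congr ((fine _) +i* (fine _)); apply: ae_eq_integral => //; try exact/measurable_EFinP;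
  by apply: filterS fg => x fgx _; rewrite /= fgx.
Qed.

(** * The short-time Fourier transform as a pairing with atoms *)

Section ShortTimeFourier.
Context {R : realType} {n : nat}.
Local Notation V := 'rV[R]_n.
Local Notation C := (R[i]).
Local Notation T := (n.-tuple (measurableTypeR R)).
Local Notation row := (@row_of_tuple R n).
Variables (hbar : R) (q : V).
Hypothesis hbar_gt0 : 0 < hbar.
Hypothesis q_gt0 : forall j, 0 < q 0 j.
Local Notation lam := (hbar^-1).

Definition window_coef (j : 'I_n) : R := q 0 j / hbar.
Definition fcst : R := (2 * pi * hbar) `^ (- (n%:R / 2)).

Lemma fcst_gt0 : 0 < fcst.
Proof. by rewrite powR_gt0// !mulr_gt0// pi_gt0. Qed.

Lemma window_coef_gt0 j : 0 < window_coef j.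
Proof. by rewrite divr_gt0. Qed.

Lemma gauss_windowE v : gauss_window hbar (diag_mx q) v = fcst%:C * rgauss window_coef v.
Proof.
rewrite rgaussE -rmorphM; congr (_ * expR _)%:C; congr (- _).
rewrite dotE mulr_sumr; apply: eq_bigr => j _; rewrite mul_mx_diag mxE /window_coef.
by field; rewrite gt_eqF.
Qed.

Variable u : @functional R n.
Hypothesis tu : tempered u.

Definition stft_profile (s : 'rV[R]_(n + n)) : R :=
  nc ((fcst ^+ 2)%:C * u (gatom window_coef lam s)).

(** One [fcst] is that of the Fourier transform and the other normalises the window; the conjugation
    disappears because the Gaussian is real. *)
Lemma stftE x xi : stft hbar (gauss_window hbar (diag_mx q)) u x xi =
  (fcst ^+ 2)%:C * u (gatom window_coef lam (row_mx x xi)).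
Proof.
rewrite /stft /fourier_at /mul_dist /fourier_cst -/fcst expr2 rmorphM -mulrA; congr (_ * _).
rewrite -temperedZ//; last exact: (gatom_schwartz _ window_coef_gt0).
congr u; apply/funext => y; rewrite gauss_windowE gatom_rgauss rgaussE -rmorphM.
rewrite /echar dotNl mulrN [lam * _]mulrC rmorphM mulrA; congr (_ * _).
apply: complex_eqP; rewrite ?Re_conj ?Im_conj //=.
by rewrite !mulr0 !mul0r addr0 oppr0.
Qed.

Lemma Minfty1_normE : Minfty1_norm hbar (gauss_window hbar (diag_mx q)) u =
  (\int[leb n]_s slice_sup stft_profile (row s))%E.
Proof.
apply: eq_integral => s _; congr ereal_sup; congr image; apply/funext => x.
by rewrite stftE.
Qed.

(** The regularity part of [tempered_superpos], extracted with amplitude 0. *)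
Lemma ccont_gatom : ccont (fun s => u (gatom window_coef lam s)) /\
  exists B k, 0 <= B /\ forall s, nc (u (gatom window_coef lam s)) <= B * jb s ^+ k.
Proof.
have mrho i : measurable_fun setT (fun _ : T * T => (0 : 'rV[R]_(n + n)) 0 i) by exact: measurable_cst.
have iA k : rintegrable (leb2 n) (fun p : T * T => nc (0 : C) * jb (0 : 'rV[R]_(n + n)) ^+ k).
  rewrite normc_real normr0 mul0r; exact: integrable0.
by have [? []] := tempered_superpos mrho (cmfun_cst 0) iA (gatom_tame lam window_coef_gt0) tu.
Qed.

Lemma stft_profile_cont : continuous stft_profile.
Proof.
have [[c1 c2] _] := ccont_gatom.
rewrite /stft_profile; under eq_fun do rewrite Normc.normcM.
apply: rcontM; first exact: rcont_cst.
under eq_fun do rewrite normcE.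
apply: (rcont_comp (h := Num.sqrt)); first by move=> x; exact: sqrt_continuous.
by apply: rcontD; apply: rcontM.
Qed.

Section FiniteNorm.
Hypothesis finite_norm : (Minfty1_norm hbar (gauss_window hbar (diag_mx q)) u < +oo)%E.
Local Notation M := (fun s : T => slice_sup stft_profile (row s)).

Let M0 s : (0 <= M s)%E.
Proof. by apply: ereal_sup_ge; exists (stft_profile (row_mx 0 (row s)))%:E; [exists 0|rewrite lee_fin normc_ge0]. Qed.

Let mM : measurable_fun setT M.
Proof. exact: (measurable_slice_sup stft_profile_cont). Qed.

(* The supremum may be infinite on a null set, hence the truncation. *)
Definition stft_sup (s : T) : R := fine (M s).

Lemma stft_sup_integrable : rintegrable (leb n) stft_sup /\
  \int[leb n]_s stft_sup s <= fine (Minfty1_norm hbar (gauss_window hbar (diag_mx q)) u).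
Proof.
have m1 : measurable_fun setT stft_sup by exact: (measurableT_comp (fine_measurable measurableT) mM).
have p0 s : 0 <= stft_sup s by exact: fine_ge0.
have le : (\int[leb n]_s (stft_sup s)%:E <= Minfty1_norm hbar (gauss_window hbar (diag_mx q)) u)%E.
  rewrite Minfty1_normE; apply: ge0_le_integral => // [s _|| s _]; rewrite ?lee_fin//.
    exact/measurable_EFinP.
  by rewrite /stft_sup; case: (M s) (M0 s) => [r| |] //=; rewrite ?leey.
split.
  apply/integrableP; split; first exact/measurable_EFinP.
  apply: le_lt_trans finite_norm; apply: le_trans le; rewrite le_eqVlt; apply/orP; left; apply/eqP.
  by apply: eq_integral => s _; rewrite /= ger0_norm.
rewrite /Rintegral fine_le//.
  by rewrite ge0_fin_numE ?integral_ge0//; [exact: le_lt_trans le _|move=> s _; rewrite lee_fin].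
by rewrite ge0_fin_numE// Minfty1_normE integral_ge0.
Qed.

(** Where the supremum is infinite, [fine] sends it to 0; setting the function to 0 there as well
    makes [stft_sup] a majorant everywhere. *)
Definition stft_trunc t (p : T * T) : C :=
  if (M p.2 < +oo)%E then (fcst ^+ 2)%:C * u (gatom window_coef lam (rho t p)) else 0.

Lemma cmfun_gatom_rho t : cmfun (fun p => u (gatom window_coef lam (rho t p))).
Proof.
have [[c1 c2] _] := ccont_gatom.
by apply: (cmfun_continuous_rV (F := fun s => u (gatom window_coef lam s))) => //; exact: measurable_rho.
Qed.

Lemma cmfun_stft_trunc t : cmfun (stft_trunc t).
Proof.
have mb : measurable_fun setT (fun p : T * T => (M p.2 < +oo)%E).
  apply: measurable_fun_lte; last exact: measurable_cst.
  by apply: (measurableT_comp mM).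
have [m1 m2] := cmfunM (cmfun_cst (fcst ^+ 2)%:C) (cmfun_gatom_rho t).
have E (g : C -> R) : g 0 = 0 -> (fun p => g (stft_trunc t p)) = fun p =>
    if (M p.2 < +oo)%E then g ((fcst ^+ 2)%:C * u (gatom window_coef lam (rho t p))) else 0.
  by move=> g0; apply/funext => p; rewrite /stft_trunc; case: ifP.
by split; rewrite E//; apply: measurable_fun_ifT => //; exact: measurable_cst.
Qed.

Lemma stft_trunc_le t s e : nc (stft_trunc t (s, e)) <= stft_sup e.
Proof.
rewrite /stft_trunc /stft_sup /=; case: ifPn => [fin|_]; last by rewrite normc_real normr0 fine_ge0.
rewrite -lee_fin fineK; last by rewrite ge0_fin_numE.
by apply: ereal_sup_ubound; exists (row s - t *: row e).
Qed.

Lemma stft_sup_ae : {ae leb n, forall e, (M e < +oo)%E}.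
Proof.
have : (leb n).-integrable setT M.
  apply/integrableP; split => //.
  by apply: le_lt_trans finite_norm; rewrite Minfty1_normE le_eqVlt; apply/orP; left; apply/eqP;
    apply: eq_integral => s _; rewrite gee0_abs.
by move/integrable_ae => /(_ measurableT); apply: filterS => e /(_ I); rewrite ge0_fin_numE.
Qed.

(** The truncation affects only a null set of frequencies. With the frequency integral outermost,
    the inner integrals agree for almost every frequency. *)
Lemma cint_stft_trunc t mu phi : (forall j, 0 < mu j) -> schwartz phi ->
  cint (leb2 n) (fun p => amp lam t mu phi p * ((fcst ^+ 2)%:C * u (gatom window_coef lam (rho t p)))) =
  cint (leb2 n) (fun p => amp lam t mu phi p * stft_trunc t p).
Proof.
move=> m0 sphi; have l0 : lam != 0 by rewrite invr_neq0// gt_eqF.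
have ma := cmfun_amp lam t m0 sphi.
have [B [k [B0 HB]]] : exists B k, 0 <= B /\ forall s, nc ((fcst ^+ 2)%:C * u (gatom window_coef lam s)) <= B * jb s ^+ k.
  have [_ [B [k [B0 HB]]]] := ccont_gatom.
  exists (fcst ^+ 2 * B), k; split; first by rewrite mulr_ge0// sqr_ge0.
  by move=> s; rewrite Normc.normcM normc_real ger0_norm ?sqr_ge0// -[leRHS]mulrA ler_wpM2l ?sqr_ge0.
have iq := rintegrableZ B (amp_rintegrable t l0 m0 sphi k).
have i1 : cintegrable (leb2 n) (fun p => amp lam t mu phi p * ((fcst ^+ 2)%:C * u (gatom window_coef lam (rho t p)))).
  apply: cintegrable_le iq _.
    by apply: cmfunM => //; apply: cmfunM; [exact: cmfun_cst|exact: cmfun_gatom_rho].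
  by move=> p; rewrite Normc.normcM mulrCA ler_wpM2l ?normc_ge0.
have i2 : cintegrable (leb2 n) (fun p => amp lam t mu phi p * stft_trunc t p).
  apply: cintegrable_le iq _; first by apply: cmfunM => //; exact: cmfun_stft_trunc.
  move=> p; rewrite Normc.normcM mulrCA ler_wpM2l ?normc_ge0// /stft_trunc.
  by case: ifP => // _; rewrite normc_real normr0 mulr_ge0// exprn_ge0// ltW// jb_gt0.
rewrite -(cfubini2 i1) -(cfubini2 i2); apply: cint_ae.
- exact/cintegrable_cmfun/(cintegrable_fubini2 i1).
- exact/cintegrable_cmfun/(cintegrable_fubini2 i2).
- apply: filterS stft_sup_ae => e fin /=.
  by congr cint; apply/funext => s; rewrite /stft_trunc fin.
Qed.

End FiniteNorm.

End ShortTimeFourier.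

(** * The upper bound for fixed alpha *)

Section UpperBound.
Context {R : realType} {n : nat}.
Local Notation V := 'rV[R]_n.
Local Notation C := (R[i]).
Local Notation T := (n.-tuple (measurableTypeR R)).
Local Notation row := (@row_of_tuple R n).
Variables (hbar t : R) (q : V).
Hypothesis hbar_gt0 : 0 < hbar.
Hypothesis q_gt0 : forall j, 0 < q 0 j.
Local Notation lam := (hbar^-1).
Local Notation fc := (@fcst R n hbar).

Lemma Lnorm_infty_le (h : V -> C) (B : R) : 0 <= B -> (forall x, nc (h x) <= B) ->
  (Lnorm (lebesgue_Rn n) +oo (fun s => (nc (h (row s)))%:E) <= B%:E)%E.
Proof.
(* The second branch is the convention that the norm is 0 when the whole space has measure 0. *)
move=> B0 hB; rewrite unlock /=; case: ifP => _; last by rewrite lee_fin.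
by apply/ess_supP; apply: nearW => s /=; rewrite lee_fin ger0_norm ?normc_ge0.
Qed.

(** Duality moves all operations onto the test function, and the two Fourier constants are collected
    in front. *)
Lemma propagatorE (u : @functional R n) phi : schwartz phi ->
  propagator hbar t u phi = u (fun y => (fc ^+ 2)%:C *
    cint (leb n) (fun s => chirp (- (lam * t / 2)) (row s) * echar lam (- row s) y * hat lam phi (row s))).
Proof.
move=> sphi; have l0 : lam != 0 by rewrite invr_neq0// gt_eqF.
rewrite /propagator /ifourier_dist /mul_dist /fourier_dist; congr u; apply/funext => y.
have iH : cintegrable (leb n) (fun s => chirp (- (lam * t / 2)) (row s) * echar lam (- row s) y * hat lam phi (row s)).
  have [B [B0 HB]] := hat_decay l0 (2 * n) sphi.
  have mc := @measurable_coord R n.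
  apply: (cintegrable_decay (F := fun x => chirp (- (lam * t / 2)) x * echar lam (- x) y * hat lam phi x) (B := B)).
    apply: cmfunM; last exact: cmfun_hat.
    apply: cmfunM; first exact: cmfun_chirp.
    by apply: cmfun_echar; [exact: measurable_rowN|exact: measurable_row_cst].
  by move=> x; rewrite Normc.normcM [nc (chirp _ _ * _)]Normc.normcM normc_chirp normc_echar !mul1r.
rewrite /fourier /fourier_cst -/(fcst hbar) expr2 rmorphM -[RHS]mulrA; congr (_ * _).
rewrite -cintZ//; congr cint; apply/funext => s.
have -> : ifourier hbar phi (row s) = fc%:C * hat lam phi (row s).
  by congr (_ * _); congr cint; apply/funext => z; rewrite mulrC /echar [lam * _]mulrC dotC.
have -> : cis (- (dot y (row s) / hbar)) = echar lam (- row s) y.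
  by rewrite /echar dotNl mulrN dotC [lam * _]mulrC.
have -> : cis (- (t / (2 * hbar) * dot (row s) (row s))) = chirp (- (lam * t / 2)) (row s).
  by rewrite /chirp; congr cis; field; rewrite gt_eqF.
by ring.
Qed.

(** This integral is the only place where t enters the constant: the chirp adds an imaginary part to
    the coefficient of the Gaussian. *)
Lemma window_chirp_integral (mu kap : 'I_n -> R) : (forall j, 0 < mu j) -> (forall j, 0 < kap j) ->
  nc (cint (leb n) (fun s => rgauss (sgam lam mu kap) (row s) * chirp (lam * t / 2) (row s))) =
  \prod_j Num.sqrt (2 * pi / nc (sgam lam mu kap j +i* (- (lam * t)))).
Proof.
move=> m0 k0; have l0 : lam != 0 by rewrite invr_neq0// gt_eqF.
have := @normc_qint R n (fun j => sgam lam mu kap j +i* (- (lam * t))) (fun=> 0).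
rewrite [X in _ * expR X]big1 ?expR0 ?mulr1; last by move=> j _; rewrite expr0n mul0r.
move=> <-; last by move=> j; exact: sgam_gt0.
congr nc; congr cint; apply/funext => s.
rewrite rgaussE -cexp_real /chirp cis_cexp -cexpD; congr cexp.
have h2 (c : C) : c / 2 = c * (2^-1 : R)%:C by rewrite fmorphV rmorph_nat.
rewrite dotE; apply: complex_eqP; rewrite ?Re_qpoly /=.
  by rewrite addr0 -sumrN; apply: eq_bigr => j _; rewrite mul0r addr0.
rewrite /qpoly Im_sum add0r mulr_sumr; apply: eq_bigr => j _; rewrite h2 /=.
by field; rewrite gt_eqF.
Qed.

Variable u : @functional R n.
Hypothesis tu : tempered u.
Local Notation N := (Minfty1_norm hbar (gauss_window hbar (diag_mx q)) u).

Lemma propagator_upper_alpha (alpha : R) : 0 < alpha -> (N < +oo)%E ->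
  (Linfty_norm (propagator hbar t u) <=
   ((\prod_j Num.sqrt (nc ((1 + alpha * q 0 j) +i* (- (t * q 0 j))))) * fine N)%:E)%E.
Proof.
move=> a0 finN; have l0 : lam != 0 by rewrite invr_neq0// gt_eqF.
have lp : 0 < lam by rewrite invr_gt0.
(* The Gaussian Gamma of the overview, with variance hbar alpha in every direction. *)
pose mu (j : 'I_n) := lam / alpha.
have m0 j : 0 < mu j by rewrite divr_gt0.
pose kap := window_coef hbar q.
have k0 j : 0 < kap j by exact: window_coef_gt0.
pose W := stft_trunc hbar q u t.
have mW : cmfun W by exact: cmfun_stft_trunc.
have [iw wN] := stft_sup_integrable hbar_gt0 q_gt0 tu finN.
have Ww s e : nc (W (s, e)) <= stft_sup hbar q u e by exact: stft_trunc_le.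
set g := sgam lam mu kap.
have g0 j : 0 < g j by exact: sgam_gt0.
pose rs := rmass g; pose rk := rmass (fun j => mu j + kap j).
have rs0 : 0 < rs by exact: rmass_gt0.
have rk0 : 0 < rk by apply: rmass_gt0 => j; rewrite addr_gt0.
pose D0 := cint (leb n) (fun s => rgauss g (row s) * chirp (lam * t / 2) (row s)).
(* The prefactor inverts the constant of [synthesis]. The two Fourier constants are already inside
   [W], because the short-time transform carries the same [fcst ^+ 2]. *)
pose h z := rs%:C / (rk%:C * D0) * kernel_rep lam t mu W z.
have nD0 := window_chirp_integral m0 k0.
have gz0 j : 0 < nc (g j +i* (- (lam * t))) by apply: lt_le_trans (g0 j) (Re_le_normc (g j +i* _)).
have D0p : 0 < nc D0.
  rewrite nD0; apply: prodr_gt0 => j _; rewrite sqrtr_gt0 divr_gt0//.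
  by rewrite mulr_gt0// pi_gt0.
have D00 : D0 != 0 by rewrite -normc_gt0.
have rkC : rk%:C != 0 :> C by rewrite -normc_gt0 normc_real normr_gt0 gt_eqF.
have rsC : rs%:C != 0 :> C by rewrite -normc_gt0 normc_real normr_gt0 gt_eqF.
have hB z : nc (h z) <= rs / (rk * nc D0) * (rmass mu * fine N).
  rewrite Normc.normcM; apply: ler_pM; rewrite ?normc_ge0//.
    rewrite Normc.normcM Normc.normcV Normc.normcM !normc_real !ger0_norm// ltW//.
  apply: le_trans (kernel_rep_bound lam t m0 mW iw Ww z) _.
  by rewrite ler_wpM2l// ltW// rmass_gt0.
(* hbar and the factors 2 pi cancel in each coordinate, which leaves the modulus of 1 + alpha q_j -
   i t q_j. *)
have K : rs / (rk * nc D0) * (rmass mu * fine N) =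
    (\prod_j Num.sqrt (nc ((1 + alpha * q 0 j) +i* (- (t * q 0 j))))) * fine N.
  rewrite mulrA; congr (_ * _).
  have Ej j : Num.sqrt (nc ((1 + alpha * q 0 j) +i* (- (t * q 0 j)))) =
      Num.sqrt (2 * pi / g j) * (Num.sqrt (2 * pi / (mu j + kap j)) *
        Num.sqrt (2 * pi / nc (g j +i* (- (lam * t)))))^-1 * Num.sqrt (2 * pi / mu j).
    have pp : 0 < 2 * (pi : R) by rewrite mulr_gt0// pi_gt0.
    have s0 : 0 < mu j + kap j by rewrite addr_gt0.
    have qj := q_gt0 j; have gj := g0 j; have mj := m0 j.
    (* Reciprocals of coefficients add under convolution: g = lam^2 (1 / mu + 1 / kap). *)
    have Eg : g j = lam / q 0 j * (1 + alpha * q 0 j).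
      by rewrite /g /sgam /nu /mu /kap /window_coef; field; rewrite !gt_eqF//= addr_gt0// mulr_gt0.
    have Ez : g j +i* (- (lam * t)) = (lam / q 0 j)%:C * ((1 + alpha * q 0 j) +i* (- (t * q 0 j))).
      rewrite Eg; apply: complex_eqP; rewrite /= ?mul0r ?subr0 ?addr0//.
      by field; rewrite !gt_eqF.
    have nz := gz0 j; move: nz.
    have -> : nc (g j +i* (- (lam * t))) = lam / q 0 j * nc ((1 + alpha * q 0 j) +i* (- (t * q 0 j))).
      by rewrite Ez Normc.normcM normc_real gtr0_norm// divr_gt0.
    set w := nc _ => nz.
    have w0 : 0 < w by move: nz; rewrite pmulr_rgt0// divr_gt0.
    have p1 : 0 <= 2 * pi / (mu j + kap j) by rewrite divr_ge0// ltW.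
    have p2 : 0 <= 2 * pi / (lam / q 0 j * w) by rewrite divr_ge0// ltW.
    have p3 : 0 <= 2 * pi / g j by rewrite divr_ge0// ltW.
    have p4 : 0 <= 2 * pi / g j * (2 * pi / (mu j + kap j) * (2 * pi / (lam / q 0 j * w)))^-1.
      by rewrite divr_ge0// mulr_ge0.
    rewrite -(sqrtrM _ p1) -(sqrtrV (mulr_ge0 p1 p2)) -(sqrtrM _ p3) -(sqrtrM _ p4).
    congr Num.sqrt; rewrite Eg /mu /kap /window_coef; clear p1 p2 p3 p4; move: pp.
    move: (2 * pi : R) => P pp; field.
    by rewrite !gt_eqF//= addr_gt0// mulr_gt0.
  rewrite nD0 (eq_bigr _ (fun j _ => Ej j)) big_split big_split prodfV big_split; congr (_ / _ * _).
have rep : represents h (propagator hbar t u).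
  move=> phi sphi; rewrite propagatorE//.
  pose S := superpos (leb2 n) (rho t) (amp lam t mu phi) (gatom kap lam).
  have mrho := @measurable_rho R n t.
  have mA := cmfun_amp lam t m0 sphi.
  have iA := amp_rintegrable t l0 m0 sphi.
  have tG := gatom_tame lam k0.
  have sS : schwartz S by exact: (superpos_schwartz mrho mA iA tG).
  have -> : (fun y => (fc ^+ 2)%:C * cint (leb n) (fun s => chirp (- (lam * t / 2)) (row s) *
      echar lam (- row s) y * hat lam phi (row s))) =
      fun y => (fc ^+ 2)%:C * (rs%:C / (rk%:C * D0)) * S y.
    apply/funext => y; rewrite -[RHS]mulrA; congr (_ * _).
    have hy : rs%:C * S y = rk%:C * D0 * cint (leb n) (fun s => chirp (- (lam * t / 2)) (row s) *
      echar lam (- row s) y * hat lam phi (row s)) := synthesis t l0 m0 k0 sphi y.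
    by rewrite [RHS]mulrAC hy [RHS]mulrAC mulfV ?mul1r// mulf_neq0.
  rewrite temperedZ//.
  have [_ [[B [k [B0 HB]]] ->]] := tempered_superpos mrho mA iA tG tu.
  have iu : cintegrable (leb2 n) (fun p => amp lam t mu phi p * u (gatom kap lam (rho t p))).
    apply: (cintegrable_weight mA iA _ (fun p => HB (rho t p))).
    exact: cmfun_gatom_rho.
  rewrite mulrAC -cintZ//.
  transitivity (rs%:C / (rk%:C * D0) * cint (leb n) (fun s => kernel_rep lam t mu W (row s) * phi (row s))).
    rewrite mulrC; congr (_ * _); rewrite -(kernel_rep_pairing lam t m0 mW iw Ww sphi).
    rewrite -cint_stft_trunc//; congr cint; apply/funext => p; exact: mulrCA.
  have ik : cintegrable (leb n) (fun s => kernel_rep lam t mu W (row s) * phi (row s)).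
    apply: (cintegrable_le (q := fun s => rmass mu * (\int[leb n]_e stft_sup hbar q u e) * nc (phi (row s)))).
    - apply: cmfunM; first exact: cmfun_kernel_rep.
      by apply: schwartz_cmfun => // i; exact: measurable_coord.
    - by apply: rintegrableZ; exact/cintegrable_norm/schwartz_cintegrable.
    - by move=> s; rewrite Normc.normcM ler_wpM2r ?normc_ge0//; exact: (kernel_rep_bound lam t m0 mW iw Ww).
  by rewrite -cintZ//; congr cint; apply/funext => s; rewrite /h mulrA.
apply: le_trans (_ : (Lnorm (lebesgue_Rn n) +oo (fun s => (nc (h (row s)))%:E) <= _)%E).
  apply: ereal_inf_lbound; exists h; last by [].
  split; last exact: rep.
  exact: (cmfunM (cmfun_cst _) (cmfun_kernel_rep _ _ _ mW)).
apply: Lnorm_infty_le => [|z]; rewrite -K//; exact: le_trans (normc_ge0 _) (hB 0).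
Qed.

End UpperBound.

(** The passage to alpha = 0 for both bounds, whose errors are put in the form exp(alpha c). By
    exp(- a c) >= 1 - a c, it is enough that a c l be at most e, and the chosen [a] ensures this
    without dividing by c or l. *)
Lemma le_expR_limit (R : realType) (l y c : R) : 0 <= c -> 0 <= l ->
  (forall a, 0 < a -> l <= expR (a * c) * y) -> l <= y.
Proof.
move=> c0 l0 H; apply/ler_addgt0Pr => e e0.
pose a := e / ((c + 1) * (l + 1)).
have d0 : 0 < (c + 1) * (l + 1) by rewrite mulr_gt0// ltr_wpDl.
have a0 : 0 < a by rewrite divr_gt0.
have h1 : l * expR (- (a * c)) <= y.
  by rewrite expRN ler_pdivrMr ?expR_gt0// [leRHS]mulrC; exact: H.
have h2 : l * (1 - a * c) <= l * expR (- (a * c)) by rewrite ler_wpM2l// expR_ge1Dx.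
have h3 : a * ((c + 1) * (l + 1)) = e by rewrite mulfVK// gt_eqF.
have : a * c * l <= e by rewrite -h3; nra.
by move=> *; nra.
Qed.

(** * Comparison of the constants for alpha > 0 with the sharp one *)

Section Constant.
Context {R : realType} {n : nat}.
Variables (t : R) (q : 'rV[R]_n).
Hypothesis q_gt0 : forall j, 0 < q 0 j.

Definition sharp_cst : R := \prod_(j < n) (t ^+ 2 * (q 0 j) ^+ 2 + 1) `^ (1 / 4).

Lemma powR14 (a : R) : 0 <= a -> a `^ (1 / 4) = Num.sqrt (Num.sqrt a).
Proof.
move=> a0; rewrite -(powR12_sqrt a0) -powR12_sqrt ?powR_ge0// -powRrM.
by congr (a `^ _); field.
Qed.

Lemma sharp_factor_ge0 j : 0 <= t ^+ 2 * (q 0 j) ^+ 2 + 1.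
Proof. by rewrite addr_ge0// mulr_ge0 ?sqr_ge0. Qed.

Lemma sharp_cst_ge0 : 0 <= sharp_cst.
Proof. by apply: prodr_ge0 => j _; exact: powR_ge0. Qed.

Let w alpha j : R[i] := (1 + alpha * q 0 j) +i* (- (t * q 0 j)).

(** The modulus is bounded with a square (1 + alpha q)^2 so that the outer square root gives 1 +
    alpha q, which is at most exp(alpha q). *)
Lemma sharp_cst_upper (alpha : R) : 0 < alpha ->
  \prod_j Num.sqrt (nc (w alpha j)) <= expR (alpha * \sum_j q 0 j) * sharp_cst.
Proof.
move=> a0; rewrite mulr_sumr expR_sum -big_split /=; apply: ler_prod => j _.
rewrite sqrtr_ge0 /= powR14 ?sharp_factor_ge0//.
have qj := q_gt0 j; have aq : 0 < alpha * q 0 j by rewrite mulr_gt0.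
have h : nc (w alpha j) <= (1 + alpha * q 0 j) ^+ 2 * Num.sqrt (t ^+ 2 * q 0 j ^+ 2 + 1).
  have s1 : 1 <= (1 + alpha * q 0 j) ^+ 2 by nra.
  have p0 : 0 <= (1 + alpha * q 0 j) ^+ 2 * Num.sqrt (t ^+ 2 * q 0 j ^+ 2 + 1).
    by rewrite mulr_ge0 ?sqr_ge0 ?sqrtr_ge0.
  rewrite normcE -[leRHS](ger0_norm p0) -sqrtr_sqr.
  rewrite ler_wsqrtr// exprMn sqr_sqrtr ?sharp_factor_ge0//=.
  have := sharp_factor_ge0 j; move: s1; set A := (1 + _) ^+ 2.
  have -> : (- (t * q 0 j)) ^+ 2 = t ^+ 2 * q 0 j ^+ 2 by rewrite sqrrN exprMn.
  have : 0 <= t ^+ 2 * q 0 j ^+ 2 by rewrite mulr_ge0 ?sqr_ge0.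
  set B := t ^+ 2 * _ => b a _.
  have a2 : A <= A ^+ 2 by rewrite expr2 ler_peMr// (le_trans ler01).
  have := ler_wpM2r b (le_trans a a2); rewrite mul1r mulrDr mulr1 => h; lra.
apply: le_trans (ler_wsqrtr h) _; rewrite sqrtrM ?sqr_ge0// sqrtr_sqr ger0_norm; last by nra.
by rewrite ler_wpM2r ?sqrtr_ge0// expR_ge1Dx.
Qed.

(** The modulus of 1 + alpha q - i t q is at least that of 1 - i t q, and the denominator is at most
    the square of exp(alpha + alpha q), again a square because of the outer root. *)
Lemma sharp_cst_lower (alpha : R) : 0 < alpha ->
  sharp_cst <= expR (alpha * (n%:R + \sum_j q 0 j)) *
    \prod_j Num.sqrt (nc (w alpha j) / ((1 + alpha) * (1 + alpha * q 0 j))).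
Proof.
move=> a0.
have -> : expR (alpha * (n%:R + \sum_j q 0 j)) = \prod_(j < n) expR (alpha + alpha * q 0 j).
  rewrite -expR_sum; congr expR; rewrite big_split /= mulrDr sumr_const card_ord mulr_sumr.
  by rewrite mulr_natr.
rewrite -big_split /=; apply: ler_prod => j _; rewrite powR_ge0 /= powR14 ?sharp_factor_ge0//.
have qj := q_gt0 j; have aq : 0 < alpha * q 0 j by rewrite mulr_gt0.
have h : Num.sqrt (t ^+ 2 * q 0 j ^+ 2 + 1) <= nc (w alpha j).
  rewrite normcE ler_wsqrtr//= sqrrN exprMn addrC lerD2r.
  by nra.
have d0 : 0 < (1 + alpha) * (1 + alpha * q 0 j) by nra.
have e1 : (1 + alpha) * (1 + alpha * q 0 j) <= expR (alpha + alpha * q 0 j) ^+ 2.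
  rewrite expRD exprMn; apply: ler_pM; rewrite ?addr_ge0 ?(ltW a0) ?(ltW aq)//.
    have := expR_ge1Dx alpha; set E := expR _ => *; rewrite expr2; nra.
  have := expR_ge1Dx (alpha * q 0 j); set E := expR _ => *; rewrite expr2; nra.
rewrite -[expR _]ger0_norm ?expR_ge0// -sqrtr_sqr -sqrtrM ?sqr_ge0// ler_wsqrtr//.
apply: le_trans h _; rewrite mulrCA ler_peMr ?normc_ge0//.
by rewrite ler_pdivlMr// mul1r.
Qed.

End Constant.

Section UpperLimit.
Context {R : realType} {n : nat}.
Variables (hbar t : R) (q : 'rV[R]_n).
Hypothesis hbar_gt0 : 0 < hbar.
Hypothesis q_gt0 : forall j, 0 < q 0 j.
Variable u : @functional R n.
Hypothesis tu : tempered u.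
Local Notation N := (Minfty1_norm hbar (gauss_window hbar (diag_mx q)) u).
Local Notation L := (Linfty_norm (propagator hbar t u)).

Lemma Minfty1_norm_ge0 : (0 <= N)%E.
Proof.
apply: integral_ge0 => s _; apply: ereal_sup_ge.
by exists (nc (stft hbar (gauss_window hbar (diag_mx q)) u 0 (row_of_tuple s)))%:E;
  [exists 0|rewrite lee_fin normc_ge0].
Qed.

Lemma Linfty_norm_ge0 (v : @functional R n) : (0 <= Linfty_norm v)%E.
Proof. by apply: le_ereal_inf_tmp => _ [h _ <-]; exact: Lnorm_ge0. Qed.

(** The quotient follows the conventions of extended reals. If N = 0 its inverse is +oo, so L = 0
    has to be shown, and alpha = 1 suffices; if N = +oo the quotient is 0. In the remaining case L
    is finite and alpha tends to 0. *)
Lemma propagator_upper : (L / N <= (sharp_cst t q)%:E)%E.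
Proof.
have := Minfty1_norm_ge0; rewrite le_eqVlt => /orP[/eqP N0|].
  have finN : (N < +oo)%E by rewrite -N0.
  have := propagator_upper_alpha t hbar_gt0 q_gt0 tu ltr01 finN.
  rewrite -N0 /= mulr0 => L0; have -> : L = 0%E.
    by apply/eqP; rewrite eq_le L0 Linfty_norm_ge0.
  by rewrite mul0e lee_fin sharp_cst_ge0.
case: (ltP N +oo%E) => [finN N0|]; last first.
  by rewrite leye_eq => /eqP -> _; rewrite invey mule0 lee_fin sharp_cst_ge0.
have Nfin : N \is a fin_num by rewrite ge0_fin_numE// ltW.
have Np : 0 < fine N by rewrite fine_gt0// N0 finN.
have Lfin : L \is a fin_num.
  rewrite ge0_fin_numE ?Linfty_norm_ge0//.
  exact: le_lt_trans (propagator_upper_alpha t hbar_gt0 q_gt0 tu ltr01 finN) (ltry _).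
rewrite -(fineK Nfin) -(fineK Lfin) inver (gt_eqF Np) -EFinM lee_fin ler_pdivrMr//.
apply: (@le_expR_limit _ _ _ (\sum_j q 0 j)).
- by apply: sumr_ge0 => j _; exact: ltW.
- by rewrite fine_ge0// Linfty_norm_ge0.
move=> a a0; rewrite mulrA; apply: (@le_trans _ _ ((\prod_j Num.sqrt (nc ((1 + a * q 0 j) +i* (- (t * q 0 j))))) * fine N)).
  by rewrite -lee_fin fineK//; exact: propagator_upper_alpha.
by rewrite ler_wpM2r ?(ltW Np)//; exact: sharp_cst_upper.
Qed.

End UpperLimit.

(** * The lower bound *)

Section LowerBoundTools.
Context {R : realType} {n : nat}.
Local Notation V := 'rV[R]_n.
Local Notation C := (R[i]).
Local Notation T := (n.-tuple (measurableTypeR R)).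
Local Notation row := (@row_of_tuple R n).

Lemma rgauss_schwartz (kap : 'I_n -> R) : (forall j, 0 < kap j) -> schwartz (rgauss kap).
Proof.
move=> k0; have := gatom_schwartz 0 k0 (row_mx 0 0); congr schwartz.
by apply/funext => y; rewrite gatom_rgauss /echar mul0r cis0 mulr1 subr0.
Qed.

Lemma bounded_fun_cintegrable (F phi : V -> C) (B : R) : cmfun (fun s => F (row s)) ->
  (forall x, nc (F x) <= B) -> schwartz phi ->
  cintegrable (leb n) (fun s => F (row s) * phi (row s)).
Proof.
move=> mF FB sphi; apply: (cintegrable_le (q := fun s => B * nc (phi (row s)))).
- by apply: cmfunM => //; apply: schwartz_cmfun => // i; exact: measurable_coord.
- by apply: rintegrableZ; exact/cintegrable_norm/schwartz_cintegrable.
- by move=> s; rewrite Normc.normcM ler_wpM2r ?normc_ge0.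
Qed.

(** The integral of |phi| is controlled by the weight (1 + |x|)^(2n), hence by undifferentiated
    seminorms with monomials of degree at most 2n. *)
Lemma bounded_fun_tempered (F : V -> C) (B : R) : cmfun (fun s => F (row s)) ->
  (forall x, nc (F x) <= B) ->
  tempered (fun phi => cint (leb n) (fun s => F (row s) * phi (row s))).
Proof.
move=> mF FB; have B0 : 0 <= B by exact: le_trans (normc_ge0 _) (FB 0).
split=> [a f g sf sg|e e0].
  have fi := bounded_fun_cintegrable mF FB sf; have gi := bounded_fun_cintegrable mF FB sg.
  rewrite -cintZ// -cintD//; last exact: cintegrableZ.
  by congr cint; apply/funext => s; rewrite mulrDr mulrCA.
pose I := \int[leb n]_s jb (row s) ^- (2 * n).
have I0 : 0 <= I by apply: Rintegral_ge0 => s _; exact: ltW (jbV_gt0 _ _).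
(* [2 ^+ (2 * n)] comes from [jbX_split] and the other 2 from its two terms, each bounded by one
   seminorm. *)
pose K := B * (2 ^+ (2 * n) * 2) * I.
have K0 : 0 <= K by rewrite !mulr_ge0// exprn_ge0.
exists (2 * n)%N, (e / (K + 1)); first by rewrite divr_gt0// ltr_wpDl.
move=> phi sphi H; set d := e / (K + 1) in H.
have d0 : 0 < d by rewrite divr_gt0// ltr_wpDl.
have pt a x : (size a <= 2 * n)%N -> `|monomial a x| * nc (phi x) <= d.
  move=> an; rewrite -lee_fin; apply: ltW; apply: le_lt_trans (H a [::] an (leq0n _)).
  by apply: ereal_sup_ubound; exists x.
have pd x : nc (phi x) <= 2 ^+ (2 * n) * 2 * d * jb x ^- (2 * n).
  rewrite ler_pdivlMr ?jbX_gt0// mulrC.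
  apply: le_trans (ler_wpM2r (normc_ge0 _) (jbX_split _ _)) _.
  rewrite -!mulrA ler_wpM2l ?exprn_ge0// mulrDl mul1r [leRHS]mulrDl mul1r lerD//.
    by have := pt [::] x isT; rewrite /monomial big_nil normr1 mul1r.
  have [x0|[j xj]] := rV_norm_attained x.
    rewrite x0; apply: le_trans (_ : nc (phi x) <= d).
      by rewrite ler_piMl ?normc_ge0// expr0n; case: (_ == _)%N.
    by have := pt [::] x isT; rewrite /monomial big_nil normr1 mul1r.
  have := pt (nseq (2 * n) j) x; rewrite size_nseq leqnn => /(_ isT).
  by rewrite /monomial big_nseq -Monoid.iteropE -/(GRing.exp _ _) normrX xj.
apply: (@le_lt_trans _ _ (K * d)); last first.
  by rewrite /d mulrA ltr_pdivrMr ?ltr_wpDl// mulrC ltr_pM2l// ltrDl.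
have -> : K * d = \int[leb n]_s (B * (2 ^+ (2 * n) * 2) * d * jb (row s) ^- (2 * n)).
  by rewrite RintegralZl//; [rewrite /K mulrAC|exact: rintegrable_jbV].
apply: normc_cint_le; first exact: bounded_fun_cintegrable mF FB sphi.
  by apply: rintegrableZ; exact: rintegrable_jbV.
move=> s; rewrite Normc.normcM -[B * _ * d]mulrA -[leRHS]mulrA.
by apply: ler_pM; rewrite ?normc_ge0.
Qed.

(** Duality with L^1, applied to every representing function: each has norm at least the pairing
    divided by the L^1 norm of the test function. *)
Lemma Linfty_norm_lower (v : @functional R n) (phi : V -> C) (I D : R) : schwartz phi ->
  \int[leb n]_s nc (phi (row s)) = I -> 0 < I -> D * I <= nc (v phi) ->
  (D%:E <= Linfty_norm v)%E.
Proof.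
move=> sphi EI I0 Dv; apply: le_ereal_inf_tmp => _ [h [mh rep] <-].
set L := Lnorm _ _ _.
have L0 : (0 <= L)%E by exact: Lnorm_ge0.
case E : L L0 => [l| |] //=; rewrite ?leey//.
rewrite lee_fin => l0; rewrite lee_fin.
have ae : {ae lebesgue_Rn n, forall s, nc (h (row s)) <= l}.
  move: E; rewrite /L unlock /=; case: ifPn => [m0 E|]; last first.
    rewrite -leNgt => m0 _.
    exists setT; split => //; apply/eqP; rewrite eq_le measure_ge0 andbT; exact: m0.
  have := ess_sup_ge (lebesgue_Rn n) (abse \o (fun s => (nc (h (row s)))%:E)).
  rewrite E; apply: filterS => s; rewrite /= lee_fin; exact: le_trans (ler_norm _).
(* Cutting off on the null set where the essential bound fails gives a majorant valid at every
   point, as [normc_cint_le] requires. *)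
pose h' s : C := if nc (h (row s)) <= l then h (row s) else 0.
have mb : measurable_fun setT (fun s => nc (h (row s)) <= l).
  by apply: measurable_fun_ler => //; exact: (measurable_normc mh).
have mh' : cmfun h'.
  have Eg (g : C -> R) : g 0 = 0 -> (fun s => g (h' s)) = fun s => if nc (h (row s)) <= l then g (h (row s)) else 0.
    by move=> g0; apply/funext => s; rewrite /h'; case: ifP.
  by case: mh => m1 m2; split; rewrite Eg//; apply: measurable_fun_ifT => //; exact: measurable_cst.
have mphi : cmfun (fun s => phi (row s)) by apply: schwartz_cmfun => // i; exact: measurable_coord.
have iphi := cintegrable_norm (schwartz_cintegrable sphi).
have h'l s : nc (h' s * phi (row s)) <= l * nc (phi (row s)).
  rewrite Normc.normcM ler_wpM2r ?normc_ge0// /h'; case: ifP => // _.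
  by rewrite normc_real normr0.
have E2 : v phi = cint (leb n) (fun s => h' s * phi (row s)).
  rewrite (rep _ sphi); apply: cint_ae; [exact: cmfunM|exact: cmfunM|].
  by apply: filterS ae => s hs; rewrite /h' hs.
have le : nc (v phi) <= l * I.
  rewrite E2 -EI -RintegralZl//; apply: normc_cint_le => //; last exact: rintegrableZ.
  by apply: cintegrable_le h'l; [exact: cmfunM|exact: rintegrableZ].
by rewrite -(ler_pM2r I0); exact: le_trans Dv le.
Qed.

End LowerBoundTools.

(** * The focusing Gaussian and its test function *)

Section ChirpedGaussian.
Context {R : realType} {n : nat}.
Local Notation V := 'rV[R]_n.
Local Notation C := (R[i]).
Local Notation T := (n.-tuple (measurableTypeR R)).
Local Notation row := (@row_of_tuple R n).
Variables (hbar t alpha : R) (q : V).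
Hypothesis hbar_gt0 : 0 < hbar.
Hypothesis alpha_gt0 : 0 < alpha.
Hypothesis q_gt0 : forall j, 0 < q 0 j.
Local Notation lam := (hbar^-1).
Local Notation kap := (window_coef hbar q).

Lemma Im_qpoly (z w : 'I_n -> C) (x : V) :
  cIm (qpoly z w x) = \sum_j (- (cIm (z j) / 2 * x 0 j ^+ 2) + cIm (w j) * x 0 j).
Proof.
have h2 (c : C) : c / 2 = c * (2^-1 : R)%:C by rewrite fmorphV rmorph_nat.
rewrite /qpoly Im_sum; apply: eq_bigr => j _; rewrite h2.
by case: (z j) => a b; case: (w j) => c d /=; field.
Qed.

Definition chirp_den : R := alpha ^+ 2 + t ^+ 2.

Lemma chirp_den_gt0 : 0 < chirp_den.
Proof. by rewrite ltr_pwDl ?sqr_ge0// exprn_gt0. Qed.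

(* The number 1 / (hbar (alpha - i t)). *)
Definition chirp_coef : C := (lam * alpha / chirp_den) +i* (lam * t / chirp_den).

Lemma chirp_coefM : chirp_coef * (alpha +i* (- t)) = lam%:C.
Proof.
have d0 := chirp_den_gt0; rewrite /chirp_coef.
apply: complex_eqP; rewrite /= /chirp_den; field; rewrite ?gt_eqF//=; exact: d0.
Qed.

Lemma Re_chirp_coef_gt0 : 0 < cRe chirp_coef.
Proof. by rewrite /= divr_gt0 ?chirp_den_gt0// mulr_gt0// invr_gt0. Qed.

Definition chirped_gauss : @functional R n :=
  fun phi => cint (leb n) (fun s => qexp (fun=> chirp_coef) (fun=> 0) (row s) * phi (row s)).

Lemma chirp_qexp_le1 (x : V) : nc (qexp (fun=> chirp_coef) (fun=> 0) x) <= 1.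
Proof.
rewrite /qexp normc_cexp Re_qpoly -expR0 ler_expR; apply: sumr_le0 => j _.
by rewrite mul0r addr0 oppr_le0 mulr_ge0 ?sqr_ge0// divr_ge0// ltW// Re_chirp_coef_gt0.
Qed.

Lemma chirped_gauss_tempered : tempered chirped_gauss.
Proof. by apply: (bounded_fun_tempered _ chirp_qexp_le1); apply: qexp_cmfun => i; exact: measurable_coord. Qed.

(** The coefficient of xi^2 that is left when the exponent in [stft_exponent] is maximised over
    x. *)
Definition stft_decay (j : 'I_n) : R := lam * alpha / (1 + alpha * q 0 j).

Lemma stft_decay_gt0 j : 0 < stft_decay j.
Proof. by rewrite divr_gt0 ?mulr_gt0 ?invr_gt0// ltr_pwDl// mulr_ge0 ?ltW. Qed.

(* Completing the square: with p = 1 + alpha q and D = p^2 + q^2 t^2, the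
   difference of both sides is lam q (p x + t xi)^2 / (2 p D). *)
Lemma stft_exponent j (x xi : R) :
  cRe (((kap j * x) +i* (- (lam * xi))) ^+ 2 / (2 * (chirp_coef + (kap j)%:C))) -
    kap j / 2 * x ^+ 2 <= - (stft_decay j / 2 * xi ^+ 2).
Proof.
have qj := q_gt0 j; have d0 := chirp_den_gt0.
have p0 : 0 < 1 + alpha * q 0 j by rewrite ltr_pwDl// mulr_ge0 ?ltW.
pose p := 1 + alpha * q 0 j; pose D := p ^+ 2 + q 0 j ^+ 2 * t ^+ 2.
have D0 : 0 < D by apply: ltr_pwDl; [exact: exprn_gt0|rewrite mulr_ge0 ?sqr_ge0].
have -> : (2 * (chirp_coef + (kap j)%:C))^-1 =
    ((alpha * p + q 0 j * t ^+ 2) / D * hbar / 2) +i* (- t / D * hbar / 2) :> C.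
  apply: mulr1_eq; have -> : (2 : C) = (2 : R)%:C by rewrite rmorph_nat.
  rewrite /chirp_coef /window_coef; move: D0 d0; rewrite /D /p /chirp_den => D0 d0.
  apply: complex_eqP; rewrite /=; field; rewrite ?gt_eqF//=.
    by rewrite exprMn.
  by rewrite exprMn.
rewrite -subr_ge0 /window_coef /stft_decay -/p.
set X := (X in 0 <= X).
have -> : X = q 0 j * (p * x + t * xi) ^+ 2 / (2 * p * D * hbar).
  rewrite /X expr2 /= /D /p; move: D0; rewrite /D /p => D0; field.
  by rewrite !gt_eqF//= exprMn.
have pp : 0 < p := p0.
apply: divr_ge0; first by rewrite mulr_ge0 ?sqr_ge0 ?(ltW qj).
by rewrite !mulr_ge0 ?(ltW pp) ?(ltW D0) ?(ltW hbar_gt0).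
Qed.

Definition stft_peak : R := \prod_j Num.sqrt (2 * pi / nc (chirp_coef + (kap j)%:C)).

Lemma stft_peak_ge0 : 0 <= stft_peak.
Proof. by apply: prodr_ge0 => j _; exact: sqrtr_ge0. Qed.

Lemma chirped_gauss_gatom x xi :
  nc (chirped_gauss (gatom kap lam (row_mx x xi))) <=
  stft_peak * expR (- \sum_j (stft_decay j / 2 * xi 0 j ^+ 2)).
Proof.
pose w j : C := (kap j * x 0 j) +i* (- (lam * xi 0 j)).
have kap0 := window_coef_gt0 hbar_gt0 q_gt0.
have z0 j : 0 < cRe (chirp_coef + (kap j)%:C) by rewrite ReD addr_gt0 ?Re_chirp_coef_gt0//; exact: kap0.
have E : chirped_gauss (gatom kap lam (row_mx x xi)) =
    (expR (- \sum_j (kap j / 2 * x 0 j ^+ 2)))%:C * qint (fun j => chirp_coef + (kap j)%:C) w.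
  rewrite -cintZ; last exact: qexp_cintegrable.
  congr cint; apply/funext => s; rewrite /qexp /gatom gexpE -cexp_real -!cexpD; congr cexp.
  apply: complex_eqP; rewrite ?(ReD, ImD) ?Re_qpoly ?Im_qpoly /=.
    rewrite -!sumrN -!big_split /=; apply: eq_bigr => j _; field.
    by rewrite !gt_eqF ?chirp_den_gt0.
  rewrite dotE mulr_sumr -sumrN add0r -!big_split /=; apply: eq_bigr => j _; field.
  by rewrite !gt_eqF ?chirp_den_gt0.
rewrite E Normc.normcM normc_real ger0_norm ?expR_ge0// normc_qint// mulrCA.
rewrite ler_wpM2l ?stft_peak_ge0//.
rewrite -expRD ler_expR -!sumrN -big_split; apply: ler_sum => j _ /=.
by rewrite addrC; exact: stft_exponent.
Qed.

Lemma chirped_gauss_Minfty1 :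
  (Minfty1_norm hbar (gauss_window hbar (diag_mx q)) chirped_gauss <=
   (@fcst R n hbar ^+ 2 * stft_peak * rmass stft_decay)%:E)%E.
Proof.
have tu := chirped_gauss_tempered.
have [ig Eg] := gauss_integral_rV stft_decay_gt0.
have c0 : 0 <= @fcst R n hbar ^+ 2 * stft_peak by rewrite mulr_ge0 ?sqr_ge0 ?stft_peak_ge0.
have -> : (@fcst R n hbar ^+ 2 * stft_peak * rmass stft_decay)%:E =
  (\int[leb n]_s (@fcst R n hbar ^+ 2 * stft_peak *
    expR (- \sum_j (stft_decay j / 2 * row s 0 j ^+ 2)))%:E)%E.
  rewrite /rmass -Eg -RintegralZl// /Rintegral fineK//; apply: integrable_fin_num => //.
  exact: rintegrableZ.
rewrite (Minfty1_normE hbar_gt0 q_gt0 tu); apply: ge0_le_integral => //.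
- move=> s _; apply: ereal_sup_ge; exists (stft_profile hbar q chirped_gauss (row_mx 0 (row s)))%:E.
    by exists 0.
  by rewrite lee_fin normc_ge0.
- exact: (measurable_slice_sup (stft_profile_cont hbar_gt0 q_gt0 tu)).
- by apply/measurable_EFinP; exact: (rintegrable_measurable (rintegrableZ _ ig)).
- move=> s _; apply: ge_ereal_sup => _ [x _ <-]; rewrite lee_fin /stft_profile.
  rewrite Normc.normcM normc_real ger0_norm ?sqr_ge0// -mulrA ler_wpM2l ?sqr_ge0//.
  exact: chirped_gauss_gatom.
Qed.

(** Variance hbar alpha^2, against hbar alpha for the focused Gaussian: the test function sees only
    the peak, at the cost of a factor (1 + alpha)^(-1/2) per coordinate. *)
Definition test_coef : R := lam / alpha ^+ 2.

Lemma test_coef_gt0 : 0 < test_coef.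
Proof. by rewrite divr_gt0 ?invr_gt0 ?exprn_gt0. Qed.

Definition test_gauss : V -> C := rgauss (fun=> test_coef).

Lemma test_gauss_schwartz : schwartz test_gauss.
Proof. by apply: rgauss_schwartz => j; exact: test_coef_gt0. Qed.

Lemma chirped_gauss_test (kp : 'I_n -> R) : (forall j, 0 < kp j) ->
  chirped_gauss (rgauss kp) = qint (fun j => chirp_coef + (kp j)%:C) (fun=> 0).
Proof.
move=> kp0; congr cint; apply/funext => s; rewrite /rgauss /qexp -cexpD; congr cexp.
by rewrite /qpoly -big_split; apply: eq_bigr => j _ /=; ring.
Qed.

(* The exponent of the propagated test function before integration. *)
Definition test_freq : C := (lam * alpha ^+ 2) +i* (lam * t).

Lemma test_freq_neq0 : test_freq != 0.
Proof.
by rewrite -normc_gt0 (lt_le_trans _ (Re_le_normc _))//= mulr_gt0 ?exprn_gt0 ?invr_gt0.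
Qed.

(** Multiplication by alpha - i t clears the denominator of [chirp_coef]. Moduli can then be
    compared through |alpha - i t|, which cancels in the final ratio, without being computed. *)
Lemma test_product : test_freq * (chirp_coef + (lam ^+ 2)%:C / test_freq) * (alpha +i* (- t)) =
  (lam ^+ 2 * (alpha + alpha ^+ 2))%:C.
Proof.
rewrite mulrDr mulrCA mulfV ?test_freq_neq0// mulr1 mulrDl -mulrA chirp_coefM.
by rewrite /test_freq; apply: complex_eqP; rewrite /=; ring.
Qed.

Lemma Re_test_coef2 : 0 < cRe ((lam ^+ 2)%:C / test_freq).
Proof.
have l0 : 0 < lam by rewrite invr_gt0.
have -> : (lam ^+ 2)%:C / test_freq =
    (lam * alpha ^+ 2 / (alpha ^+ 4 + t ^+ 2)) +i* (- (lam * t) / (alpha ^+ 4 + t ^+ 2)).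
  have e0 : 0 < alpha ^+ 4 + t ^+ 2 by rewrite ltr_pwDl ?sqr_ge0 ?exprn_gt0.
  apply: (mulIf test_freq_neq0); rewrite mulfVK ?test_freq_neq0// /test_freq.
  apply: complex_eqP; rewrite /=; field; rewrite ?gt_eqF//=; exact: e0.
rewrite /= divr_gt0 ?mulr_gt0 ?exprn_gt0// ltr_pwDl ?sqr_ge0// exprn_gt0//.
Qed.

(** The transform of the test function is a Gaussian of coefficient lam alpha^2, the chirp adds i
    lam t to it, and transforming back gives the coefficient lam^2 / [test_freq], which is then
    added to that of f. *)
Lemma propagator_test : propagator hbar t chirped_gauss test_gauss =
  (@fcst R n hbar ^+ 2 * rmass (fun _ : 'I_n => test_coef))%:C *
  (qint (fun _ : 'I_n => test_freq) (fun=> 0) *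
   qint (fun _ : 'I_n => chirp_coef + (lam ^+ 2)%:C / test_freq) (fun=> 0)).
Proof.
have l0 : lam != 0 by rewrite invr_neq0// gt_eqF.
have lp : 0 < lam by rewrite invr_gt0.
rewrite propagatorE//; last exact: test_gauss_schwartz.
pose m : R := lam * alpha ^+ 2.
have m0 : 0 < m by rewrite mulr_gt0// exprn_gt0.
have bE : (fun _ : 'I_n => test_coef) = fun=> lam ^+ 2 / m.
  by apply/funext => _; rewrite /test_coef /m; field; rewrite !gt_eqF.
have hatE xi : hat lam test_gauss xi = (rmass (fun _ : 'I_n => test_coef))%:C * rgauss (fun=> m) xi.
  by rewrite /hat /test_gauss bE rgauss_fourier.
have inner y : (@fcst R n hbar ^+ 2)%:C * cint (leb n) (fun s => chirp (- (lam * t / 2)) (row s) *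
    echar lam (- row s) y * hat lam test_gauss (row s)) =
    (@fcst R n hbar ^+ 2 * rmass (fun _ : 'I_n => test_coef))%:C * qint (fun _ : 'I_n => test_freq) (fun=> 0) *
    qexp (fun=> (lam ^+ 2)%:C / test_freq) (fun=> 0) y.
  rewrite [(_ * rmass _)%:C]rmorphM -!mulrA; congr (_ * _).
  transitivity (cint (leb n) (fun s => (rmass (fun _ : 'I_n => test_coef))%:C *
     qexp (fun=> test_freq) (fun j => 0 +i* (- (lam * y 0 j))) (row s))).
    congr cint; apply/funext => s; rewrite hatE mulrCA; congr (_ * _).
    rewrite rgaussE -cexp_real /chirp /echar !cis_cexp -!cexpD; congr cexp.
    apply: complex_eqP; rewrite ?(ReD, ImD) ?Re_qpoly ?Im_qpoly /=.
      by rewrite !add0r -sumrN; apply: eq_bigr => j _; rewrite mul0r addr0.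
    rewrite addr0 !dotE !mulr_sumr -big_split /=; apply: eq_bigr => j _; rewrite !mxE.
    by field; rewrite gt_eqF.
  rewrite cintZ; last by apply: qexp_cintegrable => j; rewrite /= mulr_gt0// exprn_gt0.
  congr (_ * _); rewrite -/(qint _ _) qint_shift; last by move=> j; rewrite /= mulr_gt0// exprn_gt0.
  rewrite /qexp; congr (_ * cexp _); apply: eq_bigr => j _.
  have sq : (0 +i* (- (lam * y 0 j))) ^+ 2 = - ((lam ^+ 2)%:C * ((y 0 j)%:C * (y 0 j)%:C)) :> C.
    by rewrite expr2; apply: complex_eqP; rewrite /=; ring.
  rewrite sq mul0r addr0; move: test_freq_neq0.
  by move: test_freq ((lam ^+ 2)%:C) ((y 0 j)%:C) => F L Y F0; field.
rewrite (_ : (fun y => _) = fun y => (@fcst R n hbar ^+ 2 * rmass (fun _ : 'I_n => test_coef))%:C *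
    qint (fun _ : 'I_n => test_freq) (fun=> 0) * qexp (fun=> (lam ^+ 2)%:C / test_freq) (fun=> 0) y); last first.
  by apply/funext => y; exact: inner.
rewrite /chirped_gauss [RHS]mulrA.
transitivity (cint (leb n) (fun s => (@fcst R n hbar ^+ 2 * rmass (fun _ : 'I_n => test_coef))%:C *
    qint (fun _ : 'I_n => test_freq) (fun=> 0) *
    qexp (fun=> chirp_coef + (lam ^+ 2)%:C / test_freq) (fun=> 0) (row s))).
  congr cint; apply/funext => s; rewrite mulrCA; congr (_ * _).
  rewrite /qexp -cexpD; congr cexp; rewrite /qpoly -big_split; apply: eq_bigr => j _ /=.
  by ring.
rewrite cintZ//; apply: qexp_cintegrable => j.
by rewrite ReD addr_gt0 ?Re_chirp_coef_gt0 ?Re_test_coef2.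
Qed.

(** The modulus of the pairing in [propagator_test] after division by the L^1 norm of the test
    function. *)
Definition propagated_peak : R := @fcst R n hbar ^+ 2 * \prod_(j < n) (Num.sqrt (2 * pi / nc test_freq) *
  Num.sqrt (2 * pi / nc (chirp_coef + (lam ^+ 2)%:C / test_freq))).

Lemma propagated_peak_le :
  (propagated_peak%:E <= Linfty_norm (propagator hbar t chirped_gauss))%E.
Proof.
have b0 (j : 'I_n) : 0 < test_coef by exact: test_coef_gt0.
have r0 : 0 < rmass (fun _ : 'I_n => test_coef) by exact: rmass_gt0.
apply: (Linfty_norm_lower test_gauss_schwartz (I := rmass (fun _ : 'I_n => test_coef))) => //.
  have [<- _] := rgauss_integral b0 (0 : V); congr Rintegral; apply/funext => s.
  by rewrite sub0r rgaussN.
rewrite propagator_test Normc.normcM normc_real ger0_norm; last by rewrite mulr_ge0 ?sqr_ge0 ?ltW.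
have l0 : 0 < lam by rewrite invr_gt0.
have f0 (j : 'I_n) : 0 < cRe test_freq by rewrite /= mulr_gt0// exprn_gt0.
have g0 (j : 'I_n) : 0 < cRe (chirp_coef + (lam ^+ 2)%:C / test_freq).
  by rewrite ReD addr_gt0 ?Re_chirp_coef_gt0 ?Re_test_coef2.
rewrite Normc.normcM !normc_qint//.
have e0 (z : C) : expR (\sum_(j < n) cRe ((0 : C) ^+ 2 / z)) = 1.
  by rewrite big1 ?expR0// => j _; rewrite expr0n mul0r.
by rewrite !e0 !mulr1 /propagated_peak big_split /= mulrAC.
Qed.

(** An identity under one square root per coordinate. The factor 1 + alpha comes from alpha +
    alpha^2 in [test_product], the factor 1 + alpha q_j from [stft_decay], and the numerator from
    the peak of the short-time transform of f. *)
Lemma chirp_ratio :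
  propagated_peak = (@fcst R n hbar ^+ 2 * stft_peak * rmass stft_decay) *
    \prod_j Num.sqrt (nc ((1 + alpha * q 0 j) +i* (- (t * q 0 j))) / ((1 + alpha) * (1 + alpha * q 0 j))).
Proof.
have Ej j : Num.sqrt (2 * pi / nc test_freq) *
    Num.sqrt (2 * pi / nc (chirp_coef + (lam ^+ 2)%:C / test_freq)) =
    Num.sqrt (2 * pi / nc (chirp_coef + (kap j)%:C)) * (Num.sqrt (2 * pi / stft_decay j) *
    Num.sqrt (nc ((1 + alpha * q 0 j) +i* (- (t * q 0 j))) / ((1 + alpha) * (1 + alpha * q 0 j)))).
  have qj := q_gt0 j; have l0 : 0 < lam by rewrite invr_gt0.
  have aq : 0 < 1 + alpha * q 0 j by rewrite ltr_pwDl// mulr_ge0 ?ltW.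
  have pp : 0 < 2 * (pi : R) by rewrite mulr_gt0// pi_gt0.
  pose s : C := alpha +i* (- t).
  have s0 : 0 < nc s by rewrite (lt_le_trans _ (Re_le_normc _)).
  have f0 : 0 < nc test_freq by rewrite normc_gt0 test_freq_neq0.
  have c0 : 0 < nc (chirp_coef + (lam ^+ 2)%:C / test_freq).
    by rewrite (lt_le_trans _ (Re_le_normc _))// ReD addr_gt0 ?Re_chirp_coef_gt0 ?Re_test_coef2.
  have k0 : 0 < nc (chirp_coef + (kap j)%:C).
    by rewrite (lt_le_trans _ (Re_le_normc _))// ReD addr_gt0 ?Re_chirp_coef_gt0//; exact: window_coef_gt0.
  have E1 : nc test_freq * nc (chirp_coef + (lam ^+ 2)%:C / test_freq) * nc s = lam ^+ 2 * (alpha + alpha ^+ 2).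
    rewrite -!Normc.normcM test_product normc_real ger0_norm// mulr_ge0 ?sqr_ge0// addr_ge0 ?sqr_ge0 ?ltW//.
  have E2 : nc (chirp_coef + (kap j)%:C) * nc s = lam * nc ((1 + alpha * q 0 j) +i* (- (t * q 0 j))).
    have -> : lam = nc (lam%:C) by rewrite normc_real gtr0_norm.
    rewrite -!Normc.normcM mulrDl chirp_coefM; congr nc.
    by rewrite /window_coef; apply: complex_eqP; rewrite /=; ring.
  have sq (x y : R) : 0 <= x -> Num.sqrt x * Num.sqrt y = Num.sqrt (x * y) by move=> ?; rewrite sqrtrM.
  have d0 := stft_decay_gt0 j.
  rewrite sq ?divr_ge0 ?ltW// [RHS]mulrA sq ?divr_ge0 ?ltW// sq; last first.
    by rewrite mulr_ge0// divr_ge0// ltW.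
  congr Num.sqrt.
  have -> : nc ((1 + alpha * q 0 j) +i* (- (t * q 0 j))) = nc (chirp_coef + (kap j)%:C) * nc s / lam.
    by rewrite E2 [RHS]mulrC mulKf// gt_eqF.
  have -> : nc s = lam ^+ 2 * (alpha + alpha ^+ 2) / (nc test_freq * nc (chirp_coef + (lam ^+ 2)%:C / test_freq)).
    by rewrite -E1 [RHS]mulrC mulKf// gt_eqF// mulr_gt0.
  rewrite /stft_decay; move: (2 * pi : R) pp f0 c0 k0 => P pp.
  move: (nc (chirp_coef + (lam ^+ 2)%:C / test_freq)) (nc test_freq) (nc (chirp_coef + (kap j)%:C)) =>
    Y X Z X0 Y0 Z0.
  have a1 : 0 < 1 + alpha by rewrite addr_gt0.
  by field; rewrite !gt_eqF.
rewrite /propagated_peak (eq_bigr _ (fun j _ => Ej j)) big_split big_split.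
by rewrite /stft_peak /rmass -[in RHS]mulrA -[RHS]mulrA.
Qed.

(** The Gaussian window itself witnesses membership, and nonvanishing is read off the explicit
    positive modulus of the pairing with a Gaussian. *)
Lemma chirped_gauss_in_Minfty1 : Minfty1 hbar chirped_gauss /\ nonzero chirped_gauss.
Proof.
have kap0 := window_coef_gt0 hbar_gt0 q_gt0.
split; last first.
  exists test_gauss; first exact: test_gauss_schwartz.
  have b0 (j : 'I_n) : 0 < test_coef by exact: test_coef_gt0.
  rewrite /test_gauss chirped_gauss_test// -normc_gt0 normc_qint => [|j]; last first.
    by rewrite ReD addr_gt0 ?Re_chirp_coef_gt0//; exact: b0.
  rewrite mulr_gt0 ?expR_gt0// prodr_gt0// => j _; rewrite sqrtr_gt0 divr_gt0 ?mulr_gt0 ?pi_gt0//.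
  by rewrite (lt_le_trans _ (Re_le_normc _))// ReD addr_gt0 ?Re_chirp_coef_gt0//; exact: (b0 j).
split; first exact: chirped_gauss_tempered.
exists (gauss_window hbar (diag_mx q)); split.
- have := schwartz_comb (@fcst R n hbar)%:C (rgauss_schwartz kap0) (schwartz0 (R := R) (n := n)).
  by congr schwartz; apply/funext => x; rewrite addr0 gauss_windowE.
- exists 0; rewrite gauss_windowE// mulf_neq0//.
    by rewrite -normc_gt0 normc_real normr_gt0 gt_eqF// fcst_gt0.
  by rewrite /rgauss /qexp cexp_neq0.
- exact: le_lt_trans chirped_gauss_Minfty1 (ltry _).
Qed.

Lemma chirp_lower_bound :
  ((\prod_j Num.sqrt (nc ((1 + alpha * q 0 j) +i* (- (t * q 0 j))) /
      ((1 + alpha) * (1 + alpha * q 0 j))))%:E <=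
   Linfty_norm (propagator hbar t chirped_gauss) /
   Minfty1_norm hbar (gauss_window hbar (diag_mx q)) chirped_gauss)%E.
Proof.
set P := \prod_j _; set L := Linfty_norm _; set N := Minfty1_norm _ _ _.
pose B := @fcst R n hbar ^+ 2 * stft_peak * rmass stft_decay.
have kap0 := window_coef_gt0 hbar_gt0 q_gt0.
have B0 : 0 < B.
  rewrite /B !mulr_gt0 ?fcst_gt0//; last exact/rmass_gt0/stft_decay_gt0.
  rewrite prodr_gt0// => j _; rewrite sqrtr_gt0 divr_gt0 ?mulr_gt0 ?pi_gt0//.
  by rewrite (lt_le_trans _ (Re_le_normc _))// ReD addr_gt0 ?Re_chirp_coef_gt0//; exact: kap0.
have NB : (N <= B%:E)%E by exact: chirped_gauss_Minfty1.
have LB : ((B * P)%:E <= L)%E by rewrite /B /P -chirp_ratio; exact: propagated_peak_le.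
have N0 : (0 <= N)%E by exact: Minfty1_norm_ge0.
have P0 : 0 <= P by apply: prodr_ge0 => j _; exact: sqrtr_ge0.
have Nfin : N \is a fin_num by rewrite ge0_fin_numE//; exact: le_lt_trans NB (ltry _).
(* If the norm were 0, its inverse would be +oo, and the quotient +oo as soon as L > 0. *)
have [Nz|Nnz] := eqVneq (fine N) 0.
  rewrite -(fineK Nfin) Nz inver eqxx.
  have [->|Pn] := eqVneq P 0; first by rewrite mule_ge0// Linfty_norm_ge0.
  rewrite gt0_muley ?leey//; apply: lt_le_trans LB; rewrite lte_fin mulr_gt0// lt_neqAle eq_sym Pn.
  exact: P0.
have Np : 0 < fine N by rewrite lt_neqAle eq_sym Nnz fine_ge0.
rewrite -(fineK Nfin) inver (negbTE Nnz) lee_pdivlMr//.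
apply: le_trans LB; rewrite -EFinM lee_fin mulrC ler_wpM2r//.
by rewrite -lee_fin fineK.
Qed.

End ChirpedGaussian.

Theorem theorem4p3 (R : realType) (hbar : R) (n : nat) (t : R) (q : 'rV[R]_n)
    (hbar_gt0 : 0 < hbar) (hbar_le1 : hbar <= 1) (n_gt0 : (0 < n)%N)
    (t_neq0 : t != 0) (q_gt0 : forall j : 'I_n, 0 < q 0 j) :
  ereal_sup
    [set (Linfty_norm (propagator hbar t f) /
          Minfty1_norm hbar (gauss_window hbar (diag_mx q)) f)%E
    | f in [set f : functional | Minfty1 hbar f /\ nonzero f]] =
  (\prod_(j < n) (t ^+ 2 * (q 0 j) ^+ 2 + 1) `^ (1 / 4))%:E.
Proof.
apply/eqP; rewrite eq_le -/(sharp_cst t q); apply/andP; split.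
  by apply: ge_ereal_sup => _ [f [[tf _] _] <-]; exact: propagator_upper.
set S := ereal_sup _.
have low a (a0 : 0 < a) := le_trans (chirp_lower_bound t hbar_gt0 a0 q_gt0)
  (ereal_sup_ubound (S := [set (Linfty_norm (propagator hbar t f) /
      Minfty1_norm hbar (gauss_window hbar (diag_mx q)) f)%E
    | f in [set f : functional | Minfty1 hbar f /\ nonzero f]])
    (ex_intro2 _ _ _ (chirped_gauss_in_Minfty1 t hbar_gt0 a0 q_gt0) erefl)).
(* The value +oo satisfies the bound trivially, -oo is excluded by alpha = 1, and a finite supremum
   is treated by the limit alpha to 0. *)
rewrite -/S in low; case: S low => [r| |] low; rewrite ?leey//; last by have := low 1 ltr01.
rewrite lee_fin; apply: (@le_expR_limit _ _ _ (n%:R + \sum_j q 0 j)).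
- by rewrite addr_ge0// sumr_ge0// => j _; exact: ltW.
- exact: sharp_cst_ge0.
- move=> a a0; apply: le_trans (sharp_cst_lower t q_gt0 a0) _.
  by rewrite ler_wpM2l ?expR_ge0// -lee_fin low.
Qed.
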